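(* Let $d\ge 2$ and let $\Omega\subset\mathbb{R}^d$ be a bounded, connected, open set with boundary $\Gamma$, let $\sigma$ be the $(d-1)$-dimensional Hausdorff measure on $\Gamma$, and assume $\sigma(\Gamma)<\infty$. Let $D_0$ be the Dirichlet-to-Neumann operator on $L_2(\Gamma)$. Then the $C_0$-semigroup $S=(S_t)_{t>0}$ on $L_2(\Gamma)$ generated by $-D_0$ is markovian, i.e. $S_t\ge0$ (that is, $S_t\varphi\ge 0$ a.e. whenever $\varphi\in L_2(\Gamma)$ and $\varphi\ge0$ a.e.) and $S_t\mathbb{1}_\Gamma=\mathbb{1}_\Gamma$ for all $t>0$.
   Context: All spaces are real. $L_2(\Gamma)=L_2(\Gamma,\sigma)$, $H^1(\Omega)$ is the Sobolev space with norm $\|u\|_{H^1(\Omega)}^2=\int_\Omega|u|^2+\int_\Omega|\nabla u|^2$, and $H^1(\Omega)\cap C(\overline\Omega)$ is the set of $u\in C(\overline\Omega)$ whose restriction to $\Omega$ lies in $H^1(\Omega)$. The operator $\Delta$ is the distributional Laplacian on $\Omega$. Trace: for $u\in H^1(\Omega)$, a function $\varphi\in L_2(\Gamma)$ is called a trace of $u$ if there is a sequence $(u_n)$ in $H^1(\Omega)\cap C(\overline\Omega)$ with $\lim u_n=u$ in $H^1(\Omega)$ and $\lim u_n|_\Gamma=\varphi$ in $L_2(\Gamma)$. Normal derivative: let $u\in H^1(\Omega)$ with $\Delta u\in L_2(\Omega)$. Then $u$ has a normal derivative in $L_2(\Gamma)$ if there is a (necessarily unique) $\psi\in L_2(\Gamma)$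 such that $\int_\Omega(\Delta u)\,v+\int_\Omega\nabla u\cdot\nabla v=\int_\Gamma\psi\,v\,d\sigma$ for all $v\in H^1(\Omega)\cap C(\overline\Omega)$; then $\frac{\partial u}{\partial\nu}:=\psi$. Dirichlet-to-Neumann operator: for $\varphi,\psi\in L_2(\Gamma)$ one has $\varphi\in D(D_0)$ and $D_0\varphi=\psi$ if and only if there is a $u\in H^1(\Omega)$ such that $\Delta u=0$, $\varphi$ is a trace of $u$, and $u$ has a normal derivative in $L_2(\Gamma)$ with $\frac{\partial u}{\partial\nu}=\psi$. This defines a single-valued, positive, self-adjoint operator on $L_2(\Gamma)$, so $-D_0$ generates a $C_0$-semigroup. *)

(* Defs.v *)
From HB Require Import structures.
From mathcomp Require Import all_boot all_order all_algebra.
From mathcomp Require Import all_classical all_reals all_analysis.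
From mathcomp Require Import measurable_realfun.
Set Implicit Arguments.
Unset Strict Implicit.
Unset Printing Implicit Defensive.
Import Order.TTheory GRing.Theory Num.Theory.
Import numFieldTopology.Exports numFieldNormedType.Exports.
Local Open Scope classical_set_scope.
Local Open Scope ring_scope.

Section covering_outer_measure.
Local Open Scope ereal_scope.
Context {R : realType} {T : pointedType}.

(* [mu_ext] asks for covers by measurable sets; over the power set sigma-algebra
   every countable cover is admitted. *)
Definition cover_ext (zeta : set T -> \bar R) : set T -> \bar R :=
  @mu_ext _ (g_sigma_algebraType [set: set T]) R zeta.

Section gauge.
Variable zeta : set T -> \bar R.
Hypotheses (zeta0 : zeta set0 = 0) (zeta_ge0 : forall A, 0 <= zeta A).

Lemma cover_ext0 : cover_ext zeta set0 = 0.
Proof. exact: mu_ext0. Qed.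

Lemma cover_ext_ge0 A : 0 <= cover_ext zeta A.
Proof. exact: mu_ext_ge0. Qed.

Lemma le_cover_ext : {homo cover_ext zeta : A B / A `<=` B >-> A <= B}.
Proof. by move=> A B AB; apply: (@le_mu_ext _ (g_sigma_algebraType [set: set T])). Qed.

Lemma cover_ext_sigma_subadditive : sigma_subadditive (cover_ext zeta).
Proof.
exact: (@mu_ext_sigma_subadditive _ (g_sigma_algebraType [set: set T]) R zeta).
Qed.

End gauge.

Definition outer_restr (mu : set T -> \bar R) (D A : set T) := mu (A `&` D).

Section outer_restr.
Variables (mu : {outer_measure set T -> \bar R}) (D : set T).

Let outer_restr0 : outer_restr mu D set0 = 0.
Proof. by rewrite /outer_restr set0I outer_measure0. Qed.

Let outer_restr_ge0 A : 0 <= outer_restr mu D A.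
Proof. exact: outer_measure_ge0. Qed.

Let le_outer_restr : {homo outer_restr mu D : A B / A `<=` B >-> A <= B}.
Proof. by move=> A B AB; apply: le_outer_measure; exact: setSI. Qed.

Let outer_restr_sigma_subadditive : sigma_subadditive (outer_restr mu D).
Proof.
by move=> F; rewrite /outer_restr setI_bigcupl; exact: outer_measure_sigma_subadditive.
Qed.

HB.instance Definition _ := isOuterMeasure.Build R T (outer_restr mu D)
  outer_restr0 outer_restr_ge0 le_outer_restr outer_restr_sigma_subadditive.

End outer_restr.

Definition cara_measure (mu : {outer_measure set T -> \bar R}) :
    {measure set (caratheodory_type mu) -> \bar R} :=
  [the {measure set (caratheodory_type mu) -> \bar R} of
     (mu : set (caratheodory_type mu) -> \bar R)].

End covering_outer_measure.

Section lebesgue.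
Local Open Scope ereal_scope.
Context (R : realType) (d : nat).
Let E := 'rV[R]_d.

Definition box (a b : E) : set E := [set x | forall i, (a 0 i < x 0 i <= b 0 i)%R].

(* +oo on the sets that are not boxes *)
Definition box_volume (A : set E) : \bar R :=
  ereal_inf [set v | (A = set0 /\ v = 0) \/
    exists a b : E, [/\ forall i, (a 0 i <= b 0 i)%R, A = box a b &
                        v = (\prod_i (b 0 i - a 0 i))%:E]].

Let box_volume_ge0 A : 0 <= box_volume A.
Proof.
apply: le_ereal_inf_tmp => _ [[_ ->]//|[a [b [ab _ ->]]]].
by rewrite lee_fin prodr_ge0// => i _; rewrite subr_ge0.
Qed.

Let box_volume0 : box_volume set0 = 0.
Proof.
apply/eqP; rewrite eq_le box_volume_ge0 andbT.
by apply: ereal_inf_lbound; left.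
Qed.

Definition lebesgue_outer : set E -> \bar R := cover_ext box_volume.

HB.instance Definition _ := isOuterMeasure.Build R E lebesgue_outer
  (cover_ext0 box_volume0 box_volume_ge0) (cover_ext_ge0 box_volume_ge0)
  (@le_cover_ext _ _ box_volume)
  (cover_ext_sigma_subadditive box_volume_ge0).

End lebesgue.

Section hausdorff.
Local Open Scope ereal_scope.
Context (R : realType) (d s : nat).
Let E := 'rV[R]_d.

(* The library norm on ['rV_d] is the sup norm; the metric here is Euclidean. *)
Definition eucl_dist (x y : E) : R := Num.sqrt (\sum_i (x 0 i - y 0 i) ^+ 2).

Definition diam (A : set E) : \bar R :=
  ereal_sup [set (eucl_dist x y)%:E | x in A & y in A].

Definition unit_ball_volume (m : nat) : \bar R :=
  lebesgue_outer [set x : 'rV[R]_m | (\sum_i x 0 i ^+ 2 <= 1)%R].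

Definition hausdorff_gauge (delta : R) (A : set E) : \bar R :=
  if A == set0 then 0 else
  if diam A <= delta%:E then
    unit_ball_volume s * ((fine (diam A) / 2) ^+ s)%:E
  else +oo.

Let hausdorff_gauge_ge0 delta A : 0 <= hausdorff_gauge delta A.
Proof.
rewrite /hausdorff_gauge; case: eqVneq => // /set0P[x Ax].
case: ifPn => // _; apply: mule_ge0; first exact: outer_measure_ge0.
rewrite lee_fin exprn_ge0// divr_ge0// fine_ge0//.
apply: (@le_trans _ _ (eucl_dist x x)%:E); first by rewrite lee_fin sqrtr_ge0.
by apply: ereal_sup_ubound; exists x => //; exists x.
Qed.

Let hausdorff_gauge0 delta : hausdorff_gauge delta set0 = 0.
Proof. by rewrite /hausdorff_gauge eqxx. Qed.

(* Normalised so that it is the surface area on s-dimensional surfaces. *)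
Definition hausdorff_outer (A : set E) : \bar R :=
  ereal_sup [set cover_ext (hausdorff_gauge delta) A | delta in [set e | (0 < e)%R]].

Let le_hausdorff delta A : (0 < delta)%R ->
  cover_ext (hausdorff_gauge delta) A <= hausdorff_outer A.
Proof. by move=> delta0; apply: ereal_sup_ubound; exists delta. Qed.

Let hausdorff_outer_ge0 A : 0 <= hausdorff_outer A.
Proof.
by apply: le_trans (@le_hausdorff 1%R A ltr01); apply: cover_ext_ge0.
Qed.

Let hausdorff_outer0 : hausdorff_outer set0 = 0.
Proof.
apply/eqP; rewrite eq_le hausdorff_outer_ge0 andbT.
apply: ge_ereal_sup => _ [delta _ <-].
by rewrite (cover_ext0 (hausdorff_gauge0 _) (hausdorff_gauge_ge0 _)).
Qed.

Let le_hausdorff_outer : {homo hausdorff_outer : A B / A `<=` B >-> A <= B}.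
Proof.
move=> A B AB; apply: ge_ereal_sup => _ [delta delta0 <-].
by apply: le_trans (@le_hausdorff _ B delta0); apply: le_cover_ext.
Qed.

Let hausdorff_outer_sigma_subadditive : sigma_subadditive hausdorff_outer.
Proof.
move=> F; apply: ge_ereal_sup => _ [delta delta0 <-].
apply: le_trans (cover_ext_sigma_subadditive (hausdorff_gauge_ge0 _) _) _.
apply: lee_nneseries => [k _ _|k _]; last exact: le_hausdorff.
exact: cover_ext_ge0.
Qed.

HB.instance Definition _ := isOuterMeasure.Build R E hausdorff_outer
  hausdorff_outer0 hausdorff_outer_ge0 le_hausdorff_outer
  hausdorff_outer_sigma_subadditive.

End hausdorff.
Arguments hausdorff_outer {R d} s A.

(* Square-integrable functions; the elements of the Hilbert space L_2(mu) are their
   classes for [_ = _ %[ae mu]], and equality in L_2(mu) is always written that way. *)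
Notation L2 mu := (LfunType mu (lee1n 2)).

Section semigroup.
Context d (T : measurableType d) (R : realType).
Variable mu : {measure set T -> \bar R}.

Definition L2norm (f : L2 mu) : R := fine 'N[mu]_2%:E[EFin \o f].

(* A linear operator, possibly not everywhere defined, is given by its graph. *)
Definition opp_graph (A : L2 mu -> L2 mu -> Prop) : L2 mu -> L2 mu -> Prop :=
  fun f g => A f (- g).

(* The value of [S] at [t <= 0] is irrelevant. *)
Record C0_semigroup (S : R -> L2 mu -> L2 mu) : Prop := {
  C0_linear : forall t, 0 < t -> forall (a : R) (f g : L2 mu),
    S t (a *: f + g) = (a *: S t f + S t g : L2 mu) %[ae mu] ;
  C0_bounded : forall t, 0 < t ->
    exists C : R, forall f : L2 mu, L2norm (S t f) <= C * L2norm f ;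
  C0_add : forall s t, 0 < s -> 0 < t -> forall f,
    S (s + t) f = S s (S t f) %[ae mu] ;
  C0_cvg0 : forall f, L2norm (S t f - f) @[t --> 0^'+] --> (0 : R) ;
  C0_continuous : forall f t, 0 < t ->
    L2norm (S s f - S t f) @[s --> t] --> (0 : R)
}.

Definition is_generator (S : R -> L2 mu -> L2 mu) (A : L2 mu -> L2 mu -> Prop) : Prop :=
  forall f g, A f g <->
    L2norm (t^-1 *: (S t f - f) - g) @[t --> 0^'+] --> (0 : R).

Definition markovian (one : L2 mu) (S : R -> L2 mu -> L2 mu) : Prop :=
  forall t, 0 < t ->
    (forall f : L2 mu, (\forall x \ae mu, 0 <= f x) -> \forall x \ae mu, 0 <= S t f x) /\
    S t one = one %[ae mu].

End semigroup.

Section dirichlet_to_neumann.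
Context {R : realType} {d : nat}.
Let E := 'rV[R]_d.
Variable Omega : set E.

Definition boundary : set E := closure Omega `\` interior Omega.

(* Both measures live on all of R^d, on their Caratheodory sigma-algebras, and
   vanish outside Omega and its boundary respectively: a function on Omega
   (resp. on the boundary) is represented by any extension to R^d. *)
Definition lebesgue_on := cara_measure (outer_restr (@lebesgue_outer R d) Omega).

Definition sigma := cara_measure (outer_restr (@hausdorff_outer R d d.-1) boundary).

Definition partial (i : 'I_d) (f : E -> R) : E -> R :=
  fun x => 'D_(delta_mx 0 i) f x.

Definition smooth (f : E -> R) : Prop := forall s : seq 'I_d,
  continuous (foldr partial f s) /\
  forall i x, derivable (foldr partial f s) x (delta_mx 0 i).

Definition test_function (phi : E -> R) : Prop :=
  let K := closure [set x | phi x != 0] in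
  [/\ smooth phi, compact K & K `<=` Omega].

Definition weak_partial (i : 'I_d) (u g : E -> R) : Prop :=
  forall phi, test_function phi ->
    \int[lebesgue_on]_x (u x * partial i phi x) =
    - \int[lebesgue_on]_x (g x * phi x).

(* An element of H^1(Omega), together with a representative of its gradient. *)
Record H1 := {
  H1_fun :> L2 lebesgue_on ;
  H1_grad : 'I_d -> L2 lebesgue_on ;
  H1_gradP : forall i, weak_partial i H1_fun (H1_grad i)
}.

Definition H1_dist (u v : H1) : R :=
  Num.sqrt (\int[lebesgue_on]_x (u x - v x) ^+ 2 +
            \int[lebesgue_on]_x (\sum_i (H1_grad u i x - H1_grad v i x) ^+ 2)).

(* H^1(Omega) `&` C(closure Omega) *)
Definition continuous_up_to_boundary (u : H1) : Prop :=
  {within closure Omega, continuous (u : E -> R)}.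

Definition is_laplacian (u f : L2 lebesgue_on) : Prop :=
  forall phi, test_function phi ->
    \int[lebesgue_on]_x (u x * \sum_i partial i (partial i phi) x) =
    \int[lebesgue_on]_x (f x * phi x).

Definition is_trace (u : H1) (phi : L2 sigma) : Prop :=
  exists un : nat -> H1,
    [/\ forall n, continuous_up_to_boundary (un n),
        H1_dist (un n) u @[n --> \oo] --> (0 : R) &
        'N[sigma]_2%:E[EFin \o (fun x => (un n x - phi x)%R)]%E @[n --> \oo] --> (0 : \bar R)].

Definition has_normal_derivative (u : H1) (psi : L2 sigma) : Prop :=
  exists f : L2 lebesgue_on, is_laplacian u f /\
    forall v : H1, continuous_up_to_boundary v ->
      \int[lebesgue_on]_x (f x * v x) +
      \int[lebesgue_on]_x (\sum_i H1_grad u i x * H1_grad v i x) =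
      \int[sigma]_x (psi x * v x).

Definition DtN (phi psi : L2 sigma) : Prop :=
  exists u : H1,
    [/\ is_laplacian u 0, is_trace u phi & has_normal_derivative u psi].

Lemma indic_boundary_Lfun : (hausdorff_outer d.-1 boundary < +oo)%E ->
  (\1_boundary : _ -> R) \in Lfun sigma 2%:E.
Proof.
move=> fin.
have mB : measurable
    (boundary : set (caratheodory_type (outer_restr (@hausdorff_outer R d d.-1) boundary))).
  move=> X; rewrite /= /outer_restr -setIA setIid -setIA setICl setI0.
  by rewrite outer_measure0 adde0.
rewrite inE; apply/andP; split; rewrite inE /=.
  exact: measurable_indic.
rewrite /finite_norm unlock /Lnorm poweR_lty//.
under eq_integral => x _.
  rewrite /= (_ : (`|\1_boundary x| `^ 2)%R = \1_boundary x); last first.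
    rewrite indicE; case: (_ \in _) => /=; last by rewrite normr0 powR0.
    by rewrite normr1 powR1.
  over.
rewrite integral_indic//= setIT /outer_restr setIid.
exact: fin.
Qed.

Definition indic_boundary (fin : (hausdorff_outer d.-1 boundary < +oo)%E) :
  L2 sigma := Lfun_Sub (lee1n 2) (indic_boundary_Lfun fin).

End dirichlet_to_neumann.
Arguments sigma {R d} Omega.

(* Main.v *)
Require Import Defs.
From HB Require Import structures.
From mathcomp Require Import all_boot all_order all_algebra.
From mathcomp Require Import all_classical all_reals all_analysis.
From mathcomp Require Import measurable_realfun.
From mathcomp Require Import ring lra.
Set Implicit Arguments.
Unset Strict Implicit.
Unset Printing Implicit Defensive.
Import Order.TTheory GRing.Theory Num.Theory.
Import numFieldTopology.Exports numFieldNormedType.Exports.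
Local Open Scope classical_set_scope.
Local Open Scope ring_scope.

(* Since the constant 1 is harmonic with zero normal derivative, D_0 1 = 0; hence
   t |-> |S_t 1 - 1| has nonpositive Dini derivatives and stays equal to 0.

   Positivity is the Beurling-Deny argument: if (D_0 phi, phi^-) <= 0 on the domain
   of D_0, then t |-> |(S_t phi)^-|^2 is nonincreasing there, and the domain is dense.
   For the inequality let u be harmonic with trace phi, u_n -> u in H^1 with u_n
   continuous up to the boundary and u_n -> phi in L_2(Gamma), and let G be a C^1
   approximation of t |-> - t^- with 0 <= G' <= 1. Then G(u_n) is again in H^1 and
   continuous up to the boundary, so that
     int_Gamma (D_0 phi) G(u_n) = int_Omega G'(u_n) grad u . grad u_n,
   which differs from int_Omega G'(u_n) |grad u|^2 >= 0 by a term tending to 0.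

   The chain rule for G(u), u continuous, is obtained from difference quotients:
   translation invariance of the Lebesgue measure and the density in L_2(W) of the
   smooth functions supported in W show that those of u are bounded in L_2 near the
   support of a test function, by the norm of the weak derivative, and converge weakly
   to it. *)

(** * Square-integrable functions *)

(** Normal derivatives are tested only against functions continuous up to the boundary, and on a
    rough domain an element of H^1 may have several traces. So neither u^- nor G(u) can be inserted
    directly: only G(u_n) is admissible, and the limits, in n and then in the smoothing parameter of
    G, are taken in the inequality and not in the functions. The derivative of G has to be Lipschitz
    because the chain rule rests on a quadratic Taylor bound: of the two increments of u in the
    remainder, one divided by h stays bounded in L_2, the other tends to 0 by continuity of u.
    Difference quotients spare convolutions: they ask of the measure only translation invariance and
    approximation by boxes. On the semigroup side, each S_t comes with its own bound, without
    control in t. Every estimate is therefore made at a fixed time s, with S_s applied to a small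
    increment, and [dini_nonincreasing] assembles them. Vector-valued integrals, needed only for the
    density of the domain, are handled through scalar primitives of their pairings. *)

Section square_integrable.
Context d (T : measurableType d) (R : realType).
Variable mu : {measure set T -> \bar R}.
Implicit Types f g h : T -> R.

(** A predicate on plain functions, so that pointwise expressions can be estimated without first
    being packed into elements of [L2 mu]. *)
Definition l2 f := measurable_fun setT f /\
  mu.-integrable setT (EFin \o (fun x => f x ^+ 2)).

Definition dot f g : R := \int[mu]_x (f x * g x).

Definition nrm f : R := Num.sqrt (dot f f).

Lemma integrable_eq (F G : T -> \bar R) : mu.-integrable setT F -> F =1 G ->
  mu.-integrable setT G.
Proof. by move=> Fi FG; rewrite (_ : G = F)//; apply/funext => x. Qed.

Lemma l2_measurable f : l2 f -> measurable_fun setT f.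
Proof. by case. Qed.

Lemma l2_Lfun f : f \in Lfun mu 2%:E <-> l2 f.
Proof.
split => [fL|[mf fi]].
  split; last exact: Lfun2_integrable_sqr.
  by move: fL; rewrite inE => /andP[]; rewrite inE.
rewrite inE; apply/andP; split; rewrite inE //=.
rewrite /finite_norm unlock /Lnorm poweR_lty//.
under eq_integral => x _.
  rewrite /= (_ : (`|f x| `^ 2)%R = (f x ^+ 2)%R); last first.
    by rewrite -[2]/(2%:R) powR_mulrn// real_normK// num_real.
  over.
case/integrableP: fi => _; apply: le_lt_trans.
apply: ge0_le_integral => //.
- by move=> x _; rewrite lee_fin sqr_ge0.
- apply/measurable_EFinP; exact: measurable_funX.
- apply/measurableT_comp => //; apply/measurable_EFinP; exact: measurable_funX.
- by move=> x _; rewrite /= lee_fin ler_norm.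
Qed.

Lemma l2_le f g : measurable_fun setT g -> (forall x, `|g x| <= `|f x|) ->
  l2 f -> l2 g.
Proof.
move=> mg gf [mf fi]; split => //.
apply: (le_integrable _ _ _ fi) => //.
  by apply/measurable_EFinP; exact: measurable_funX.
move=> x _ /=; rewrite lee_fin !normrX.
by rewrite ler_pXn2r// nnegrE.
Qed.

Lemma integrableM f g : l2 f -> l2 g ->
  mu.-integrable setT (EFin \o (fun x => f x * g x)).
Proof.
move=> [mf fi] [mg gi].
apply: (@le_integrable _ _ _ mu setT _ _
  (EFin \o (fun x => f x ^+ 2 + g x ^+ 2))) => //.
- by apply/measurable_EFinP; exact: measurable_funM.
- move=> x _ /=; rewrite lee_fin [leRHS]ger0_norm; last by rewrite addr_ge0// sqr_ge0.
  rewrite normrM; have := sqr_ge0 (`|f x| - `|g x|).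
  rewrite -[f x ^+ 2]real_normK ?num_real// -[g x ^+ 2]real_normK ?num_real//.
  by nra.
- exact: (integrableD _ fi gi).
Qed.

Lemma integrable_sqr f : l2 f -> mu.-integrable setT (EFin \o (fun x => f x * f x)).
Proof. by move=> fl; apply: integrableM. Qed.

Lemma l2D f g : l2 f -> l2 g -> l2 (fun x => f x + g x).
Proof.
move=> fl gl; have [mf fi] := fl; have [mg gi] := gl.
split; first exact: measurable_funD.
have fgi := integrableM fl gl.
apply: (integrable_eq (integrableD measurableT (integrableD measurableT fi
  (integrableD measurableT fgi fgi)) gi)) => x.
by rewrite /= -!EFinD; congr EFin; ring.
Qed.

Lemma l2Z a f : l2 f -> l2 (fun x => a * f x).
Proof.
move=> [mf fi]; split; first exact: measurable_funM.
apply: (integrable_eq (integrableZl measurableT (a ^+ 2) fi)) => x.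
by rewrite /= exprMn.
Qed.

Lemma l2N f : l2 f -> l2 (fun x => - f x).
Proof.
move=> /(l2Z (-1)); rewrite (_ : (fun x => _) = (fun x => - f x))//.
by apply/funext => x; rewrite mulN1r.
Qed.

Lemma l2B f g : l2 f -> l2 g -> l2 (fun x => f x - g x).
Proof. by move=> fl gl; apply: l2D => //; exact: l2N. Qed.

Lemma l20 : l2 (fun=> 0).
Proof.
split => //; rewrite (_ : EFin \o _ = cst 0%E); first exact: integrable0.
by apply/funext => x /=; rewrite expr0n.
Qed.

Lemma l2_sum (I : Type) (s : seq I) (F : I -> T -> R) :
  (forall i, l2 (F i)) -> l2 (fun x => \sum_(i <- s) F i x).
Proof.
move=> Fl; elim: s => [|i s IH].
  by under eq_fun do rewrite big_nil; exact: l20.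
by under eq_fun do rewrite big_cons; exact: l2D.
Qed.

Lemma l2M c f (b : T -> R) : (forall x, `|b x| <= c) -> measurable_fun setT b -> l2 f ->
  l2 (fun x => b x * f x).
Proof.
move=> bc mb fl; have mf := l2_measurable fl.
apply: (@l2_le (fun x => c * f x)); [exact: measurable_funM| |exact: l2Z].
by move=> x; rewrite !normrM ler_wpM2r// (le_trans (bc x))// ler_norm.
Qed.

Lemma l2_bounded (c : R) f : (mu setT < +oo)%E -> measurable_fun setT f ->
  (forall x, `|f x| <= c) -> l2 f.
Proof.
move=> muT mf fc; split => //.
apply: (@le_integrable _ _ _ mu setT _ _ (cst (c ^+ 2)%:E)) => //.
- by apply/measurable_EFinP; exact: measurable_funX.
- move=> x _ /=; rewrite lee_fin !normrX ler_pXn2r ?nnegrE//.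
  by rewrite (le_trans (fc x))// ler_norm.
- apply/integrableP; split; first exact: measurable_cst.
  by rewrite /= integral_cst// lte_mul_pinfty.
Qed.

Lemma dotC f g : dot f g = dot g f.
Proof. by apply: eq_Rintegral => x _; rewrite mulrC. Qed.

Lemma dotDl f g h : l2 f -> l2 g -> l2 h ->
  dot (fun x => f x + g x) h = dot f h + dot g h.
Proof.
move=> fl gl hl; rewrite /dot -RintegralD//; [|exact: integrableM..].
by apply: eq_Rintegral => x _; rewrite mulrDl.
Qed.

Lemma dotZl a f h : l2 f -> l2 h -> dot (fun x => a * f x) h = a * dot f h.
Proof.
move=> fl hl; rewrite /dot -RintegralZl//; last exact: integrableM.
by apply: eq_Rintegral => x _; rewrite mulrA.
Qed.

Lemma dotNl f h : l2 f -> l2 h -> dot (fun x => - f x) h = - dot f h.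
Proof.
move=> fl hl; rewrite -mulN1r -dotZl//.
by apply: eq_Rintegral => x _; rewrite mulN1r.
Qed.

Lemma dotBl f g h : l2 f -> l2 g -> l2 h ->
  dot (fun x => f x - g x) h = dot f h - dot g h.
Proof. by move=> fl gl hl; rewrite dotDl ?dotNl//; exact: l2N. Qed.

Lemma dotDr f g h : l2 f -> l2 g -> l2 h ->
  dot h (fun x => f x + g x) = dot h f + dot h g.
Proof. by move=> ? ? ?; rewrite dotC dotDl// ![dot h _]dotC. Qed.

Lemma dotZr a f h : l2 f -> l2 h -> dot h (fun x => a * f x) = a * dot h f.
Proof. by move=> ? ?; rewrite dotC dotZl// [dot h _]dotC. Qed.

Lemma dotBr f g h : l2 f -> l2 g -> l2 h ->
  dot h (fun x => f x - g x) = dot h f - dot h g.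
Proof. by move=> ? ? ?; rewrite dotC dotBl// ![dot h _]dotC. Qed.

Lemma dot_suml (I : Type) (s : seq I) (F : I -> T -> R) h :
  (forall i, l2 (F i)) -> l2 h ->
  dot (fun x => \sum_(i <- s) F i x) h = \sum_(i <- s) dot (F i) h.
Proof.
move=> Fl hl; elim: s => [|i s IH].
  rewrite big_nil /dot; under eq_Rintegral do rewrite big_nil mul0r.
  by rewrite Rintegral_cst ?mul0r.
rewrite big_cons -IH -dotDl//; last exact: l2_sum.
by apply: eq_Rintegral => x _; rewrite big_cons.
Qed.

Lemma dot_ge0 f : 0 <= dot f f.
Proof. by apply: Rintegral_ge0 => x _; rewrite -expr2 sqr_ge0. Qed.

Lemma nrm_ge0 f : 0 <= nrm f.
Proof. exact: sqrtr_ge0. Qed.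

Lemma sqr_nrm f : nrm f ^+ 2 = dot f f.
Proof. by rewrite sqr_sqrtr// dot_ge0. Qed.

Lemma dot_le_nrm f g : l2 f -> l2 g -> `|dot f g| <= nrm f * nrm g.
Proof.
move=> fl gl.
have key t : 0 <= dot f f - 2 * t * dot f g + t ^+ 2 * dot g g.
  have := dot_ge0 (fun x => f x - t * g x).
  rewrite dotBl ?dotBr ?dotZl ?dotZr//; try (by apply: l2Z); last first.
    by apply: l2B => //; apply: l2Z.
  by rewrite [dot g f]dotC => /le_trans; apply; lra.
have ab : dot f g ^+ 2 <= dot f f * dot g g.
  have := dot_ge0 g; rewrite le_eqVlt => /predU1P[g0|g0].
    rewrite -g0 mulr0; have [->|fg0] := eqVneq (dot f g) 0; first by rewrite expr0n.
    (* When [g] has norm 0 the quadratic is affine in [t], and this [t] gives it the value -1. *)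
    have := key ((dot f f + 1) / (2 * dot f g)).
    rewrite -g0 mulr0 addr0 (_ : 2 * _ * _ = dot f f + 1); last by field.
    by rewrite opprD addNKr ler0N1.
  have := key (dot f g / dot g g).
  rewrite (_ : _ + _ * dot g g = (dot f f * dot g g - dot f g ^+ 2) / dot g g); last first.
    by field; rewrite gt_eqF.
  by rewrite pmulr_lge0 ?invr_gt0// subr_ge0.
rewrite -ler_sqr ?nnegrE ?mulr_ge0 ?nrm_ge0// real_normK ?num_real//.
by rewrite exprMn !sqr_nrm.
Qed.

Lemma nrmZ a f : l2 f -> nrm (fun x => a * f x) = `|a| * nrm f.
Proof.
move=> fl; rewrite /nrm dotZl ?dotZr//; last exact: l2Z.
by rewrite mulrA -expr2 sqrtrM ?sqr_ge0// sqrtr_sqr.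
Qed.

Lemma nrmN f : nrm (fun x => - f x) = nrm f.
Proof. by rewrite /nrm; congr Num.sqrt; apply: eq_Rintegral => x _; rewrite mulrNN. Qed.

Lemma nrmD f g : l2 f -> l2 g -> nrm (fun x => f x + g x) <= nrm f + nrm g.
Proof.
move=> fl gl; have fgl := l2D fl gl.
rewrite -ler_sqr ?nnegrE ?addr_ge0 ?nrm_ge0// sqrrD !sqr_nrm.
rewrite dotDl// !dotDr// [dot g f]dotC.
have := le_trans (ler_norm _) (dot_le_nrm fl gl).
by move: (nrm f * nrm g) => u; lra.
Qed.

Lemma nrm_distC f g : nrm (fun x => f x - g x) = nrm (fun x => g x - f x).
Proof. by rewrite -nrmN; congr nrm; apply/funext => x; rewrite opprB. Qed.

Lemma nrm_triangle h f g : l2 f -> l2 g -> l2 h ->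
  nrm (fun x => f x - g x) <= nrm (fun x => f x - h x) + nrm (fun x => h x - g x).
Proof.
move=> fl gl hl; rewrite (_ : (fun x => f x - g x) = (fun x => (f x - h x) + (h x - g x))).
  by apply: nrmD; exact: l2B.
by apply/funext => x; rewrite addrA subrK.
Qed.

Lemma nrm_dist f g : l2 f -> l2 g -> `|nrm f - nrm g| <= nrm (fun x => f x - g x).
Proof.
have key u v : l2 u -> l2 v -> nrm u - nrm v <= nrm (fun x => u x - v x).
  move=> ul vl; rewrite lerBlDr; apply: le_trans (nrmD (l2B ul vl) vl).
  by rewrite le_eqVlt; apply/orP; left; apply/eqP; congr nrm; apply/funext => x; rewrite subrK.
move=> fl gl; rewrite ler_norml key// andbT.
by rewrite lerNl opprB nrm_distC key.
Qed.

Lemma nrm_sum (I : Type) (s : seq I) (F : I -> T -> R) :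
  (forall i, l2 (F i)) ->
  nrm (fun x => \sum_(i <- s) F i x) <= \sum_(i <- s) nrm (F i).
Proof.
move=> Fl; elim: s => [|i s IH].
  rewrite big_nil /nrm /dot; under eq_Rintegral do rewrite big_nil mul0r.
  by rewrite Rintegral_cst ?mul0r ?sqrtr0.
rewrite big_cons; under [X in nrm X]eq_fun do rewrite big_cons.
by apply: le_trans (nrmD _ _) _ => //; [exact: l2_sum|rewrite lerD2l].
Qed.

Lemma nrm_le f g : l2 f -> l2 g -> (forall x, `|f x| <= `|g x|) -> nrm f <= nrm g.
Proof.
move=> fl gl fg; rewrite ler_sqrt ?dot_ge0//.
apply: le_Rintegral => //; [exact: integrable_sqr..|].
move=> x _; rewrite -!expr2 -[leLHS]real_normK ?num_real//.
by rewrite -[leRHS]real_normK ?num_real// ler_pXn2r ?nnegrE.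
Qed.

Lemma nrm_abs f : nrm (fun x => `|f x|) = nrm f.
Proof.
by congr Num.sqrt; apply: eq_Rintegral => x _; rewrite -!expr2 real_normK ?num_real.
Qed.

Lemma eq_ae_dot f f' g : l2 f -> l2 f' -> l2 g -> f = f' %[ae mu] -> dot f g = dot f' g.
Proof.
move=> [mf _] [mf' _] [mg _] ff'; rewrite /dot /Rintegral; congr fine.
apply: ae_eq_integral => //.
- by apply/measurable_EFinP; exact: measurable_funM.
- by apply/measurable_EFinP; exact: measurable_funM.
- by apply: filterS ff' => x /= fx /fx ->.
Qed.

Lemma eq_ae_nrm f g : l2 f -> l2 g -> f = g %[ae mu] -> nrm f = nrm g.
Proof.
move=> fl gl fg; rewrite /nrm; congr Num.sqrt.
by rewrite (eq_ae_dot fl gl)// dotC (eq_ae_dot fl gl)// dotC.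
Qed.

Lemma nrm0_ae f : l2 f -> nrm f = 0 -> f = (fun=> 0) %[ae mu].
Proof.
move=> fl f0; have [mf _] := fl.
have /ae_eq_integral_abs : measurable_fun setT (EFin \o (fun x => f x * f x)).
  by apply/measurable_EFinP; exact: measurable_funM.
move=> /(_ mu measurableT)[+ _].
have -> : (\int[mu]_x `|(EFin \o (fun x => f x * f x)%R) x| = 0)%E.
  have /eqP := sqr_nrm f; rewrite f0 expr0n /= eq_sym => /eqP.
  rewrite /dot /Rintegral => ff.
  under eq_integral => x _ do rewrite /= ger0_norm -?expr2 ?sqr_ge0// expr2.
  have /integrable_fin_num := integrable_sqr fl.
  by move=> /(_ measurableT) /fineK <-; rewrite ff.
move=> /(_ erefl); apply: filterS => x /= + _ => /(_ I) [].
by move/eqP; rewrite mulf_eq0 orbb => /eqP.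
Qed.

Lemma nrm_eq0_ae f : l2 f -> f = (fun=> 0) %[ae mu] -> nrm f = 0.
Proof.
move=> fl f0; rewrite (eq_ae_nrm fl l20 f0) /nrm /dot.
under eq_Rintegral do rewrite mul0r.
by rewrite Rintegral_cst ?mul0r ?sqrtr0.
Qed.

Lemma L2norm_nrm (f : L2 mu) : L2norm f = nrm f.
Proof.
rewrite /L2norm /nrm /dot unlock /Lnorm /Rintegral.
under eq_integral => x _.
  rewrite /= (_ : (`|f x| `^ 2)%R = (f x * f x)%R); last first.
    by rewrite -[2]/(2%:R) powR_mulrn// real_normK ?num_real// expr2.
  over.
have fi : mu.-integrable setT (EFin \o (fun x => f x * f x)).
  by apply: integrable_sqr; apply/l2_Lfun; exact: LfunP.
have /fineK <- := integrable_fin_num measurableT fi.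
by rewrite poweR_EFin /= powR12_sqrt//; exact: (dot_ge0 f).
Qed.


Lemma dominated_Rintegral (F : (T -> R)^nat) f h :
  (forall n, measurable_fun setT (F n)) -> measurable_fun setT f ->
  mu.-integrable setT (EFin \o h) ->
  (forall x, F n x @[n --> \oo] --> f x) -> (forall n x, `|F n x| <= h x) ->
  \int[mu]_x F n x @[n --> \oo] --> \int[mu]_x f x.
Proof.
move=> mF mf hi Ff Fh.
have [||||fi _ cv] := @dominated_convergence _ T R mu setT measurableT
  (fun n => EFin \o F n) (EFin \o f) (EFin \o h) _ _ _ hi.
- by move=> n; exact/measurable_EFinP.
- exact/measurable_EFinP.
- by apply: aeW => x _; apply: cvg_EFin; [exact: nearW|exact: Ff].
- by apply: aeW => x n _; rewrite /= lee_fin.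
apply: fine_cvg; rewrite fineK; last exact: integrable_fin_num.
exact: cv.
Qed.

Lemma nrm_dominated (F : (T -> R)^nat) f h :
  (forall n, measurable_fun setT (F n)) -> l2 f -> l2 h ->
  (forall x, F n x @[n --> \oo] --> f x) -> (forall n x, `|F n x| <= h x) ->
  nrm (fun x => F n x - f x) @[n --> \oo] --> (0 : R).
Proof.
move=> mF fl hl Ff Fh; have mf := l2_measurable fl.
rewrite -[X in _ --> X]sqrtr0; apply: continuous_cvg; first exact: sqrt_continuous.
have -> : (0 : R) = \int[mu]_x (cst 0 x) by rewrite Rintegral_cst// mul0r.
have hfl : l2 (fun x => h x + `|f x|).
  apply: l2D => //; apply: l2_le fl => [|x]; last by rewrite normr_id.
  exact: measurableT_comp.
apply: (@dominated_Rintegral _ _ (fun x => (h x + `|f x|) * (h x + `|f x|))).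
- by move=> n; apply: measurable_funM; exact: measurable_funB.
- exact: measurable_cst.
- exact: integrable_sqr.
- move=> x; rewrite /cst [X in _ --> X](_ : 0 = (f x - f x) * (f x - f x)); last first.
    by rewrite subrr mulr0.
  by apply: cvgM; apply: cvgB => //; exact: cvg_cst.
- move=> n x; rewrite normrM ler_pM// (le_trans (ler_normB _ _))// lerD2r//.
Qed.

(** Fatou's lemma for the squares. That the limit is square integrable is part of the conclusion,
    which is what completeness needs. *)
Lemma fatou_nrm (F : (T -> R)^nat) f (M : R) :
  (forall n, l2 (F n)) -> measurable_fun setT f -> 0 <= M ->
  (\forall x \ae mu, F n x @[n --> \oo] --> f x) ->
  (\forall n \near \oo, nrm (F n) <= M) -> l2 f /\ nrm f <= M.
Proof.
move=> Fl mf M0 Ff FM.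
have key : (\int[mu]_x (f x * f x)%:E <= (M ^+ 2)%:E)%E.
  have -> : (\int[mu]_x (f x * f x)%:E =
      \int[mu]_x (limn_einf (fun n => (F n x * F n x)%:E)))%E.
    apply: ae_eq_integral => //.
    - by apply/measurable_EFinP; exact: measurable_funM.
    - rewrite (_ : (fun x => _) = (fun x => - limn_esup (fun n => - (F n x * F n x)%:E))%E).
        apply: measurableT_comp => //; apply: measurable_fun_limn_esup => n.
        apply: measurableT_comp => //; apply/measurable_EFinP.
        by apply: measurable_funM; exact: (l2_measurable (Fl n)).
      by apply/funext => x; rewrite -[LHS]oppeK -limn_esupN.
    - apply: filterS Ff => x Fx _.
      have /cvg_limn_einf_sup : (F n x * F n x)%:E @[n --> \oo] --> (f x * f x)%:E.
        by apply: cvg_EFin; [exact: nearW|exact: cvgM].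
      by case.
  apply: le_trans (fatou _ _ _ _) _ => //.
  - move=> n; apply/measurable_EFinP.
    by apply: measurable_funM; exact: (l2_measurable (Fl n)).
  - by move=> n x _; rewrite lee_fin -expr2 sqr_ge0.
  - rewrite limn_einf_lim.
    apply: lime_le; first exact: is_cvg_einfs.
    near=> n; apply: ereal_inf_le; exists (\int[mu]_x (F n x * F n x)%:E)%E.
      by exists n => //=.
    have Fi := integrable_sqr (Fl n).
    rewrite -[leLHS]fineK; last exact: (integrable_fin_num measurableT Fi).
    rewrite lee_fin -[X in X <= _]/(dot (F n) (F n)) -sqr_nrm ler_sqr ?nnegrE ?nrm_ge0//.
    by near: n.
have fl : l2 f.
  split => //; apply/integrableP; split.
    by apply/measurable_EFinP; exact: measurable_funX.
  under eq_integral => x _ do rewrite /= ger0_norm ?sqr_ge0// expr2.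
  by apply: le_lt_trans key _; rewrite ltry.
split => //; rewrite -ler_sqr ?nnegrE ?nrm_ge0// sqr_nrm -lee_fin.
rewrite /dot /Rintegral fineK//.
exact: (integrable_fin_num measurableT (integrable_sqr fl)).
Unshelve. all: by end_near. Qed.


(** Monotone convergence gives the squared partial sums of the absolute increments an integrable
    limit; where that limit is finite the telescoping series converges absolutely. *)
Lemma ae_cvg_of_summable (F : (T -> R)^nat) (M : R) : 0 <= M ->
  (forall n, l2 (F n)) ->
  (forall n, \sum_(k < n) nrm (fun x => F k.+1 x - F k x) <= M) ->
  \forall x \ae mu, cvgn (fun n => F n x).
Proof.
move=> M0 Fl FM.
pose g n x := \sum_(k < n) `|F k.+1 x - F k x|.
have dl k : l2 (fun x => `|F k.+1 x - F k x|).
  apply: l2_le (l2B (Fl k.+1) (Fl k)) => [|x]; last by rewrite normr_id.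
  by apply: measurableT_comp => //; exact: (l2_measurable (l2B (Fl k.+1) (Fl k))).
have gl n : l2 (g n) by apply: l2_sum => i; exact: dl.
have g0 n x : 0 <= g n x by apply: sumr_ge0.
have gM n : nrm (g n) <= M.
  apply: le_trans (nrm_sum _ (fun k : 'I_n => dl k)) _.
  by under eq_bigr do rewrite nrm_abs; exact: FM.
have gh x : {homo g^~ x : n m / (n <= m)%N >-> n <= m}.
  by apply/nondecreasing_seqP => n; rewrite /g big_ord_recr /= lerDl.
pose G x := limn (fun n => (g n x * g n x)%:E).
have hG x : {homo (fun n => (g n x * g n x)%:E) : n m / (n <= m)%N >-> (n <= m)%E}.
  by move=> n m nm; rewrite lee_fin ler_pM// gh.
have mG n : measurable_fun setT (fun x => (g n x * g n x)%:E).
  by apply/measurable_EFinP; apply: measurable_funM; exact: (l2_measurable (gl n)).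
have G0 n x : (0 <= (g n x * g n x)%:E)%E by rewrite lee_fin mulr_ge0.
have iG : (\int[mu]_x G x <= (M ^+ 2)%:E)%E.
  have := @cvg_monotone_convergence _ _ _ mu _ measurableT
    (fun n x => (g n x * g n x)%:E) mG (fun n x _ => G0 n x) (fun x _ => hG x).
  move=> cv; rewrite -(cvg_lim _ cv)//.
  apply: lime_le; first by apply/cvg_ex; eexists; exact: cv.
  apply: nearW => n; have gi := integrable_sqr (gl n).
  rewrite -[leLHS]fineK; last exact: (integrable_fin_num measurableT gi).
  by rewrite lee_fin -[X in X <= _]/(dot (g n) (g n)) -sqr_nrm ler_sqr ?nnegrE ?nrm_ge0.
have Gge x n : ((g n x * g n x)%:E <= G x)%E.
  apply: lime_ge; first exact: ereal_nondecreasing_is_cvgn.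
  by exists n => // m /= nm; exact: hG.
have Gi : mu.-integrable setT G.
  apply/integrableP; split.
    apply: (@emeasurable_fun_cvg _ _ _ _ (fun n x => (g n x * g n x)%:E)) => //.
    by move=> x _; apply: ereal_nondecreasing_is_cvgn; exact: hG.
  under eq_integral => x _ do rewrite gee0_abs ?(le_trans (G0 0%N x))//.
  by apply: le_lt_trans iG _; rewrite ltry.
apply: filterS (integrable_ae measurableT Gi) => x /(_ I) Gx.
have /(@normed_cvg R R) : cvgn [normed series (fun k => F k.+1 x - F k x)].
  rewrite (_ : [normed series _] = g^~ x); last first.
    by apply/funext => n; rewrite /normed_series_of /= seriesEnat /= big_mkord.
  apply: nondecreasing_is_cvgn; first exact: gh.
  (* The integrable majorant controls the square of [g n x]; the bound on [g n x] itself comes from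
     [2 g <= 1 + g ^+ 2]. *)
  exists (1 + fine (G x)) => _ [n _ <-].
  have : g n x * g n x <= fine (G x) by rewrite -lee_fin fineK.
  have := g0 n x; have := sqr_ge0 (g n x - 1); nra.
rewrite -[X in _ -> cvg (X @ _)](_ : (fun n => F 0%N x + series (fun k => F k.+1 x - F k x) n) = _).
  by move=> cv; apply: is_cvgD => //; exact: is_cvg_cst.
apply/funext => n; rewrite /series /=.
by rewrite -[F n x](subrK (F 0%N x)) addrC -(telescope_sumr (fun k => F k x)).
Qed.

(** Riesz-Fischer: a subsequence with increments of norm at most 2^-k converges almost
    everywhere. *)
Lemma l2_complete (F : (T -> R)^nat) : (forall n, l2 (F n)) ->
  (forall e, 0 < e -> exists N, forall m n, (N <= m)%N -> (N <= n)%N ->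
    nrm (fun x => F m x - F n x) <= e) ->
  exists2 f, l2 f & nrm (fun x => F n x - f x) @[n --> \oo] --> (0 : R).
Proof.
move=> Fl FC.
have /choice[N NP] (k : nat) : exists N, forall m n, (N <= m)%N -> (N <= n)%N ->
    nrm (fun x => F m x - F n x) <= 2^-1 ^+ k by apply: FC; rewrite exprn_gt0.
pose p := fix p k := if k is k'.+1 then maxn (p k').+1 (N k) else N 0%N.
have pN k : (N k <= p k)%N by case: k => [//|k] /=; rewrite leq_maxr.
have pS k : (p k < p k.+1)%N by rewrite /= leq_max leqnn.
have pge k : (k <= p k)%N by elim: k => [//|k IH]; exact: leq_ltn_trans IH (pS k).
have cv : \forall x \ae mu, cvgn (fun k => F (p k) x).
  apply: (@ae_cvg_of_summable _ 2) => // n.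
  apply: (@le_trans _ _ (\sum_(k < n) 2^-1 ^+ k)).
    apply: ler_sum => k _; apply: NP => //.
    by rewrite (leq_trans (pN _))// ltnW.
  have -> : \sum_(k < n) 2^-1 ^+ k = 2 - 2 * 2^-1 ^+ n :> R.
    elim: n => [|n IH]; first by rewrite big_ord0 expr0 mulr1 subrr.
    by rewrite big_ord_recr /= IH exprS; field.
  by rewrite lerBlDr lerDl mulr_ge0// exprn_ge0.
(* An upper limit is defined and measurable everywhere, including the null set where the subsequence
   diverges. *)
pose f x := fine (limn_esup (fun k => (F (p k) x)%:E)).
have mf : measurable_fun setT f.
  apply: measurableT_comp; first exact: fine_measurable.
  apply: measurable_fun_limn_esup => k; apply/measurable_EFinP.
  exact: (l2_measurable (Fl _)).
have Ff : \forall x \ae mu, F (p k) x @[k --> \oo] --> f x.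
  apply: filterS cv => x /cvg_ex[l Fxl].
  suff -> : f x = l by [].
  have /cvg_limn_einf_sup : (F (p k) x)%:E @[k --> \oo] --> l%:E.
    by apply: cvg_EFin => //; exact: nearW.
  by rewrite /f => -[_ ->].
(* Fatou's lemma passes to the limit in the second index of the Cauchy condition only, so the whole
   sequence converges in norm. *)
have key e : 0 < e -> exists N, forall m, (N <= m)%N ->
    l2 (fun x => F m x - f x) /\ nrm (fun x => F m x - f x) <= e.
  move=> e0; have [n nP] := FC _ e0; exists n => m nm.
  apply: (@fatou_nrm (fun k x => F m x - F (p k) x)); last 2 first.
  - by apply: filterS Ff => x Fx; apply: cvgB => //; exact: cvg_cst.
  - near=> k; apply: nP => //; apply: leq_trans (pge k); near: k.
    exact: nbhs_infty_ge.
  - by move=> k; exact: l2B.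
  - by apply: measurable_funB => //; exact: (l2_measurable (Fl m)).
  - exact: ltW.
exists f.
  have [n /(_ n (leqnn n))[nl _]] := key 1 ltr01.
  rewrite (_ : f = (fun x => F n x - (F n x - f x))); first exact: l2B.
  by apply/funext => x; rewrite subKr.
apply/cvgrPdist_le => e e0; have [n nP] := key _ e0.
near=> m; rewrite sub0r normrN ger0_norm ?nrm_ge0//.
apply: (nP m _).2; near: m; exact: nbhs_infty_ge.
Unshelve. all: by end_near. Qed.

End square_integrable.

(** * Semigroups on L_2 *)

(** Differentiability is two-sided, hence claimed on the open interval only; uses on a closed
    interval first enlarge it by 1 on either side. *)
Lemma primitive_exists (R : realType) (q : R -> R) (a b : R) : continuous q ->
  exists Q : R -> R, forall t, a < t < b -> is_derive t 1 Q (q t).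
Proof.
move=> cq; exists (fun t => \int[lebesgue_measure]_(s in `[a, t]) q s) => t /andP[ata tb].
have iq : lebesgue_measure.-integrable `[a, b] (EFin \o q).
  apply: continuous_compact_integrable; first exact: segment_compact.
  exact: continuous_subspaceT.
have [dQ Qq] := continuous_FTC1_closed tb iq ata (cq t).
apply: DeriveDef; first exact: dQ.
by rewrite -derive1E; exact: Qq.
Qed.

(** The mean value theorem for [Q] minus a linear function of slope [w]. It plays the role of
    estimating the integral of [q - w], without any integral being formed. *)
Lemma primitive_dist (R : realType) (Q q : R -> R) (u v w M : R) : u <= v ->
  (forall t, u <= t <= v -> is_derive t 1 Q (q t)) ->
  (forall t, u <= t <= v -> `|q t - w| <= M) ->
  `|Q v - Q u - (v - u) * w| <= M * (v - u).
Proof.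
rewrite le_eqVlt => /predU1P[->|uv] Qq qw; first by rewrite !subrr mul0r subr0 normr0 mulr0.
have [|c cuv ->] := @MVT _ Q q u v uv (fun t tuv => Qq t (subset_itv_oo_cc tuv)).
  apply: continuous_in_subspaceT => t /set_mem/Qq dt.
  by apply: differentiable_continuous; apply/derivable1_diffP; exact: ex_derive.
have uv0 : 0 <= v - u by rewrite subr_ge0 ltW.
rewrite [(v - u) * w]mulrC -mulrBl normrM [`|v - u|]ger0_norm//.
by rewrite ler_wpM2r// qw//; exact: (subset_itv_oo_cc cuv).
Qed.

Lemma primitive_riemann_dist (R : realType) (Q q : R -> R) (a b e d : R) n : a <= b ->
  (forall t, a <= t <= b -> is_derive t 1 Q (q t)) ->
  (forall s t, a <= s <= b -> a <= t <= b -> `|s - t| <= d -> `|q s - q t| <= e) ->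
  (b - a) / n.+1%:R <= d ->
  `|Q b - Q a - \sum_(k < n.+1) (b - a) / n.+1%:R * q (a + k%:R * ((b - a) / n.+1%:R))|
    <= e * (b - a).
Proof.
move=> ab Qq qe; set h := _ / _ => hd.
have h0 : 0 <= h by rewrite divr_ge0// subr_ge0.
have nh : n.+1%:R * h = b - a by rewrite mulrC divfK.
pose s (k : nat) := a + k%:R * h.
have sab k : (k <= n.+1)%N -> a <= s k <= b.
  move=> kn; rewrite /s lerDl mulr_ge0//= -[leRHS](subrK a) addrC lerD2r -nh.
  by rewrite ler_wpM2r// ler_nat.
have sS k : s k.+1 - s k = h by rewrite /s -natr1; ring.
have -> : Q b - Q a = \sum_(k < n.+1) (Q (s k.+1) - Q (s k)).
  have := telescope_sumr (fun k => Q (s k)) (leq0n n.+1).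
  by rewrite big_mkord => ->; rewrite /s nh mul0r addr0 [a + _]addrC subrK.
rewrite -sumrB; apply: le_trans (ler_norm_sum _ _ _) _.
apply: (@le_trans _ _ (\sum_(k < n.+1) e * h)); last first.
  by rewrite sumr_const card_ord -mulrnAr -nh mulr_natl.
apply: ler_sum => k _.
have k1 : a <= s k <= b by apply: sab; rewrite ltnW.
have k2 : a <= s k.+1 <= b by exact: sab.
rewrite -{1 3}(sS k).
have sk t : s k <= t <= s k.+1 -> a <= t <= b.
  move: k1 k2 => /andP[p1 _] /andP[_ p2] /andP[p3 p4].
  by rewrite (le_trans p1)//= (le_trans p4).
apply: primitive_dist; first by rewrite -subr_ge0 sS.
  by move=> t /sk; exact: Qq.
move=> t tk; apply: qe => //; first exact: sk.
move: tk => /andP[p3 p4]; rewrite ger0_norm ?subr_ge0// (le_trans _ hd)//.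
by rewrite -[leRHS](sS k) lerD2r.
Qed.

(* The set of [s] in [0, t] with [y s <= y 0 + e s] is closed under increasing
   limits and open to the right, hence contains [t]. *)
Lemma dini_nonincreasing (R : realType) (y : R -> R) (t : R) : 0 <= t ->
  (forall s, 0 <= s -> forall e, 0 < e ->
     exists2 d, 0 < d & forall h, 0 < h < d -> y (s + h) <= y s + e * h) ->
  (forall s, 0 < s -> forall e, 0 < e ->
     exists2 d, 0 < d & forall r, s - d < r < s -> y s <= y r + e) ->
  y t <= y 0.
Proof.
move=> t0 yr yl; apply/ler_addgt0Pr => e0 e0_gt0.
pose e := e0 / (1 + t); have e_gt0 : 0 < e by rewrite divr_gt0// ltr_pwDl.
suff : y t <= y 0 + e * t.
  move/le_trans; apply; rewrite lerD2l /e -mulrA ler_piMr ?ltW//.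
  by rewrite mulrC ltr_pdivrMr ?ltr_pwDl// mul1r ltrDr ltr01.
pose E := [set s | 0 <= s <= t /\ y s <= y 0 + e * s].
have E0 : E 0 by split; [rewrite lexx|rewrite mulr0 addr0].
have Et : ubound E t by move=> s [/andP[]].
have supE : has_sup E by split; [exists 0|exists t].
pose s := sup E.
have s0 : 0 <= s by apply: ub_le_sup E0; exists t.
have st : s <= t by apply: ge_sup => //; exists 0.
have ys : y s <= y 0 + e * s.
  move: (s0); rewrite le_eqVlt => /predU1P[<-|s_gt0]; first by rewrite mulr0 addr0.
  apply/ler_addgt0Pr => n n0.
  have [d d0 dP] := yl _ s_gt0 _ n0.
  have [r Er sr] := sup_adherent d0 supE.
  have rs : r <= s by apply: ub_le_sup Er; exists t.
  move: rs Er; rewrite le_eqVlt => /predU1P[->|rs] [_ Er].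
    by rewrite (le_trans Er)// lerDl ltW.
  apply: le_trans (dP r _) _; first by rewrite sr.
  by rewrite lerD2r (le_trans Er)// lerD2l ler_wpM2l ?ltW.
move: st; rewrite le_eqVlt => /predU1P[<-//|st].
have [d d0 dP] := yr _ s0 _ e_gt0.
pose h := Num.min (d / 2) (t - s).
have h0 : 0 < h by rewrite lt_min divr_gt0//= subr_gt0.
have hd : h < d by rewrite gt_min ltr_pdivrMr// ltr_pMr// ltr1n.
have ht : h <= t - s by rewrite ge_min lexx orbT.
have /(ub_le_sup _) : E (s + h).
  split; first by rewrite addr_ge0 ?(ltW h0)//= -lerBrDl.
  apply: le_trans (dP h _) _; first by rewrite h0.
  by rewrite mulrDr addrA lerD2r.
have -> : s + h <= sup E = false by apply/negbTE; rewrite -ltNge -/s ltrDl.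
by move=> /(_ (ex_intro _ t Et)).
Qed.

(** * Integrals of continuous curves in L_2, defined through pairings *)

Section L2_elements.
Context d (T : measurableType d) (R : realType).
Variable mu : {measure set T -> \bar R}.

Lemma L2_l2 (f : L2 mu) : l2 mu f.
Proof. by apply/l2_Lfun; exact: LfunP. Qed.

Lemma L2_sumE (I : Type) (s : seq I) (F : I -> L2 mu) :
  ((\sum_(i <- s) F i : L2 mu) : T -> R) = (fun x => \sum_(i <- s) F i x).
Proof.
elim: s => [|i s IH]; first by rewrite big_nil; apply/funext => x; rewrite big_nil.
rewrite big_cons; apply/funext => x.
by rewrite big_cons -[X in _ = _ + X](congr1 (@^~ x) IH).
Qed.

(** Self-duality: if the pairing of a vector with every [g] is at most [M] times the norm of [g],
    taking [g] to be that vector bounds its norm. This turns weak descriptions into norm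
    estimates. *)
Lemma nrm_le_of_dot (g : T -> R) (M : R) : 0 <= M -> dot mu g g <= M * nrm mu g ->
  nrm mu g <= M.
Proof.
rewrite -sqr_nrm; have := nrm_ge0 mu g; rewrite le_eqVlt => /predU1P[<-//|g0] M0.
by rewrite expr2 ler_pM2r.
Qed.

Definition l2_continuous (c : R -> L2 mu) := forall t e, 0 < e ->
  exists2 d, 0 < d & forall s, `|s - t| < d -> nrm mu (fun x => c s x - c t x) <= e.

Lemma l2_continuous_dot (c : R -> L2 mu) (g : L2 mu) : l2_continuous c ->
  continuous (fun t => dot mu (c t) g).
Proof.
move=> cc t; apply/cvgrPdist_le => e e0.
pose M := nrm mu g + 1; have M0 : 0 < M by rewrite ltr_wpDl ?nrm_ge0.
have [d0 d00 dP] := cc t (e / M) (divr_gt0 e0 M0).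
exists d0 => //= s ts; have sl := L2_l2 (c s); have tl := L2_l2 (c t); have gl := L2_l2 g.
rewrite -dotBl//; apply: le_trans (dot_le_nrm _ _) _ => //; first exact: l2B.
rewrite nrm_distC -[leRHS](divfK (lt0r_neq0 M0)).
by apply: ler_pM; rewrite ?nrm_ge0 ?dP ?lerDl// distrC.
Qed.

Lemma l2_uniformly_continuous (c : R -> L2 mu) (a b e : R) : l2_continuous c -> 0 < e ->
  exists2 d, 0 < d & forall s t, a <= s <= b -> `|s - t| <= d ->
    nrm mu (fun x => c s x - c t x) <= e.
Proof.
move=> cc e0.
(* Compactness, as a near covering, yields one [dl] good for all [s] in the interval; [t] may lie
   outside it. *)
pose P (dl s : R) := forall t, `|s - t| <= dl -> nrm mu (fun x => c s x - c t x) <= e.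
have : near_covering `[a, b]%classic by apply/compact_near_coveringP; exact: segment_compact.
move=> /(_ R (0^'+) P _) [].
  move=> s _; have [d0 d00 dP] := cc s (e / 2) (divr_gt0 e0 (ltr0Sn R 1)).
  exists ([set r | `|r - s| < d0 / 2], [set r | r < d0 / 2]) => /=.
    split; last by apply: nbhs_right_lt; rewrite divr_gt0.
    by exists (d0 / 2); [rewrite /= divr_gt0|move=> r /=; rewrite distrC].
  move=> [r dl] [/= rs dd] t rt.
  have /= := nrm_triangle (L2_l2 (c r)) (L2_l2 (c t)) (L2_l2 (c s)).
  move/le_trans; apply; rewrite [leRHS]splitr; apply: lerD.
    by apply: dP; rewrite (lt_trans rs)// ltr_pdivrMr// ltr_pMr// ltr1n.
  rewrite nrm_distC; apply: dP.
  rewrite (_ : t - s = (t - r) + (r - s)); last by rewrite addrA subrK.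
  rewrite (le_lt_trans (ler_normD _ _))// [ltRHS]splitr ltrD// distrC.
  exact: le_lt_trans rt dd.
move=> d0 /= d00 dP; exists (d0 / 2); first by rewrite divr_gt0.
move=> s t sab; apply: (dP (d0 / 2)) => //=.
  by rewrite sub0r normrN gtr0_norm ?divr_gt0// ltr_pdivrMr// ltr_pMr// ltr1n.
by rewrite divr_gt0.
Qed.

Definition riemann_sum (c : R -> L2 mu) (a b : R) (n : nat) : L2 mu :=
  \sum_(k < n.+1) ((b - a) / n.+1%:R) *: c (a + k%:R * ((b - a) / n.+1%:R)).

Lemma dot_riemann_sum c a b n (g : L2 mu) : dot mu (riemann_sum c a b n) g =
  \sum_(k < n.+1) ((b - a) / n.+1%:R) * dot mu (c (a + k%:R * ((b - a) / n.+1%:R))) g.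
Proof.
rewrite /riemann_sum L2_sumE dot_suml; [|by move=> i; exact: L2_l2|exact: L2_l2].
by apply: eq_bigr => k _; rewrite dotZl//; exact: L2_l2.
Qed.

(** The rank of [n] does not depend on [g]. This uniformity makes the Riemann sums Cauchy in norm
    and not only weakly. *)
Lemma dot_riemann_sum_dist (c : R -> L2 mu) (a b e : R) : l2_continuous c -> a <= b ->
  0 < e -> \forall n \near \oo, forall (g : L2 mu) (Q : R -> R),
    (forall t, a <= t <= b -> is_derive t 1 Q (dot mu (c t) g)) ->
    `|Q b - Q a - dot mu (riemann_sum c a b n) g| <= e * nrm mu g * (b - a).
Proof.
move=> cc ab e0; have [d0 d00 dP] := l2_uniformly_continuous a b cc e0.
near=> n => g Q Qd; rewrite dot_riemann_sum.
apply: (primitive_riemann_dist (d := d0)) => //.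
  move=> s t sab tab st; rewrite -dotBl; try exact: L2_l2.
  apply: le_trans (dot_le_nrm _ _) _; [|exact: L2_l2|].
    by apply: l2B; exact: L2_l2.
  by rewrite ler_wpM2r ?nrm_ge0// dP.
rewrite ler_pdivrMr// mulrC -ler_pdivrMr//.
apply: le_trans (_ : n%:R <= _); last by rewrite ler_nat.
by near: n; exact: nbhs_infty_ger.
Unshelve. all: by end_near. Qed.

(* A Bochner integral [I] of [c] over [a, b], characterised weakly: pairing it with
   [g] gives the increment of a primitive of [t |-> (c t, g)]. *)
Lemma l2_curve_integral (c : R -> L2 mu) (a b : R) : l2_continuous c -> a <= b ->
  exists I : L2 mu,
    nrm mu (fun x => riemann_sum c a b n x - I x) @[n --> \oo] --> (0 : R) /\
    forall (g : L2 mu) (Q : R -> R),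
      (forall t, a <= t <= b -> is_derive t 1 Q (dot mu (c t) g)) ->
      dot mu I g = Q b - Q a.
Proof.
move=> cc ab.
have [|I Il RI] := @l2_complete _ _ _ mu (fun n => riemann_sum c a b n : T -> R) (fun n => L2_l2 _).
  move=> e e0; pose e' := e / (2 * (b - a + 1)).
  have ba0 : 0 < b - a + 1 by rewrite ltr_wpDl// subr_ge0.
  have e'0 : 0 < e' by rewrite divr_gt0// mulr_gt0.
  have [N _ NP] := dot_riemann_sum_dist cc ab e'0.
  exists N => m n Nm Nn.
  (* The difference of two sums is tested against itself: both pairings are close to the same
     increment of a primitive. *)
  pose g : L2 mu := riemann_sum c a b m - riemann_sum c a b n.
  rewrite -[X in nrm _ X]/(g : T -> R).
  have [Q Qd] := @primitive_exists _ (fun t => dot mu (c t) g) (a - 1) (b + 1)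
    (l2_continuous_dot cc).
  have Qd' t : a <= t <= b -> is_derive t 1 Q (dot mu (c t) g).
    move=> /andP[at_ tb]; apply: Qd; rewrite ltrBlDr (le_lt_trans at_) ?ltrDl//=.
    by rewrite (le_lt_trans tb)// ltrDl.
  have Hm := NP m Nm g Q Qd'; have Hn := NP n Nn g Q Qd'.
  apply: nrm_le_of_dot; first exact: ltW.
  rewrite -[X in dot _ X _ <= _]/(fun x => riemann_sum c a b m x - riemann_sum c a b n x).
  rewrite dotBl; try exact: L2_l2.
  have g0 := nrm_ge0 mu g.
  have : 2 * (e' * nrm mu g * (b - a)) <= e * nrm mu g.
    rewrite (_ : 2 * _ = (e * nrm mu g) * ((b - a) / (b - a + 1))); last first.
      by rewrite /e'; field; rewrite gt_eqF.
    rewrite ler_piMr ?mulr_ge0 ?(ltW e0)// ler_pdivrMr// mul1r lerDl.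
    exact: ler01.
  move: Hm Hn; rewrite !ler_norml => /andP[h1 h2] /andP[h3 h4]; move: h1 h2 h3 h4.
  set v1 := dot _ _ _; set v2 := dot _ _ _; lra.
exists (Lfun_Sub (lee1n 2) ((l2_Lfun _ _).2 Il)); split; first exact: RI.
move=> g Q Qd; set J := Lfun_Sub _ _; apply/eqP; rewrite -subr_eq0 -normr_le0.
apply/ler_addgt0Pl => e e0; rewrite addr0.
pose M := (nrm mu g + 1) * (b - a + 1 + 1).
have g0 := nrm_ge0 mu g; have ba0 : 0 <= b - a by rewrite subr_ge0.
have M0 : 0 < M by rewrite mulr_gt0 ?ltr_wpDl// addr_ge0.
have e1 : 0 < e / M by rewrite divr_gt0.
have : \forall n \near \oo, `|dot mu J g - (Q b - Q a)| <= e.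
  near=> n.
  have h1 : nrm mu (fun x => riemann_sum c a b n x - J x) <= e / M.
    rewrite -[leLHS]ger0_norm ?nrm_ge0//; near: n.
    by move/cvgr0_norm_le : RI; apply.
  have h2 : `|Q b - Q a - dot mu (riemann_sum c a b n) g| <= e / M * nrm mu g * (b - a).
    by near: n; apply: filterS (dot_riemann_sum_dist cc ab e1) => n /(_ g Q Qd).
  have h3 : `|dot mu (riemann_sum c a b n) g - dot mu J g| <= e / M * nrm mu g.
    rewrite -dotBl; try exact: L2_l2.
    apply: le_trans (dot_le_nrm _ _) _; [|exact: L2_l2|by rewrite ler_wpM2r].
    by apply: l2B; exact: L2_l2.
  have : e / M * nrm mu g * (b - a) + e / M * nrm mu g <= e.
    rewrite -{3}(divfK (lt0r_neq0 M0) e) -{2}[e / M * nrm mu g]mulr1 -mulrDr -mulrA.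
    rewrite ler_wpM2l ?(ltW e1)// /M; apply: ler_pM => //.
    - exact: addr_ge0.
    - by rewrite lerDl.
    - by rewrite lerDl.
  apply: le_trans; apply: le_trans (lerD h2 h3).
  rewrite distrC; apply: le_trans (ler_normD _ _).
  by rewrite addrA subrK.
by move=> [N _ /(_ N)]; apply => /=.
Unshelve. all: by end_near. Qed.

End L2_elements.

Definition neg_part (R : realType) (T : Type) (f : T -> R) : T -> R :=
  fun x => Num.max (- f x) 0.

Lemma ler_dist_neg_part (R : realType) (a b : R) :
  `|Num.max (- a) 0 - Num.max (- b) 0| <= `|a - b|.
Proof.
have := ler_norm (a - b); have := ler_norm (- (a - b)); rewrite normrN.
move: `|a - b| => m h1 h2; rewrite ler_norml.
case: (leP (- a) 0) => ha; case: (leP (- b) 0) => hb; apply/andP; split; lra.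
Qed.

(** Since [- a = - b - (a - b)] and [- b] is at most its positive part. Squared and integrated, this
    linearises the square of the negative part at [b]. *)
Lemma neg_part_le_dist (R : realType) (a b : R) :
  `|Num.max (- a) 0| <= `|Num.max (- b) 0 - (a - b)|.
Proof.
rewrite [leLHS]ger0_norm ?le_max ?lexx ?orbT//.
have h := ler_norm (Num.max (- b) 0 - (a - b)); rewrite ge_max normr_ge0 andbT.
apply: le_trans h.
have : - b <= Num.max (- b) 0 by rewrite le_max lexx.
lra.
Qed.

Section negative_part.
Context d (T : measurableType d) (R : realType).
Variable mu : {measure set T -> \bar R}.

Lemma l2_neg_part (f : T -> R) : l2 mu f -> l2 mu (neg_part f).
Proof.
move=> fl; have mf := l2_measurable fl; apply: l2_le fl => [|x].
  apply: measurable_maxr; [exact: measurableT_comp|exact: measurable_cst].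
by rewrite /neg_part; case: (leP (- f x) 0) => fx; rewrite ?normr0// normrN.
Qed.

Lemma nrm_neg_part_dist (f g : T -> R) : l2 mu f -> l2 mu g ->
  nrm mu (fun x => neg_part f x - neg_part g x) <= nrm mu (fun x => f x - g x).
Proof.
move=> fl gl; apply: nrm_le; [by apply: l2B; exact: l2_neg_part|exact: l2B|].
by move=> x; exact: ler_dist_neg_part.
Qed.

(* The subgradient inequality for the convex function [|f^-|^2], up to the square
   of the increment. *)
Lemma nrm_neg_part_sqr_le (f g : T -> R) : l2 mu f -> l2 mu g ->
  nrm mu (neg_part f) ^+ 2 <= nrm mu (neg_part g) ^+ 2
    - 2 * dot mu (neg_part g) (fun x => f x - g x) + nrm mu (fun x => f x - g x) ^+ 2.
Proof.
move=> fl gl; have fgl := l2B fl gl; have nfl := l2_neg_part fl; have ngl := l2_neg_part gl.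
have bl := l2B ngl fgl.
apply: (@le_trans _ _ (nrm mu (fun x => neg_part g x - (f x - g x)) ^+ 2)).
  by rewrite ler_sqr ?nnegrE ?nrm_ge0//; apply: nrm_le => // x; exact: neg_part_le_dist.
rewrite !sqr_nrm (dotBl ngl fgl bl) (dotBr ngl fgl ngl) (dotBr ngl fgl fgl).
rewrite [dot mu (fun x => f x - g x) (neg_part g)]dotC.
by rewrite le_eqVlt; apply/orP; left; apply/eqP; ring.
Qed.

Lemma neg_part0_ae (f : T -> R) : l2 mu f -> nrm mu (neg_part f) = 0 ->
  \forall x \ae mu, 0 <= f x.
Proof.
move=> fl f0; apply: filterS (nrm0_ae (l2_neg_part fl) f0) => x /(_ I).
by rewrite /neg_part => fx; rewrite -oppr_le0 -[leRHS]fx le_max lexx.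
Qed.

Lemma nrm_neg_part0 (f : T -> R) : l2 mu f -> (\forall x \ae mu, 0 <= f x) ->
  nrm mu (neg_part f) = 0.
Proof.
move=> fl f0; apply: nrm_eq0_ae; first exact: l2_neg_part.
by apply: filterS f0 => x fx _; rewrite /neg_part max_r// oppr_le0.
Qed.

End negative_part.

(** * Generator, density of its domain, and invariance along orbits *)

Section semigroup_theory.
Context d (T : measurableType d) (R : realType).
Variable mu : {measure set T -> \bar R}.
Variable S : R -> L2 mu -> L2 mu.
Hypothesis C0S : C0_semigroup S.

(** The values of [S] at [t <= 0] are arbitrary; replacing them by the identity makes every orbit
    continuous on the whole line. *)
Definition orbit t (f : L2 mu) : L2 mu := if 0 < t then S t f else f.

Lemma orbit0 f : orbit 0 f = f.
Proof. by rewrite /orbit ltxx. Qed.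

Lemma orbit_linear t (a : R) (f g : L2 mu) :
  \forall x \ae mu, orbit t (a *: f + g) x = a * orbit t f x + orbit t g x.
Proof.
have [t0|t0] := ltP 0 t; rewrite /orbit.
  by rewrite t0; apply: filterS (C0_linear C0S t0 a f g) => x /(_ I).
by rewrite ltNge t0; exact: aeW.
Qed.

Lemma orbit_bounded t : exists2 C, 0 <= C & forall f, nrm mu (orbit t f) <= C * nrm mu f.
Proof.
have [t0|t0] := ltP 0 t; last first.
  by exists 1 => // f; rewrite /orbit ltNge t0 mul1r.
have [C CP] := C0_bounded C0S t0; exists `|C| => // f.
rewrite /orbit t0; have := CP f; rewrite !L2norm_nrm => /le_trans; apply.
by rewrite ler_wpM2r ?nrm_ge0// ler_norm.
Qed.

Lemma orbit_ae0 t : \forall x \ae mu, orbit t 0 x = 0.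
Proof.
have [C C0 CP] := orbit_bounded t; have := CP 0.
rewrite (_ : nrm mu (0 : L2 mu) = 0) ?mulr0; last first.
  by apply: nrm_eq0_ae; [exact: L2_l2|exact: aeW].
move=> le0; have /nrm0_ae : nrm mu (orbit t 0) = 0 by apply/eqP; rewrite eq_le le0 nrm_ge0.
by move=> /(_ (L2_l2 _)); apply: filterS => x /(_ I).
Qed.

Lemma orbit_sum t (I : Type) (s : seq I) (a : I -> R) (F : I -> L2 mu) :
  \forall x \ae mu, orbit t (\sum_(i <- s) a i *: F i) x = \sum_(i <- s) a i * orbit t (F i) x.
Proof.
elim: s => [|i s IH].
  rewrite big_nil; apply: filterS (orbit_ae0 t) => x ->; by rewrite big_nil.
rewrite big_cons; apply: filterS2 IH (orbit_linear t (a i) (F i) (\sum_(j <- s) a j *: F j)) => x IHx ->.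
by rewrite IHx big_cons.
Qed.

Lemma orbitD s t f : 0 <= s -> 0 <= t ->
  \forall x \ae mu, orbit (s + t) f x = orbit s (orbit t f) x.
Proof.
rewrite le_eqVlt => /predU1P[<- _|s0]; first by rewrite add0r orbit0; exact: aeW.
rewrite le_eqVlt => /predU1P[<-|t0]; first by rewrite addr0 orbit0; exact: aeW.
by rewrite /orbit addr_gt0// s0 t0; apply: filterS (C0_add C0S s0 t0 f) => x /(_ I).
Qed.

Lemma orbit_bounded_dist t : exists2 C, 0 <= C & forall f g,
  nrm mu (fun x => orbit t f x - orbit t g x) <= C * nrm mu (fun x => f x - g x).
Proof.
have [C C0 CP] := orbit_bounded t; exists C => // f g.
have := CP ((-1) *: g + f).
have -> : nrm mu ((-1) *: g + f : L2 mu) = nrm mu (fun x => f x - g x).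
  congr (nrm _ _); apply/funext => x; transitivity ((-1) * g x + f x) => //.
  by rewrite mulN1r addrC.
rewrite (@eq_ae_nrm _ _ _ _ _ (fun x => orbit t f x - orbit t g x))//.
- exact: L2_l2.
- by apply: l2B; exact: L2_l2.
- by apply: filterS (orbit_linear t (-1) g f) => x -> _; rewrite mulN1r addrC.
Qed.

Lemma orbit_continuous f : l2_continuous (orbit^~ f).
Proof.
move=> t e e0; rewrite /orbit.
have [t0|t0] := ltP 0 t.
- have := C0_continuous C0S f t0 => /cvgrPdist_le/(_ _ e0)[d0 /= d00 dP].
  exists (Num.min d0 t); first by rewrite lt_min d00.
  move=> s; rewrite lt_min => /andP[sd st].
  have -> : 0 < s by move: st; rewrite ltr_distlC; lra.
  have := dP s; rewrite /= distrC => /(_ sd).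
  by rewrite sub0r normrN L2norm_nrm ger0_norm// nrm_ge0.
- move: t0; rewrite le_eqVlt => /predU1P[->|t0].
    have := C0_cvg0 C0S f => /cvgrPdist_le/(_ _ e0)[d0 /= d00 dP].
    exists d0 => // s; rewrite subr0 => sd; case: ifPn => s0; last first.
      by under eq_fun do rewrite subrr; rewrite nrm_eq0_ae ?(ltW e0)//; [exact: l20|exact: ae_eq_refl].
    have := dP s; rewrite /= sub0r normrN => /(_ sd s0).
    by rewrite sub0r normrN L2norm_nrm ger0_norm// nrm_ge0.
  exists (- t); first by rewrite oppr_gt0.
  move=> s; rewrite ltr_distlC => st.
  have -> : (0 < s) = false by apply/negbTE; rewrite -leNgt; lra.
  by under eq_fun do rewrite subrr; rewrite nrm_eq0_ae ?(ltW e0)//; [exact: l20|exact: ae_eq_refl].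
Qed.


Lemma orbit_continuous_comp t (f : L2 mu) : l2_continuous (fun s => orbit t (orbit s f)).
Proof.
have [C C0 CP] := orbit_bounded_dist t => s e e0.
have C1 : 0 < C + 1 by rewrite ltr_wpDl.
have [d0 d00 dP] := @orbit_continuous f s _ (divr_gt0 e0 C1).
exists d0 => // r /dP rs; apply: le_trans (CP _ _) _.
rewrite -[leRHS](divfK (lt0r_neq0 C1)) mulrC.
by rewrite ler_pM ?nrm_ge0// lerDl.
Qed.

Definition gen (f g : L2 mu) := forall e, 0 < e -> exists2 d, 0 < d &
  forall t, 0 < t < d -> nrm mu (fun x => t^-1 * (orbit t f x - f x) - g x) <= e.

Lemma genP (f g : L2 mu) :
  L2norm (t^-1 *: (S t f - f) - g) @[t --> 0^'+] --> (0 : R) <-> gen f g.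
Proof.
have E t : 0 < t -> L2norm (t^-1 *: (S t f - f) - g) =
    nrm mu (fun x => t^-1 * (orbit t f x - f x) - g x).
  by move=> t0; rewrite L2norm_nrm /orbit t0.
split => [/cvgrPdist_le fg e /fg[d0 /= d00 dP]|fg].
  exists d0 => // t /andP[t0 td]; have := dP t; rewrite /= !sub0r !normrN gtr0_norm//.
  by move=> /(_ td t0); rewrite E// ger0_norm// nrm_ge0.
apply/cvgrPdist_le => e /fg[d0 d00 dP]; exists d0 => // t.
move=> td t0; rewrite sub0r normrN E// ger0_norm ?nrm_ge0//.
by apply: dP; rewrite t0/=; move: td; rewrite /= sub0r normrN gtr0_norm.
Qed.

Lemma genZ a f g : gen f g -> gen (a *: f) (a *: g).
Proof.
move=> fg e e0; have a1 : 0 < `|a| + 1 by rewrite ltr_wpDl.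
have [d0 d00 dP] := fg _ (divr_gt0 e0 a1); exists d0 => // t /dP tle.
rewrite (@eq_ae_nrm _ _ _ mu _ (fun x => a * (t^-1 * (orbit t f x - f x) - g x))).
- rewrite nrmZ; last by apply: l2B (L2_l2 _); apply: l2Z; apply: l2B; exact: L2_l2.
  by rewrite -[leRHS](divfK (lt0r_neq0 a1)) mulrC ler_pM ?nrm_ge0// lerDl.
- by apply: l2B (L2_l2 _); apply: l2Z; apply: l2B; exact: L2_l2.
- by apply: l2Z; apply: l2B (L2_l2 _); apply: l2Z; apply: l2B; exact: L2_l2.
- apply: filterS2 (orbit_linear t a f 0) (orbit_ae0 t) => x + h0 _.
  rewrite addr0 h0 addr0 => ->.
  by rewrite -[(a *: f : L2 mu) x]/(a * f x) -[(a *: g : L2 mu) x]/(a * g x); ring.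
Qed.

Lemma gen_orbit t f g : 0 <= t -> gen f g -> gen (orbit t f) (orbit t g).
Proof.
move=> t0 fg e e0; have [C C0 CP] := orbit_bounded t.
have C1 : 0 < C + 1 by rewrite ltr_wpDl.
have [d0 d00 dP] := fg _ (divr_gt0 e0 C1); exists d0 => // h hd; have := dP _ hd.
move: hd => /andP[h0 _].
(* [p] and [k] have the literal shape [a *: f + g], even at the price of adding 0, so that
   [orbit_linear] applies to them up to null sets. *)
pose p : L2 mu := (-1) *: f + orbit h f.
pose k : L2 mu := (-1) *: g + (h^-1 *: p + 0).
have -> : (fun x => h^-1 * (orbit h f x - f x) - g x) = k.
  apply/funext => x; rewrite -[k x]/((-1) * g x + (h^-1 * ((-1) * f x + orbit h f x) + 0)).
  by ring.
move=> kle; rewrite (@eq_ae_nrm _ _ _ mu _ (orbit t k)).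
- apply: le_trans (CP _) _.
  by rewrite -[leRHS](divfK (lt0r_neq0 C1)) mulrC ler_pM ?nrm_ge0// lerDl.
- by apply: l2B (L2_l2 _); apply: l2Z; apply: l2B; exact: L2_l2.
- exact: L2_l2.
have a1 := orbit_linear t (-1) g (h^-1 *: p + 0).
have a2 := orbit_linear t h^-1 p 0.
have a3 := orbit_linear t (-1) f (orbit h f).
have a4 := orbit_ae0 t.
have a5 := orbitD f (ltW h0) t0.
have a6 := orbitD f t0 (ltW h0).
apply: filterS2 (filterI a1 (filterI a2 a3)) (filterI a4 (filterI a5 a6)) => x.
move=> [e1 [e2 e3]] [e4 [e5 e6]] _.
rewrite -[k]/((-1) *: g + (h^-1 *: p + 0)) e1 e2 e3 e4 -e5 [h + t]addrC e6.
by ring.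
Qed.

(** The mean of the orbit of [f] over a short interval [0, h] lies in the domain, with image
    [h^-1 *: (orbit h f - f)], and is close to [f] by continuity at 0. *)
Lemma gen_dense (f : L2 mu) (e : R) : 0 < e ->
  exists f' g', gen f' g' /\ nrm mu (fun x => f' x - f x) <= e.
Proof.
move=> e0; have cc := @orbit_continuous f.
have [d0 d00 dP] := cc 0 e e0; rewrite orbit0 in dP.
pose h := d0 / 2; have h0 : 0 < h by rewrite divr_gt0.
have hd : h < d0 by rewrite ltr_pdivrMr// ltr_pMr// ltr1n.
have [I [RI IQ]] := l2_curve_integral cc (ltW h0).
have Qex (g : L2 mu) (b : R) : exists Q : R -> R, forall t : R, 0 <= t <= b ->
    is_derive t 1 Q (dot mu (orbit t f) g).
  have [Q QP] := @primitive_exists _ _ (-1) (b + 1) (@l2_continuous_dot _ _ _ _ _ g cc).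
  exists Q => t /andP[t0 tb]; apply: QP; rewrite (lt_le_trans _ t0) ?ltrN10//=.
  by rewrite (le_lt_trans tb)// ltrDl.
have qdist (g : L2 mu) (s r : R) : `|dot mu (orbit s f) g - dot mu (orbit r f) g| <=
    nrm mu (fun x => orbit s f x - orbit r f x) * nrm mu g.
  rewrite -dotBl; try exact: L2_l2.
  by apply: dot_le_nrm; [apply: l2B|]; exact: L2_l2.
exists (h^-1 *: I), (h^-1 *: (orbit h f - f)); split; last first.
  pose g : L2 mu := h^-1 *: I - f; rewrite -[X in nrm _ X]/(g : T -> R).
  apply: nrm_le_of_dot; first exact: ltW.
  have [Q Qd] := Qex g h.
  rewrite -[X in dot _ X _]/(fun x => h^-1 * I x - f x).
  rewrite dotBl ?dotZl; try exact: L2_l2; last by apply: l2Z; exact: L2_l2.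
  rewrite (IQ g Q)// -(ler_pM2l h0) mulrBr mulrA mulfV ?gt_eqF// mul1r.
  apply: le_trans (ler_norm _) _; rewrite mulrC -{1 2}[h]subr0.
  rewrite [leLHS](_ : _ = `|Q h - Q 0 - (h - 0) * dot mu (orbit 0 f) g|); last first.
    by rewrite !subr0 orbit0 [h * _]mulrC.
  rewrite [leRHS](_ : _ = e * nrm mu g * (h - 0)); last by rewrite subr0 mulrC.
  apply: primitive_dist => //; first exact: ltW.
  move=> t /andP[t0 th]; apply: le_trans (qdist _ _ _) _.
  rewrite ler_wpM2r ?nrm_ge0// orbit0 dP// subr0 ger0_norm//.
  exact: le_lt_trans hd.
(* It remains to differentiate the orbit of [I] at 0; the expected derivative is [orbit h f - f]. *)
apply: genZ => e1 e10; have e2 : 0 < e1 / 2 by rewrite divr_gt0.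
have [d1 d10 d1P] := cc 0 _ e2; have [d2 d20 d2P] := cc h _ e2.
exists (Num.min d1 d2); first by rewrite lt_min d10.
move=> t /andP[t0]; rewrite lt_min => /andP[td1 td2].
(* [orbit t] commutes with the integral because it commutes, almost everywhere, with the Riemann
   sums and is Lipschitz. *)
have [I' [RI' IQ']] := l2_curve_integral (@orbit_continuous_comp t f) (ltW h0).
have II' : nrm mu (fun x => orbit t I x - I' x) = 0.
  have [C C0 CP] := orbit_bounded_dist t.
  apply/eqP; rewrite -normr_le0 ger0_norm ?nrm_ge0//.
  apply/ler_addgt0Pl => e3 e30; rewrite addr0.
  have C1 : 0 < C + 1 by rewrite ltr_wpDl.
  have e4 : 0 < e3 / (C + 1) by rewrite divr_gt0.
  pose Rs n := riemann_sum (orbit^~ f) 0 h n.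
  pose Rs' n := riemann_sum (fun s => orbit t (orbit s f)) 0 h n.
  have RR n : nrm mu (fun x => orbit t (Rs n) x - Rs' n x) = 0.
    apply: nrm_eq0_ae; first by apply: l2B; exact: L2_l2.
    have := @orbit_sum t _ (index_enum 'I_n.+1) (fun=> (h - 0) / n.+1%:R)
      (fun k => orbit (0 + (k : nat)%:R * ((h - 0) / n.+1%:R)) f).
    apply: filterS => x + _; rewrite /Rs/= /riemann_sum => ->.
    by rewrite /Rs' /riemann_sum L2_sumE subrr.
  have : \forall n \near \oo, nrm mu (fun x => orbit t I x - I' x) <= e3.
    near=> n.
    have h1 : nrm mu (fun x => Rs n x - I x) <= e3 / (C + 1).
      by rewrite -[leLHS]ger0_norm ?nrm_ge0//; near: n; move/cvgr0_norm_le : RI; apply.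
    have h2 : nrm mu (fun x => Rs' n x - I' x) <= e3 / (C + 1).
      by rewrite -[leLHS]ger0_norm ?nrm_ge0//; near: n; move/cvgr0_norm_le : RI'; apply.
    apply: le_trans (nrm_triangle (L2_l2 (orbit t I)) (L2_l2 I') (L2_l2 (orbit t (Rs n)))) _.
    apply: le_trans (lerD (CP _ _) (nrm_triangle (L2_l2 (orbit t (Rs n))) (L2_l2 I') (L2_l2 (Rs' n)))) _.
    rewrite RR add0r -[leRHS](divfK (lt0r_neq0 C1)) mulrDr mulr1 mulrC.
    by apply: lerD => //; rewrite ler_wpM2r// nrm_distC.
  by move=> [N _ /(_ N)]; apply => /=.
pose v : L2 mu := t^-1 *: (orbit t I - I) - (orbit h f - f).
rewrite -[X in nrm _ X]/(v : T -> R); apply: nrm_le_of_dot; first exact: ltW.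
(* The pairing of [orbit t I - I] with [v] is the increment of [Q] over [h, h + t] minus that over
   [0, t]; each is [t] times the derivative of [Q] at the left end, up to
   [e1 / 2 * nrm mu v * t]. *)
have [Q Qd] := Qex v (h + t).
have dI : dot mu I v = Q h - Q 0.
  apply: IQ => s /andP[s0 sh]; apply: Qd; rewrite s0/= (le_trans sh)// lerDl; exact: ltW.
have dI' : dot mu I' v = Q (t + h) - Q (t + 0).
  apply: (IQ' v (fun s => Q (t + s))) => s /andP[s0 sh].
  have -> : dot mu (orbit t (orbit s f)) v = dot mu (orbit (t + s) f) v.
    apply: eq_ae_dot; try exact: L2_l2.
    by apply: filterS (orbitD f (ltW t0) s0) => x -> _.
  have Qts : is_derive (t + s) 1 Q (dot mu (orbit (t + s) f) v).
    by apply: Qd; rewrite addr_ge0 ?(ltW t0)//= addrC lerD2r.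
  have sh' : is_derive s 1 (fun s => t + s) (1 : R).
    by rewrite -[X in is_derive _ _ _ X]add0r; apply: is_deriveD.
  by have := is_derive1_comp Qts sh'; rewrite mulr1.
have dtI : dot mu (orbit t I) v = dot mu I' v.
  apply: eq_ae_dot; try exact: L2_l2.
  apply: filterS (nrm0_ae (l2B (L2_l2 _) (L2_l2 _)) II') => x /(_ Logic.I) + _.
  by move/eqP; rewrite subr_eq0 => /eqP.
rewrite -[X in dot _ X _]/(fun x => t^-1 * (orbit t I x - I x) - (orbit h f x - f x)).
have l1 := l2B (L2_l2 (orbit t I)) (L2_l2 I).
have l2' := l2B (L2_l2 (orbit h f)) (L2_l2 f).
rewrite dotBl ?dotZl ?dotBl; try exact: L2_l2; try by []; try exact: l2Z.
rewrite dtI dI dI' addr0 -(ler_pM2l t0) mulrBr mulrA mulfV ?gt_eqF// mul1r.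
have k1 : `|Q t - Q 0 - (t - 0) * dot mu (orbit 0 f) v| <= e1 / 2 * nrm mu v * (t - 0).
  apply: primitive_dist; first exact: ltW.
    move=> s /andP[s0 st]; apply: Qd; rewrite s0/= (le_trans st)// lerDr; exact: ltW.
  move=> s /andP[s0 st]; apply: le_trans (qdist _ _ _) _.
  rewrite ler_wpM2r ?nrm_ge0// d1P// subr0 ger0_norm//.
  exact: le_lt_trans td1.
have k2 : `|Q (h + t) - Q h - (h + t - h) * dot mu (orbit h f) v| <=
    e1 / 2 * nrm mu v * (h + t - h).
  apply: primitive_dist; first by rewrite lerDl ltW.
    move=> s /andP[s0 st]; apply: Qd; rewrite st andbT (le_trans _ s0)//; exact: ltW.
  move=> s /andP[s0 st]; apply: le_trans (qdist _ _ _) _.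
  rewrite ler_wpM2r ?nrm_ge0// d2P// ger0_norm ?subr_ge0//.
  by rewrite (le_lt_trans _ td2)// lerBlDl.
move: k1 k2; rewrite subr0 orbit0 [h + t - h]addrAC subrr add0r [t + h]addrC.
have := nrm_ge0 mu v; rewrite !ler_norml.
set q1 := dot _ _ _; set q2 := dot _ _ _; set N := nrm mu v.
have := ltW t0; move: (Q t) (Q 0) (Q h) (Q (h + t)) => A B C D t0' N0 /andP[a1 a2] /andP[b1 b2].
have -> : t * (e1 * N) = e1 / 2 * N * t + e1 / 2 * N * t by field.
lra.
Unshelve. all: by end_near. Qed.


(** The step from [s] to [s + h] costs the norm of [orbit s] applied to [orbit h f - f], which is
    o(h). Only the bound of [orbit s] at the fixed time [s] enters. *)
Lemma orbit_fixed f : gen f 0 -> forall t, 0 <= t -> orbit t f = f %[ae mu].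
Proof.
move=> f0 t t0.
have fl s := l2B (L2_l2 (orbit s f)) (L2_l2 f).
suff : nrm mu (fun x => orbit t f x - f x) <= nrm mu (fun x => orbit 0 f x - f x).
  rewrite orbit0 [leRHS](_ : _ = 0); last first.
    apply: nrm_eq0_ae; first by apply: l2B; exact: L2_l2.
    by apply: aeW => x _; rewrite subrr.
  move=> le0; have {le0} : nrm mu (fun x => orbit t f x - f x) = 0.
    by apply/eqP; rewrite eq_le le0 nrm_ge0.
  move/(nrm0_ae (fl t)); apply: filterS => x /[apply] /eqP.
  by rewrite subr_eq0 => /eqP.
apply: (@dini_nonincreasing _ (fun s => nrm mu (fun x => orbit s f x - f x))) => //.
- move=> s s0 e e0; have [C C0 CP] := orbit_bounded_dist s.
  have C1 : 0 < C + 1 by rewrite ltr_wpDl.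
  have [d0 d00 dP] := f0 _ (divr_gt0 e0 C1); exists d0 => // h hd.
  have := dP h hd; move: hd => /andP[h0 _].
  have -> : nrm mu (fun x => h^-1 * (orbit h f x - f x) - (0 : L2 mu) x) =
      h^-1 * nrm mu (fun x => orbit h f x - f x).
    rewrite -[X in X * _]gtr0_norm ?invr_gt0// -nrmZ//.
    by congr (nrm _ _); apply/funext => x; rewrite -[(0 : L2 mu) x]/0 subr0.
  rewrite ler_pdivrMl// => hle.
  apply: le_trans (nrm_triangle (L2_l2 _) (L2_l2 _) (L2_l2 (orbit s f))) _.
  rewrite addrC lerD2l.
  rewrite (@eq_ae_nrm _ _ _ mu _ (fun x => orbit s (orbit h f) x - orbit s f x)).
  + apply: le_trans (CP _ _) _; apply: le_trans (ler_wpM2l C0 hle) _.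
    rewrite mulrCA [e * h]mulrC ler_wpM2l ?(ltW h0)// mulrA ler_pdivrMr//.
    by rewrite [e * _]mulrC ler_wpM2r ?(ltW e0)// lerDl.
  + by apply: l2B; exact: L2_l2.
  + by apply: l2B; exact: L2_l2.
  + by apply: filterS (orbitD f s0 (ltW h0)) => x -> _.
- move=> s _ e e0; have [d0 d00 dP] := @orbit_continuous f s e e0.
  exists d0 => // r /andP[rs1 rs2].
  apply: le_trans (nrm_triangle (L2_l2 _) (L2_l2 _) (L2_l2 (orbit r f))) _.
  rewrite addrC lerD2l nrm_distC; apply: dP.
  by rewrite ltr_distlC; apply/andP; split; lra.
Qed.

(* The Beurling-Deny type condition [(g, f^-) >= 0] on the generator makes
   [t |-> |(S_t f)^-|^2] nonincreasing for [f] in its domain. *)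
Lemma orbit_neg_part_le :
  (forall f g, gen f g -> 0 <= dot mu g (neg_part f)) ->
  forall f g, gen f g -> forall t, 0 <= t ->
    nrm mu (neg_part (orbit t f)) <= nrm mu (neg_part f).
Proof.
move=> diss f g fg t t0.
have nl s : l2 mu (neg_part (orbit s f)) by apply: l2_neg_part; exact: L2_l2.
suff : nrm mu (neg_part (orbit t f)) ^+ 2 <= nrm mu (neg_part (orbit 0 f)) ^+ 2.
  by rewrite orbit0 ler_sqr ?nnegrE ?nrm_ge0.
apply: (@dini_nonincreasing _ (fun s => nrm mu (neg_part (orbit s f)) ^+ 2)) => //.
- move=> s s0 e e0.
  set N := nrm mu (neg_part (orbit s f)); set G := nrm mu (orbit s g).
  have N0 : 0 <= N by exact: nrm_ge0.
  have G0 : 0 <= G by exact: nrm_ge0.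
  (* The bound 1 keeps the difference quotient below [G + 1] in the quadratic term; the other bound
     makes the linear error [2 * N * eta] at most [e / 2]. *)
  pose eta := Num.min 1 (e / (2 * (2 * N + 1))).
  have D0 : 0 < 2 * (2 * N + 1) by rewrite mulr_gt0// ltr_wpDl// mulr_ge0.
  have eta0 : 0 < eta by rewrite lt_min ltr01 divr_gt0.
  have [d0 d00 dP] := gen_orbit s0 fg eta0.
  have D1 : 0 < 2 * (G + 1) ^+ 2 by rewrite mulr_gt0// exprn_gt0// ltr_wpDl.
  exists (Num.min d0 (e / (2 * (G + 1) ^+ 2))); first by rewrite lt_min d00 divr_gt0.
  move=> h /andP[h0]; rewrite lt_min => /andP[hd hG].
  have := dP h; rewrite h0 hd => /(_ isT).
  set r := (fun x => _) => rle.
  have rl : l2 mu r by apply: l2B (L2_l2 _); apply: l2Z; apply: l2B; exact: L2_l2.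
  have gl := L2_l2 (orbit s g); have sl := L2_l2 (orbit s f).
  have hl := L2_l2 (orbit h (orbit s f)).
  have -> : nrm mu (neg_part (orbit (s + h) f)) = nrm mu (neg_part (orbit h (orbit s f))).
    apply: eq_ae_nrm => //; first exact: l2_neg_part.
    rewrite addrC; apply: filterS (orbitD f (ltW h0) s0) => x fx _.
    by rewrite /neg_part fx.
  apply: le_trans (nrm_neg_part_sqr_le hl sl) _.
  (* The increment is [h] times the derivative of the orbit plus the error [r]; the condition on the
     generator disposes of the first term. *)
  have E : (fun x => orbit h (orbit s f) x - orbit s f x) =
      (fun x => h * (orbit s g x + r x)).
    by apply/funext => x; rewrite /r [_ + (_ - _)]addrC subrK mulrA mulfV ?gt_eqF// mul1r.
  rewrite E nrmZ; last exact: l2D.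
  rewrite dotZr//; last exact: l2D.
  rewrite dotDr// [dot mu _ (orbit s g)]dotC gtr0_norm//.
  have h1 := diss _ _ (gen_orbit s0 fg).
  have h2 : - (N * eta) <= dot mu (neg_part (orbit s f)) r.
    have := dot_le_nrm (nl s) rl; rewrite ler_norml => /andP[+ _].
    by apply: le_trans; rewrite lerN2 ler_wpM2l.
  have h3 : nrm mu (fun x => orbit s g x + r x) <= G + 1.
    apply: le_trans (nrmD gl rl) _; rewrite lerD2l (le_trans rle)//.
    by rewrite ge_min lexx.
  have h4 : h * (G + 1) ^+ 2 <= e / 2.
    have G1 : 0 < (G + 1) ^+ 2 by rewrite exprn_gt0// ltr_wpDl.
    rewrite -ler_pdivlMr// -mulrA -invfM; exact: ltW.
  have h5 : 2 * N * eta <= e / 2.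
    have : eta <= e / (2 * (2 * N + 1)) by rewrite ge_min lexx orbT.
    have N1 : 0 < 2 * N + 1 by rewrite ltr_wpDl// mulr_ge0.
    rewrite invfM mulrA ler_pdivlMr// => etale.
    apply: le_trans etale; rewrite mulrC ler_wpM2l ?(ltW eta0)// lerDl.
    exact: ler01.
  have h6 : (h * nrm mu (fun x => orbit s g x + r x)) ^+ 2 <= h * (e / 2).
    apply: (@le_trans _ _ ((h * (G + 1)) ^+ 2)).
      by rewrite ler_sqr ?nnegrE ?mulr_ge0 ?nrm_ge0 ?(ltW h0) ?addr_ge0// ler_wpM2l// ltW.
    by rewrite exprMn expr2 -mulrA ler_wpM2l ?(ltW h0).
  rewrite -/N.
  move: h1 h2 h6; set p := dot _ _ _; set q := dot _ _ _; move=> h1 h2 h6.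
  have h7 : - (h * (e / 2)) <= 2 * (h * (p + q)).
    rewrite [2 * (h * _)]mulrCA -mulrN ler_wpM2l ?(ltW h0)//; lra.
  lra.
- move=> s _ e e0; set N := nrm mu (neg_part (orbit s f)).
  have N0 : 0 <= N by exact: nrm_ge0.
  have D0 : 0 < 2 * N + 1 by rewrite ltr_wpDl// mulr_ge0.
  have [d0 d00 dP] := @orbit_continuous f s _ (divr_gt0 e0 D0).
  exists d0 => // r /andP[rs1 rs2].
  have rs : `|r - s| < d0 by rewrite ltr_distlC; apply/andP; split; lra.
  have := dP r rs; set del := nrm mu _ => dle.
  have M0 : 0 <= nrm mu (neg_part (orbit r f)) by exact: nrm_ge0.
  have : `|nrm mu (neg_part (orbit s f)) - nrm mu (neg_part (orbit r f))| <= del.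
    apply: le_trans (nrm_dist (nl s) (nl r)) _.
    rewrite /del nrm_distC; apply: nrm_neg_part_dist; exact: L2_l2.
  rewrite -/N; set M := nrm mu (neg_part (orbit r f)) in M0 *.
  rewrite ler_norml => /andP[_ NM].
  (* For [M < N] the difference of squares is [(N - M) * (N + M)], at most [del * (2 * N)]; the
     extra 1 in [2 * N + 1] only keeps the divisor positive. *)
  have [NM'|MN] := leP N M.
    by apply: (@le_trans _ _ (M ^+ 2)); [rewrite ler_sqr|rewrite lerDl ltW].
  have : del * (2 * N + 1) <= e by rewrite -ler_pdivlMr.
  have : 0 <= del by exact: nrm_ge0.
  nra.
Qed.

(** The monotonicity is known on the domain only; it reaches [f] because [orbit t] and the negative
    part are both Lipschitz in L_2. *)
Lemma orbit_positive :
  (forall f g, gen f g -> 0 <= dot mu g (neg_part f)) ->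
  forall f : L2 mu, (\forall x \ae mu, 0 <= f x) -> forall t, 0 <= t ->
  \forall x \ae mu, 0 <= orbit t f x.
Proof.
move=> diss f f0 t t0; apply: neg_part0_ae; first exact: L2_l2.
have [C C0 CP] := orbit_bounded_dist t.
have C1 : 0 < C + 1 by rewrite ltr_wpDl.
apply/eqP; rewrite -normr_le0 ger0_norm ?nrm_ge0//.
apply/ler_addgt0Pl => e e0; rewrite addr0.
have [f' [g' [fg' ff']]] := @gen_dense f _ (divr_gt0 e0 C1).
have n1 := l2_neg_part (L2_l2 (orbit t f)); have n2 := l2_neg_part (L2_l2 (orbit t f')).
have n3 := l2_neg_part (L2_l2 f); have n4 := l2_neg_part (L2_l2 f').
have h1 : nrm mu (neg_part (orbit t f)) <= nrm mu (neg_part (orbit t f')) +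
    nrm mu (fun x => neg_part (orbit t f) x - neg_part (orbit t f') x).
  rewrite -lerBlDl; apply: le_trans (nrm_dist n1 n2); exact: ler_norm.
have h2 : nrm mu (neg_part f') <= nrm mu (neg_part f) +
    nrm mu (fun x => neg_part f' x - neg_part f x).
  rewrite -lerBlDl; apply: le_trans (nrm_dist n4 n3); exact: ler_norm.
have h3 := nrm_neg_part_dist (L2_l2 (orbit t f)) (L2_l2 (orbit t f')).
have h4 := nrm_neg_part_dist (L2_l2 f') (L2_l2 f).
have h5 := orbit_neg_part_le diss fg' t0.
have h6 := CP f f'; rewrite [X in _ <= C * X]nrm_distC in h6.
rewrite (nrm_neg_part0 (L2_l2 _) f0) add0r in h2.
move: ff'; rewrite ler_pdivlMr// => ff'.
have := nrm_ge0 mu (fun x => f' x - f x).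
lra.
Qed.

End semigroup_theory.

(** * Measurability and translation *)

Section covers.
Local Open Scope ereal_scope.
Context {R : realType} {T : pointedType}.
Variable zeta : set T -> \bar R.
Hypotheses (zeta0 : zeta set0 = 0) (zeta_ge0 : forall A, 0 <= zeta A).

Lemma cover_ext_le A (F : (set T)^nat) : A `<=` \bigcup_k F k ->
  cover_ext zeta A <= \sum_(k <oo) zeta (F k).
Proof.
move=> AF; apply: ereal_inf_lbound; exists F => //; split => // k.
exact: sub_sigma_algebra.
Qed.

Lemma cover_ext_le1 A : cover_ext zeta A <= zeta A.
Proof.
apply: (le_trans (@cover_ext_le A (fun k => if k == 0%N then A else set0) _)).
  by move=> x Ax; exists 0%N.
rewrite (nneseriesD1 (n := 0%N))//= eseries0 ?adde0//.
by move=> k _ /=; case: k.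
Qed.

Lemma le_cover_ext_glb (M : \bar R) A :
  (forall F : (set T)^nat, A `<=` \bigcup_k F k -> M <= \sum_(k <oo) zeta (F k)) ->
  M <= cover_ext zeta A.
Proof. by move=> H; apply: le_ereal_inf_tmp => _ [F [_ AF] <-]; exact: H. Qed.

Lemma cover_ext_approx A e : (0 < e)%R -> cover_ext zeta A \is a fin_num ->
  exists2 F : (set T)^nat, A `<=` \bigcup_k F k &
    \sum_(k <oo) zeta (F k) < cover_ext zeta A + e%:E.
Proof.
move=> e0 Afin; have [_ [F [_ AF] <-] lt] := @lb_ereal_inf_adherent R _ _ e0 Afin.
by exists F.
Qed.

End covers.

(** * Open sets are measurable as soon as half-spaces are *)

Section open_sets.
Context {R : realType} {d : nat}.
Let E := 'rV[R]_d.

Definition half_space (i : 'I_d) (c : R) : set E := [set x | x 0 i <= c].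

Lemma open_rVP (U : set E) (x : E) : open U -> U x ->
  exists2 e, 0 < e & forall y : E, (forall i, `|y 0 i - x 0 i| < e) -> U y.
Proof.
rewrite openE => /[apply]; rewrite /interior -nbhs_ballE => -[e /= e0 eU].
exists e => // y xy; apply: eU; split => // i j.
by rewrite (ord1 i) /ball/= distrC.
Qed.

Definition rat_cube (p : 'rV[rat]_d) (n : nat) : set E :=
  [set x | forall i, `|x 0 i - ratr (p 0 i)| < n.+1%:R^-1].

Definition closed_rat_cube (p : 'rV[rat]_d) (n : nat) : set E :=
  [set x | forall i, `|x 0 i - ratr (p 0 i)| <= n.+1%:R^-1].

Lemma rat_cube_in_open (U : set E) (x : E) : open U -> U x ->
  exists p n, rat_cube p n x /\ closed_rat_cube p n `<=` U.
Proof.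
move=> oU /(open_rVP oU)[e e0 eU].
have [n ne'] := ltr_add_invr (divr_gt0 e0 (ltr0Sn R 1)); rewrite add0r in ne'.
have n0 : 0 < n.+1%:R^-1 :> R by rewrite invr_gt0.
have ne : n.+1%:R^-1 + n.+1%:R^-1 < e by rewrite [ltRHS]splitr ltrD.
have /choice[p pP] (i : 'I_d) : exists q : rat, `|x 0 i - ratr q| < n.+1%:R^-1.
  have [|q] := @rat_in_itvoo R (x 0 i - n.+1%:R^-1) (x 0 i + n.+1%:R^-1).
    by rewrite ltrBlDr -addrA ltrDl addr_gt0.
  by rewrite in_itv/= -ltr_distlC => ?; exists q.
exists (\row_i p i), n; split => [i|y yp]; first by rewrite mxE.
apply: eU => i.
have -> : y 0 i - x 0 i = (y 0 i - ratr (p i)) + - (x 0 i - ratr (p i)) by ring.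
apply: le_lt_trans (ler_normD _ _) _; apply: le_lt_trans ne; rewrite normrN.
by apply: lerD; [have := yp i; rewrite mxE|exact: ltW].
Qed.

(* An enumeration of the open cubes with rational data whose closure lies in [U]. *)
Definition inner_cube (U : set E) (k : nat) : set E :=
  if unpickle k is Some (p, n) then
    if `[< closed_rat_cube p n `<=` U >] then rat_cube p n else set0
  else set0.

Lemma bigcup_inner_cube (U : set E) : open U -> \bigcup_k inner_cube U k = U.
Proof.
move=> oU; apply/seteqP; split => [x [k _]|x Ux].
  rewrite /inner_cube; case: unpickle => // -[p n]; case: asboolP => // + xp; apply.
  by move=> i; exact: ltW.
have [p [n [xp pU]]] := rat_cube_in_open oU Ux.
exists (pickle (p, n)) => //; rewrite /inner_cube pickleK.
by case: asboolP.
Qed.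

Variable mu : {outer_measure set E -> \bar R}.
Hypothesis half_space_cara : forall i c, mu.-caratheodory (half_space i c).

Lemma rat_cube_caratheodory p n : mu.-caratheodory (rat_cube p n).
Proof.
have lt_cara i c : mu.-caratheodory [set x : E | x 0 i < c].
  rewrite (_ : [set x | _] = \bigcup_k half_space i (c - k.+1%:R^-1)).
    exact: caratheodory_measurable_bigcup.
  apply/seteqP; split => [x /= xc|x [k _ /=]]; last first.
    by move/le_lt_trans; apply; rewrite ltrBlDr ltrDl invr_gt0.
  by have [m mc] := ltr_add_invr xc; exists m; rewrite // /half_space/= lerBrDr ltW.
rewrite (_ : rat_cube p n = \bigcap_(i in [set: 'I_d])
    ([set x : E | x 0 i < ratr (p 0 i) + n.+1%:R^-1] `&`
     ~` half_space i (ratr (p 0 i) - n.+1%:R^-1))); last first.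
  apply/seteqP; split => [x xp i _|x xp i].
    by have := xp i; rewrite ltr_distl => /andP[a b]; split => //=; apply/negP; rewrite -ltNge.
  have [//|/= h1 /negP] := xp i; rewrite -ltNge => h2.
  by rewrite ltr_distl h1 h2.
suff : measurable (\bigcap_(i in [set: 'I_d])
    ([set x : E | x 0 i < ratr (p 0 i) + n.+1%:R^-1] `&`
     ~` half_space i (ratr (p 0 i) - n.+1%:R^-1)) : set (caratheodory_type mu)) by [].
apply: fin_bigcap_measurable => // i _.
apply: caratheodory_measurable_setI => //.
exact: caratheodory_measurable_setC.
Qed.

Lemma open_caratheodory (U : set E) : open U -> mu.-caratheodory U.
Proof.
move=> /bigcup_inner_cube <-; apply: caratheodory_measurable_bigcup => k.
rewrite /inner_cube; case: unpickle => [[p n]|]; last exact: caratheodory_measurable_set0.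
case: ifP => _; first exact: rat_cube_caratheodory.
exact: caratheodory_measurable_set0.
Qed.

Lemma closed_caratheodory (C : set E) : closed C -> mu.-caratheodory C.
Proof.
move=> cC; rewrite -[C]setCK; apply: caratheodory_measurable_setC.
by apply: open_caratheodory; exact: closed_openC.
Qed.

Lemma continuous_within_measurable (D : set E) (f : E -> R) : mu.-caratheodory D ->
  {within D, continuous f} ->
  measurable_fun (D : set (caratheodory_type mu)) (f : caratheodory_type mu -> R).
Proof.
move=> mD cf; apply: (measurability _ (RGenOInfty.measurableE R)) => _ [_ [a ->] <-].
have /open_subspaceP[V oV VD] : open ((f : subspace D -> R) @^-1` `]a, +oo[).
  by move/continuousP : cf; apply; exact: interval_open.
by rewrite setIC -VD; apply: caratheodory_measurable_setI => //; exact: open_caratheodory.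
Qed.

Lemma continuous_measurable (f : E -> R) : continuous f ->
  measurable_fun setT (f : caratheodory_type mu -> R).
Proof.
move=> cf; apply: continuous_within_measurable; first exact: (@measurableT _ (caratheodory_type mu)).
exact: continuous_subspaceT.
Qed.

End open_sets.

Lemma caratheodory_outer_restr (R : realType) (T : pointedType)
    (mu : {outer_measure set T -> \bar R}) (D A : set T) :
  mu.-caratheodory A -> (outer_restr mu D).-caratheodory A.
Proof. by move=> mA X; rewrite /outer_restr (mA (X `&` D)) (setIAC X A) (setIAC X (~` A)). Qed.

Section lebesgue_outer.
Context {R : realType} {d : nat}.
Let E := 'rV[R]_d.

Lemma box_volume_ge0 (A : set E) : (0 <= box_volume A)%E.
Proof.
apply: le_ereal_inf_tmp => _ [[_ ->]//|[a [b [ab _ ->]]]].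
by rewrite lee_fin prodr_ge0// => i _; rewrite subr_ge0.
Qed.

Lemma box_volume0 : box_volume (set0 : set E) = 0%E.
Proof.
apply/eqP; rewrite eq_le box_volume_ge0 andbT.
by apply: ereal_inf_lbound; left.
Qed.

Lemma lebesgue_outer_le_volume (A : set E) : (lebesgue_outer A <= box_volume A)%E.
Proof. exact: (cover_ext_le1 box_volume0 box_volume_ge0). Qed.

Lemma lebesgue_outer_box (a b : E) : (forall i, (a 0 i <= b 0 i)%R) ->
  (lebesgue_outer (box a b) <= (\prod_i (b 0 i - a 0 i))%:E)%E.
Proof.
move=> ab; apply: le_trans (lebesgue_outer_le_volume _) _.
by apply: ereal_inf_lbound; right; exists a, b.
Qed.

(** A hyperplane orthogonal to an axis cuts a box into two boxes whose volumes add up; summing over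
    a cover splits the outer measure of any set. *)
Lemma half_space_lebesgue i c : (@lebesgue_outer R d).-caratheodory (half_space i c).
Proof.
apply: le_caratheodory_measurable => X; apply: le_cover_ext_glb => F XF.
set H := half_space i c.
have key A : (lebesgue_outer (A `&` H) + lebesgue_outer (A `&` ~` H) <= box_volume A)%E.
  apply: le_ereal_inf_tmp => _ [[-> ->]|[a [b [ab -> ->]]]].
    by rewrite !set0I outer_measure0 adde0.
  (* [c] is clamped to the edge of the box, so that both pieces have ordered corners even when the
     hyperplane misses the box. *)
  pose m := Num.max (a 0 i) (Num.min (b 0 i) c).
  have am : (a 0 i <= m)%R by rewrite le_max lexx.
  have mb : (m <= b 0 i)%R by rewrite ge_max ab ge_min lexx.
  pose b' : E := \row_j (if j == i then m else b 0 j).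
  pose a' : E := \row_j (if j == i then m else a 0 j).
  have ab' j : (a 0 j <= b' 0 j)%R by rewrite mxE; case: eqP => [->|].
  have a'b j : (a' 0 j <= b 0 j)%R by rewrite mxE; case: eqP => [->|].
  have s1 : box a b `&` H `<=` box a b'.
    move=> x [xab xH] j; rewrite mxE; case: eqP => [->|_]; last exact: xab.
    have /andP[-> xb] := xab i; rewrite /= /m le_max.
    by rewrite le_min xb xH orbT.
  have s2 : box a b `&` ~` H `<=` box a' b.
    move=> x [xab /negP]; rewrite -ltNge => xH j; rewrite mxE; case: eqP => [->|_]; last exact: xab.
    have /andP[xa ->] := xab i; rewrite andbT /m gt_max xa/=.
    by rewrite gt_min xH orbT.
  apply: (@le_trans _ _ (lebesgue_outer (box a b') + lebesgue_outer (box a' b))%E).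
    by apply: leeD; apply: le_outer_measure.
  apply: le_trans (leeD (lebesgue_outer_box ab') (lebesgue_outer_box a'b)) _.
  rewrite -EFinD lee_fin !(bigD1 (P := predT) i)//= !mxE eqxx.
  rewrite (eq_bigr (fun j => b 0 j - a 0 j)%R); last by move=> j /negbTE ji; rewrite mxE ji.
  rewrite [X in (_ + _ * X)%R](eq_bigr (fun j => b 0 j - a 0 j)%R); last first.
    by move=> j /negbTE ji; rewrite mxE ji.
  by rewrite -mulrDl addrC addrA subrK.
apply: (@le_trans _ _ (\sum_(k <oo) (lebesgue_outer (F k `&` H) + lebesgue_outer (F k `&` ~` H)))%E).
  rewrite nneseriesD//; last 2 first.
    by move=> *; exact: outer_measure_ge0.
    by move=> *; exact: outer_measure_ge0.
  apply: leeD.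
    apply: le_trans (outer_measure_sigma_subadditive _ (fun k => F k `&` H)).
    by apply: le_outer_measure; rewrite -setI_bigcupl; exact: setSI.
  apply: le_trans (outer_measure_sigma_subadditive _ (fun k => F k `&` ~` H)).
  by apply: le_outer_measure; rewrite -setI_bigcupl; exact: setSI.
by apply: lee_nneseries => k *; [rewrite adde_ge0// outer_measure_ge0|exact: key].
Qed.

Lemma lebesgue_outer_bounded (A : set E) : bounded_set A -> (lebesgue_outer A < +oo)%E.
Proof.
move=> [M [_ /(_ (M + 1))]]; rewrite ltrDl => /(_ ltr01) AM.
(* Boxes exclude their lower faces, hence the additional 1. *)
pose c := (`|M + 1| + 1)%R.
have AB : A `<=` box (\row__ - c) (\row__ c).
  move=> x /AM /= xM i; rewrite !mxE.
  have : (`|x 0 i| <= M + 1)%R.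
    apply: le_trans xM; have -> : `|x| = mx_norm x by []; rewrite mx_normrE.
    by apply: (le_bigmax _ _ (0, i)).
  rewrite ler_norml => /andP[h1 h2]; rewrite /c.
  have := ler_norm (M + 1); have := ler_norm (- (M + 1)); rewrite normrN => h3 h4.
  by apply/andP; split; lra.
apply: le_lt_trans (le_outer_measure _ _ _ AB) _.
apply: le_lt_trans (lebesgue_outer_box _) (ltry _) => i.
by rewrite !mxE ge0_cp// addr_ge0.
Qed.

Definition translate (v : E) (A : set E) : set E := [set x | A (x - v)].

Lemma box_volume_translate v (A : set E) : (box_volume (translate v A) <= box_volume A)%E.
Proof.
apply: le_ereal_inf_tmp => _ [[-> ->]|[a [b [ab -> ->]]]].
  by apply: ereal_inf_lbound; left; split => //; apply/seteqP; split.
apply: ereal_inf_lbound; right; exists (a + v), (b + v); split.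
- by move=> i; rewrite !mxE lerD2r.
- by apply/seteqP; split => x /= xab i; have := xab i; rewrite !mxE; lra.
- by congr EFin; apply: eq_bigr => i _; rewrite !mxE opprD addrACA subrr addr0.
Qed.

Lemma translateN v (A : set E) : translate (- v) (translate v A) = A.
Proof. by apply/seteqP; split => x; rewrite /translate/= opprK addrK. Qed.

Lemma lebesgue_outer_translate v (A : set E) :
  lebesgue_outer (translate v A) = lebesgue_outer A.
Proof.
have key w (B : set E) : (lebesgue_outer (translate w B) <= lebesgue_outer B)%E.
  apply: le_cover_ext_glb => F BF.
  apply: le_trans (@cover_ext_le _ _ _ _ (fun k => translate w (F k)) _) _.
    by move=> x /BF[k _ Fk]; exists k.
  apply: lee_nneseries => k *; [exact: box_volume_ge0|exact: box_volume_translate].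
by apply/eqP; rewrite eq_le key/= -{1}(translateN v A) key.
Qed.

End lebesgue_outer.

Section hausdorff.
Context {R : realType} {d s : nat}.
Let E := 'rV[R]_d.
Local Notation H := (@hausdorff_outer R d s).

Lemma hausdorff_gauge_ge0 delta (A : set E) : (0 <= hausdorff_gauge s delta A)%E.
Proof.
rewrite /hausdorff_gauge; case: eqVneq => // /set0P[x Ax].
case: ifPn => // _; apply: mule_ge0; first exact: outer_measure_ge0.
rewrite lee_fin exprn_ge0// divr_ge0// fine_ge0//.
apply: (@le_trans _ _ (eucl_dist x x)%:E); first by rewrite lee_fin sqrtr_ge0.
by apply: ereal_sup_ubound; exists x => //; exists x.
Qed.

Lemma hausdorff_gauge0 delta : hausdorff_gauge s delta (set0 : set E) = 0%E.
Proof. by rewrite /hausdorff_gauge eqxx. Qed.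

Lemma le_hausdorff_gauge delta1 delta2 (A : set E) : delta1 <= delta2 ->
  (hausdorff_gauge s delta2 A <= hausdorff_gauge s delta1 A)%E.
Proof.
move=> d12; rewrite /hausdorff_gauge; case: ifP => // _.
case: (boolP (diam A <= delta1%:E)%E) => [A1|_]; last exact: leey.
by rewrite (le_trans A1) ?lee_fin.
Qed.

Lemma le_hausdorff_outer delta (A : set E) : 0 < delta ->
  (cover_ext (hausdorff_gauge s delta) A <= H A)%E.
Proof. by move=> delta0; apply: ereal_sup_ubound; exists delta. Qed.

Lemma eucl_dist_coord (x y : E) i : `|x 0 i - y 0 i| <= eucl_dist x y.
Proof.
rewrite -sqrtr_sqr ler_sqrt ?sumr_ge0//; last by move=> j _; exact: sqr_ge0.
by rewrite (bigD1 i)//= lerDl sumr_ge0// => j _; exact: sqr_ge0.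
Qed.

(** A set of diameter less than [c' - c] cannot meet both [A] and [B], so a fine cover of the union
    splits into disjoint families covering each. *)
Lemma hausdorff_outer_separated i (c c' : R) (A B : set E) : c < c' ->
  (forall x, A x -> x 0 i <= c) -> (forall x, B x -> c' <= x 0 i) ->
  (H A + H B <= H (A `|` B))%E.
Proof.
move=> cc' Ac Bc.
have key delta : 0 < delta -> delta < c' - c ->
    (cover_ext (hausdorff_gauge s delta) A + cover_ext (hausdorff_gauge s delta) B <=
     H (A `|` B))%E.
  move=> delta0 dcc; apply: le_trans (le_hausdorff_outer _ delta0).
  apply: le_cover_ext_glb => F ABF.
  (* Members of the cover that miss [C] are replaced by the empty set, of gauge 0, which keeps the
     indexing. *)
  pose meet (C : set E) k := if `[< exists2 x, C x & F k x >] then F k else set0.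
  have meet_cover C : C `<=` A `|` B -> C `<=` \bigcup_k meet C k.
    move=> CAB x Cx; have [k _ Fkx] := ABF x (CAB x Cx); exists k => //.
    by rewrite /meet asboolT//; exists x.
  have g0 := hausdorff_gauge_ge0 delta.
  have cA := cover_ext_le (hausdorff_gauge s delta) (@meet_cover A (@subsetUl _ A B)).
  have cB := cover_ext_le (hausdorff_gauge s delta) (@meet_cover B (@subsetUr _ A B)).
  apply: le_trans (leeD cA cB) _.
  rewrite -nneseriesD//.
  apply: lee_nneseries => k *; first by rewrite adde_ge0.
  rewrite /meet; case: asboolP => [[x Ax Fx]|_]; case: asboolP => [[y By Fy]|_];
    rewrite ?hausdorff_gauge0 ?adde0 ?add0e//.
  rewrite {3}/hausdorff_gauge; case: ifPn => [/eqP F0|_]; first by rewrite F0 in Fx.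
  case: ifPn => [Fd|]; last by rewrite leey.
  have : ((eucl_dist x y)%:E <= delta%:E)%E.
    by apply: le_trans Fd; apply: ereal_sup_ubound; exists x => //; exists y.
  rewrite lee_fin => xyd; exfalso; have := le_trans (eucl_dist_coord x y i) xyd.
  have := Ac x Ax; have := Bc y By; rewrite ler_distl => h1 h2 /andP[h3 h4]; lra.
have [->|Hfin] := eqVneq (H (A `|` B)) +oo%E; first by rewrite leey.
have HABfin : H (A `|` B) \is a fin_num.
  by rewrite ge0_fin_numE ?outer_measure_ge0// ltey.
have HA : (H A <= H (A `|` B))%E by apply: le_outer_measure => x; left.
have HB : (H B <= H (A `|` B))%E by apply: le_outer_measure => x; right.
have HAfin : H A \is a fin_num.
  by rewrite ge0_fin_numE ?outer_measure_ge0// (le_lt_trans HA)// ltey.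
rewrite addeC -leeBrDr//; apply: ge_ereal_sup => _ [d1 /= d10 <-].
rewrite leeBrDr// addeC.
have C1fin : cover_ext (hausdorff_gauge s d1) B \is a fin_num.
  rewrite ge0_fin_numE; last exact: cover_ext_ge0 (hausdorff_gauge_ge0 _) _.
  by apply: le_lt_trans (le_hausdorff_outer _ d10) _; rewrite (le_lt_trans HB)// ltey.
rewrite -leeBrDr//; apply: ge_ereal_sup => _ [d2 /= d20 <-].
rewrite leeBrDr//.
(* The gauge grows as delta decreases, so one scale below [d1], [d2] and the gap serves both
   suprema. *)
pose dd := Num.min (Num.min d1 d2) ((c' - c) / 2).
have cc0 : 0 < c' - c by rewrite subr_gt0.
have dd0 : 0 < dd by rewrite !lt_min d10 d20 divr_gt0.
have ddc : dd < c' - c by rewrite gt_min ltr_pdivrMr// ltr_pMr// ltr1n orbT.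
apply: le_trans (key _ dd0 ddc); apply: leeD.
  apply: le_cover_ext_glb => F AF; apply: le_trans (cover_ext_le _ AF) _.
  apply: lee_nneseries => k *; first exact: hausdorff_gauge_ge0.
  by apply: le_hausdorff_gauge; rewrite !ge_min lexx orbT.
apply: le_cover_ext_glb => F AF; apply: le_trans (cover_ext_le _ AF) _.
apply: lee_nneseries => k *; first exact: hausdorff_gauge_ge0.
by apply: le_hausdorff_gauge; rewrite !ge_min lexx.
Qed.

(* Caratheodory's criterion for metric outer measures: the part of [X] beyond the
   half-space is exhausted by [V n], and the slabs [D k] in between, taken two by
   two, are at positive distance, so that their measures are summable. *)
Lemma half_space_hausdorff i c : H.-caratheodory (half_space i c).
Proof.
set C := half_space i c.
suff key X : (H (X `&` C) + H (X `&` ~` C) <= H X)%E by exact: le_caratheodory_measurable key.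
have [->|HX] := eqVneq (H X) +oo%E; first by rewrite leey.
have Hfin Y : Y `<=` X -> H Y \is a fin_num.
  move=> YX; rewrite ge0_fin_numE ?outer_measure_ge0//.
  by rewrite (le_lt_trans (le_outer_measure _ _ _ YX))// ltey.
pose r (n : nat) : R := c + n.+1%:R^-1.
have rS n : r n.+1 < r n by rewrite ltrD2l ltf_pV2 ?posrE// ltr_nat.
have rc n : c < r n by rewrite ltrDl invr_gt0.
pose V n := X `&` [set x | r n <= x 0 i].
pose D n := X `&` [set x | r n.+1 <= x 0 i < r n].
have VS n : V n `<=` V n.+1 by move=> x [Xx /= rx]; split => //=; rewrite (le_trans _ rx)// ltW.
have DV n : D n `<=` V n.+1 by move=> x [Xx /= /andP[]].
(* [p] is the parity. The new slab lies below level [r (n.*2 + p).+2] and the earlier ones above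
   [r (n.*2 + p).+1]; the skipped slab is the gap that makes the measures superadditive. *)
have step p n : (\sum_(j < n.+1) H (D (j.*2 + p)%N) <= H (V (n.*2 + p).+1))%E.
  elim: n => [|n IH].
    by rewrite big_ord1; apply: le_outer_measure; exact: DV.
  rewrite big_ord_recr; apply: (@le_trans _ _ (H (V (n.*2 + p).+1) + H (D (n.+1.*2 + p)%N))%E).
    exact: leeD2r.
  rewrite addeC; apply: (@le_trans _ _ (H (D (n.+1.*2 + p)%N `|` V (n.*2 + p).+1))).
    apply: (@hausdorff_outer_separated i (r (n.*2 + p).+2) (r (n.*2 + p).+1)) => //.
      by move=> x [_ /= /andP[_ /ltW]]; rewrite doubleS.
    by move=> x [].
  apply: le_outer_measure => x [|]; first exact: DV.
  by move/VS/VS; rewrite doubleS.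
have sumD p n : (\sum_(j < n) H (D (j.*2 + p)%N) <= H X)%E.
  case: n => [|n]; first by rewrite big_ord0 outer_measure_ge0.
  by apply: le_trans (step p n) _; apply: le_outer_measure => x [].
have sumDD : (\sum_(k <oo) H (D k) <= H X + H X)%E.
  apply: lime_le; first by apply: is_cvg_nneseries => *; exact: outer_measure_ge0.
  apply: nearW => n; apply: (@le_trans _ _ (\sum_(0 <= k < n.*2) H (D k))%E).
    apply: lee_sum_nneg_natr => //; first by move=> *; exact: outer_measure_ge0.
    by rewrite -addnn leq_addr.
  apply: le_trans (leeD (sumD 0%N n) (sumD 1%N n)).
  rewrite -big_split/= big_mkord.
  elim: n => [|n IH]; first by rewrite !big_ord0.
  rewrite doubleS !big_ord_recr/= -addeA; apply: leeD => //.
  by rewrite addn0 addn1.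
have tail : (\sum_(N <= k <oo) H (D k))%E @[N --> \oo] --> 0%E.
  apply: nneseries_tail_cvg; last by move=> *; exact: outer_measure_ge0.
  by rewrite (le_lt_trans sumDD)// lte_add_pinfty// ltey.
apply/lee_addgt0Pr => e e0.
have [N tN] : exists N, (\sum_(N <= k <oo) H (D k) <= e%:E)%E.
  have : \forall N \near \oo, (\sum_(N <= k <oo) H (D k) < e%:E)%E.
    have /tail : nbhs 0%E [set x : \bar R | (x < e%:E)%E].
      by apply: open_nbhs_nbhs; split; [exact: open_ereal_lt_ereal|rewrite /= lte_fin].
    by [].
  by move=> [N _ /(_ N)/(_ (leqnn N))/ltW]; exists N.
have outside : (H (X `&` ~` C) <= H (V N) + \sum_(N <= k <oo) H (D k))%E.
  apply: (@le_trans _ _ (H (V N `|` \bigcup_(n in ~` `I_N) D n))); last first.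
    apply: le_trans (outer_measureU2 _ _ _) _; apply: leeD2l.
    exact: outer_measure_sigma_subadditive_tail.
  apply: le_outer_measure => x [Xx /negP]; rewrite -ltNge => cx.
  have [xN|xN] := leP (r N) (x 0 i); [by left|right].
  have exP : exists n, r n <= x 0 i.
    by have [n nc] := ltr_add_invr cx; exists n; exact: ltW.
  (* With [m] least such that [r m <= x 0 i], the point lies in slab [m.-1]; as it is below [r N],
     [N < m], so the predecessor is legitimate and at least [N]. *)
  case: (ex_minnP exP) => m Pm minm.
  have Nm : (N < m)%N.
    rewrite ltnNge; apply/negP => mN.
    suff : r N <= r m by move=> /le_trans/(_ Pm); rewrite leNgt xN.
    by rewrite lerD2l lef_pV2 ?posrE// ler_nat.
  have m0 : (0 < m)%N by rewrite (leq_ltn_trans _ Nm).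
  exists m.-1; first by rewrite /= => /=; apply/negP; rewrite -leqNgt -ltnS prednK.
  split => //=; rewrite prednK//; apply/andP; split => //.
  rewrite ltNge; apply/negP => /minm; rewrite leqNgt prednK//.
  by rewrite leqnn.
have sep : (H (X `&` C) + H (V N) <= H X)%E.
  apply: le_trans (@hausdorff_outer_separated i c (r N) _ _ _ _ _) _ => //.
  - by move=> x [].
  - by move=> x [].
  - by apply: le_outer_measure => x [] [].
apply: le_trans (leeD2l _ outside) _; rewrite addeA.
exact: leeD sep tN.
Qed.

End hausdorff.

(** * Smooth functions and their density *)

Section flat_functions.
Context {R : realType}.

(** The classical flat function exp(-1/x) with the powers of 1/x that its derivatives produce: the
    linear span of the family is closed under differentiation. *)
Definition flat (n : nat) (x : R) : R :=
  if 0 < x then x^-1 ^+ n * expR (- x^-1) else 0.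

(** The exponential of 1/x dominates the term of degree n + 1 of its series, which leaves one factor
    x to spare. *)
Lemma flat_le n x : `|flat n x| <= (n.+1)`!%:R * `|x|.
Proof.
rewrite /flat; case: ifPn => [x0|_]; last by rewrite normr0 mulr_ge0.
have y0 : 0 < x^-1 by rewrite invr_gt0.
rewrite !gtr0_norm ?mulr_gt0 ?exprn_gt0 ?expR_gt0// expRN.
rewrite ler_pdivrMr ?expR_gt0//.
have := expR_ge1Dxn n (ltW y0); move: (expR _) => e.
have f0 : 0 < (n.+1)`!%:R :> R by rewrite ltr0n fact_gt0.
rewrite -lerBrDl => /le_trans/(_ (_ : _ <= e)); rewrite gerBl// => /(_ ler01).
rewrite ler_pdivrMr// exprS => ye.
rewrite -(ler_pM2l y0) (le_trans ye)// mulrC !mulrA [x^-1 * _]mulrC -!mulrA.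
by rewrite [x^-1 * _]mulrA mulVf ?mul1r// gt_eqF.
Qed.

Lemma flat_ge0 n x : 0 <= flat n x.
Proof. by rewrite /flat; case: ifP => // x0; rewrite mulr_ge0 ?expR_ge0// exprn_ge0// invr_ge0 ltW. Qed.

Lemma flat_gt0 n x : (0 < flat n x) = (0 < x).
Proof.
rewrite /flat; case: ifPn => [x0|_]; last by rewrite ltxx.
by rewrite mulr_gt0 ?expR_gt0// exprn_gt0// invr_gt0.
Qed.

Lemma flat0_le1 x : flat 0 x <= 1.
Proof.
by rewrite /flat; case: ifP => // x0; rewrite mul1r expR_le1 oppr_le0 invr_ge0 ltW.
Qed.

Lemma flat_eq0 n x : x <= 0 -> flat n x = 0.
Proof. by rewrite /flat leNgt => /negbTE ->. Qed.

Lemma is_derive_flat (n : nat) (x : R) : is_derive x 1 (flat n) (flat n.+2 x - n%:R * flat n.+1 x).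
Proof.
have [x0|x0|->] := ltgtP x 0.
- have -> : flat n.+2 x - n%:R * flat n.+1 x = 0.
    by rewrite /flat ltNge (ltW x0)/= mulr0 subrr.
  apply: (@near_eq_is_derive _ _ _ (cst 0 : R -> R)).
  near=> y; rewrite /flat ltNge ifF//; apply/negbTE; rewrite negbK ltW//.
  by near: y; exact: lt_nbhsl.
- pose F (y : R) := y^-1 ^+ n * expR (- y^-1).
  apply: (@near_eq_is_derive _ _ _ F).
    near=> y; rewrite /flat ifT//.
    by near: y; exact: lt_nbhsr.
  have dV : is_derive x 1 (fun y : R => y^-1) (- x ^- 2).
    have := @is_deriveV R id x 1 1 (lt0r_neq0 x0) (is_derive_id _ _).
    by rewrite /GRing.scale/= mulr1.
  have dN : is_derive x 1 (fun y : R => - y^-1) (x ^- 2).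
    by rewrite -[x ^- 2]opprK; exact: is_deriveN.
  have dE : is_derive x 1 (fun y : R => expR (- y^-1)) (expR (- x^-1) * x ^- 2).
    exact: (is_derive1_comp (is_derive_expR _) dN).
  have dX : is_derive x 1 (fun y : R => y^-1 ^+ n) (n%:R * x^-1 ^+ n.-1 * - x ^- 2).
    have := is_deriveX n dV; rewrite /GRing.scale/=.
    by rewrite (_ : (fun y : R => y^-1) ^+ n = (fun y => y^-1 ^+ n))//; exact: exprfctE.
  rewrite [X in is_derive _ _ _ X](_ : _ = x^-1 ^+ n *: (expR (- x^-1) * x ^- 2) +
      expR (- x^-1) *: (n%:R * x^-1 ^+ n.-1 * - x ^- 2)); first exact: is_deriveM.
  rewrite /GRing.scale/=.
  rewrite /flat x0; case: n {F dX} => [|n]/=; rewrite -?exprVn ?exprS; ring.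
- have -> : flat n.+2 0 - n%:R * flat n.+1 0 = 0 by rewrite /flat ltxx mulr0 subrr.
  have lim0 : h^-1 *: ((flat n \o shift 0) (h *: 1) - flat n 0) @[h --> 0^'] --> 0.
    apply/cvgrPdist_le => e e0.
    have f0 : 0 < (n.+2)`!%:R :> R by rewrite ltr0n fact_gt0.
    exists (e / (n.+2)`!%:R); first by rewrite /= divr_gt0.
    move=> h /=; rewrite !sub0r !normrN => he h0.
    rewrite addr0 {2}/flat ltxx subr0 /GRing.scale/= mulr1.
    (* The difference quotient at 0 is the next member of the family, so the linear bound [flat_le]
       is all that is needed. *)
    have -> : h^-1 * flat n h = flat n.+1 h.
      by rewrite /flat; case: ifP => _; rewrite ?mulr0// exprS mulrA.
    apply: le_trans (flat_le _ _) _.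
    by rewrite mulrC -ler_pdivlMr// ltW.
  apply: DeriveDef; first by apply/cvg_ex; exists 0; exact: lim0.
  exact: cvg_lim lim0.
Unshelve. all: by end_near. Qed.

Lemma continuous_flat n : continuous (flat n).
Proof.
move=> x; apply: differentiable_continuous; apply/derivable1_diffP.
by have df := is_derive_flat n x; exact: ex_derive.
Qed.

End flat_functions.

Section lines.
Context {R : realType} {V W : normedModType R}.

Lemma is_derive_line (f : V -> W) (a v : V) (s : R) (df : W) :
  is_derive s 1 (fun h : R => f (h *: v + a)) df <-> is_derive (s *: v + a) v f df.
Proof.
pose g h := f (h *: v + a).
have E : (fun h => h^-1 *: ((g \o shift s) (h *: (1 : R)) - g s)) =
    (fun h => h^-1 *: ((f \o shift (s *: v + a)) (h *: v) - f (s *: v + a))).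
  apply/funext => h; rewrite /g /= /shift/=; congr (_ *: (f _ - _)).
  by rewrite [h *: 1]mulr1 scalerDl addrA.
split => -[dg <-]; (apply: DeriveDef; [move: dg|]); rewrite /derivable /derive.
- by rewrite E.
- by rewrite E.
- by rewrite -E.
- by rewrite -E.
Qed.

End lines.

Section bump_algebra.
Context {R : realType} {d : nat}.
Let E := 'rV[R]_d.

(* Functions generated by constants and [flat n (s x_i + a)]: a class of smooth
   functions visibly stable under partial derivatives, sums and products. *)
Inductive bump_alg : (E -> R) -> Prop :=
| bump_cst c : bump_alg (fun=> c)
| bump_flat n s a i : bump_alg (fun x => flat n (s * x 0 i + a))
| bump_add f g : bump_alg f -> bump_alg g -> bump_alg (fun x => f x + g x)
| bump_mul f g : bump_alg f -> bump_alg g -> bump_alg (fun x => f x * g x).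

Lemma bump_alg_continuous f : bump_alg f -> continuous f.
Proof.
elim=> [c|n s a i|{}f g _ cf _ cg|{}f g _ cf _ cg] x.
- exact: cst_continuous.
- apply: (@continuous_comp _ _ _ (fun x : E => s * x 0 i + a) (flat n)).
    apply: continuousD; last exact: cst_continuous.
    by apply: continuousM; [exact: cst_continuous|exact: coord_continuous].
  exact: continuous_flat.
- by apply: continuousD; [exact: cf|exact: cg].
- by apply: continuousM; [exact: cf|exact: cg].
Qed.

Lemma bump_alg_derive f (j : 'I_d) : bump_alg f ->
  exists2 g, bump_alg g & forall x, is_derive x (delta_mx 0 j) f (g x).
Proof.
elim=> [c|n s a i|{}f g af [f' af' df] ag [g' ag' dg]|{}f g af [f' af' df] ag [g' ag' dg]].
- exists (fun=> 0); first exact: bump_cst.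
  by move=> x; exact: is_derive_cst.
- exists (fun x => (s * (i == j)%:R) *
      (flat n.+2 (s * x 0 i + a) + - n%:R * flat n.+1 (s * x 0 i + a))).
    apply: bump_mul; first exact: bump_cst.
    apply: bump_add; first exact: bump_flat.
    by apply: bump_mul; [exact: bump_cst|exact: bump_flat].
  move=> x; have -> : x = 0 *: delta_mx 0 j + x by rewrite scale0r add0r.
  apply/is_derive_line.
  have -> : (fun h : R => flat n (s * (h *: delta_mx 0 j + x : E) 0 i + a)) =
      flat n \o (fun h => h * (s * (i == j)%:R) + (s * x 0 i + a)).
    by apply/funext => h; rewrite /= !mxE eqxx/=; congr flat; ring.
  have dl : is_derive (0 : R) 1 (fun h => h * (s * (i == j)%:R) + (s * x 0 i + a)) (s * (i == j)%:R).
    rewrite (_ : (fun h => _) = (id * cst (s * (i == j)%:R) + cst (s * x 0 i + a))%R)//.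
    apply: is_derive_eq.
    by rewrite scaler0 add0r addr0 /GRing.scale/= mulr1.
  apply: is_derive_eq; first exact: is_derive1_comp (is_derive_flat n _) dl.
  by rewrite /= mul0r add0r scale0r add0r mulrC mulNr.
- exists (fun x => f' x + g' x); first exact: bump_add.
  by move=> x; exact: is_deriveD.
- exists (fun x => f x * g' x + g x * f' x).
    by apply: bump_add; exact: bump_mul.
  by move=> x; exact: is_deriveM.
Qed.

Lemma bump_alg_smooth f : bump_alg f -> smooth f.
Proof.
move=> af.
have H s : bump_alg (foldr (@partial R d) f s).
  elim: s => [//|i s IH] /=; have [g ag dg] := bump_alg_derive i IH.
  by rewrite (_ : partial i _ = g)//; apply/funext => x; exact: derive_val.
move=> s; split; first exact: bump_alg_continuous.
by move=> i x; have [g _ /(_ x) dg] := bump_alg_derive i (H s); exact: ex_derive.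
Qed.

Lemma bump_prod (I : Type) (r : seq I) (F : I -> E -> R) :
  (forall i, bump_alg (F i)) -> bump_alg (fun x => \prod_(i <- r) F i x).
Proof.
move=> aF; elim: r => [|i r IH].
  by under eq_fun do rewrite big_nil; exact: bump_cst.
by under eq_fun do rewrite big_cons; exact: bump_mul.
Qed.

Lemma bump_exp n f : bump_alg f -> bump_alg (fun x => f x ^+ n).
Proof.
move=> af; elim: n => [|n IH]; first exact: bump_cst.
by under eq_fun do rewrite exprS; exact: bump_mul.
Qed.

Lemma bump_opp f : bump_alg f -> bump_alg (fun x => 1 - f x).
Proof.
move=> af; under eq_fun do rewrite -mulN1r.
by apply: bump_add; [exact: bump_cst|apply: bump_mul => //; exact: bump_cst].
Qed.

(** Positive exactly on the open cube [rat_cube p n]. The coefficients [1] and [-1] keep each factor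
    in the form of the constructor [bump_flat]. *)
Definition cube_bump (p : 'rV[rat]_d) (n : nat) (x : E) : R :=
  \prod_i (flat 0 (1 * x 0 i + (n.+1%:R^-1 - ratr (p 0 i))) *
           flat 0 (-1 * x 0 i + (n.+1%:R^-1 + ratr (p 0 i)))).

Lemma bump_cube p n : bump_alg (cube_bump p n).
Proof. by apply: bump_prod => i; apply: bump_mul; exact: bump_flat. Qed.

Lemma cube_bump_ge0 p n x : 0 <= cube_bump p n x.
Proof. by apply: prodr_ge0 => i _; rewrite mulr_ge0// flat_ge0. Qed.

Lemma cube_bump_le1 p n x : cube_bump p n x <= 1.
Proof.
apply: prodr_ile1 => i _; rewrite mulr_ge0 ?flat_ge0//=.
by rewrite mulr_ile1 ?flat_ge0 ?flat0_le1.
Qed.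

Lemma cube_bump_gt0 p n x : rat_cube p n x -> 0 < cube_bump p n x.
Proof.
move=> xp; apply: prodr_gt0 => i _; have := xp i; rewrite ltr_distl.
move: (n.+1%:R^-1) => r /andP[h1 h2].
by apply: mulr_gt0; rewrite flat_gt0; lra.
Qed.

Lemma cube_bump_eq0 p n x : ~ rat_cube p n x -> cube_bump p n x = 0.
Proof.
move=> /existsNP[i /negP]; rewrite ltr_distl negb_and -!leNgt => xi.
rewrite /cube_bump (bigD1 i)//= [X in X * _ = _](_ : _ = 0) ?mul0r//.
move: (n.+1%:R^-1) xi => r /orP[] xi.
  by rewrite [flat 0 (1 * _ + _)]flat_eq0 ?mul0r//; lra.
by rewrite [flat 0 (-1 * _ + _)]flat_eq0 ?mulr0//; lra.
Qed.

Definition inner_bump (U : set E) (k : nat) : E -> R :=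
  if unpickle k is Some (p, n) then
    if `[< closed_rat_cube p n `<=` U >] then cube_bump p n else fun=> 0
  else fun=> 0.

(** Converges to the indicator of [U]: one bump positive at [x] suffices, its factor tending to 0 as
    a power and the others lying in [0, 1]; off [U] all factors are 1. *)
Definition bump_approx (U : set E) (n : nat) (x : E) : R :=
  1 - \prod_(k < n) (1 - inner_bump U k x) ^+ n.

Lemma bump_inner U k : bump_alg (inner_bump U k).
Proof.
rewrite /inner_bump; case: unpickle => [[p n]|]; last exact: bump_cst.
by case: ifP => _; [exact: bump_cube|exact: bump_cst].
Qed.

Lemma inner_bump_ge0 U k x : 0 <= inner_bump U k x.
Proof.
by rewrite /inner_bump; case: unpickle => [[p n]|]//; case: ifP => // _; exact: cube_bump_ge0.
Qed.

Lemma inner_bump_le1 U k x : inner_bump U k x <= 1.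
Proof.
by rewrite /inner_bump; case: unpickle => [[p n]|]//; case: ifP => // _; exact: cube_bump_le1.
Qed.

Lemma bump_bump_approx U n : bump_alg (bump_approx U n).
Proof. by apply: bump_opp; apply: bump_prod => k; apply: bump_exp; apply: bump_opp; exact: bump_inner. Qed.

Let factor01 U n k x : 0 <= (1 - inner_bump U k x) ^+ n <= 1.
Proof.
have := inner_bump_ge0 U k x; have := inner_bump_le1 U k x => h1 h0.
by rewrite exprn_ge0 ?subr_ge0//= exprn_ile1 ?subr_ge0// gerBl.
Qed.

Lemma bump_approx01 U n x : 0 <= bump_approx U n x <= 1.
Proof.
rewrite subr_ge0 gerBl prodr_ge0 ?andbT => [|k _]; last by have /andP[] := factor01 U n k x.
exact: prodr_ile1.
Qed.

Lemma bump_approx_cvg U x : open U -> bump_approx U n x @[n --> \oo] --> (\1_U x : R).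
Proof.
move=> oU; rewrite indicE; case: (boolP (x \in U)) => [/set_mem|/negP xU].
  rewrite -{1}(bigcup_inner_cube oU) => -[k _ xk] /=.
  have bk : 0 < inner_bump U k x.
    move: xk; rewrite /inner_cube /inner_bump; case: unpickle => // -[p n].
    by case: ifP => // _; exact: cube_bump_gt0.
  have gk : (1 - inner_bump U k x) ^+ n @[n --> \oo] --> 0.
    apply: cvg_expr; have := inner_bump_le1 U k x => b1.
    by rewrite ger0_norm ?subr_ge0// gtrBl.
  rewrite -[X in _ --> X]subr0; apply: cvgB; first exact: cvg_cst.
  apply: (@squeeze_cvgr _ _ _ _ (cst 0) (fun n => (1 - inner_bump U k x) ^+ n)) => //; last exact: cvg_cst.
  exists k.+1 => // n /= kn.
  rewrite prodr_ge0 => [/=|j _]; last by have /andP[] := factor01 U n j x.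
  rewrite (bigD1 (Ordinal kn))//= ler_piMr//; first by have /andP[] := factor01 U n k x.
  exact: prodr_ile1.
have -> : bump_approx U ^~ x = cst (\1_U x : R).
  apply/funext => n; rewrite /= indicE; move/negP/negbTE : (xU) => ->.
  rewrite /bump_approx big1 ?subrr// => k _; rewrite [inner_bump _ _ _](_ : _ = 0) ?subr0 ?expr1n//.
  rewrite /inner_bump; case: unpickle => // -[p m]; case: asboolP => // pU.
  apply: cube_bump_eq0 => xp; apply: xU; rewrite inE; apply: pU => i; exact: ltW.
by rewrite indicE; move/negP/negbTE : (xU) => ->; exact: cvg_cst.
Qed.

End bump_algebra.

(** Change of variables in which the two image measures need agree only inside [D], the integrand
    seeing nothing else. *)
Lemma eq_pushforward_Rintegral (R : realType) d1 d2 (X : measurableType d1)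
    (Y : measurableType d2) (mu : {measure set X -> \bar R}) (phi0 phi1 : X -> Y)
    (D : set Y) (w : Y -> R) (M : R) :
  (mu setT < +oo)%E -> measurable_fun setT phi0 -> measurable_fun setT phi1 ->
  measurable D -> measurable_fun setT w -> (forall y, `|w y| <= M) ->
  (forall x, ~ D (phi0 x) -> w (phi0 x) = 0) ->
  (forall x, ~ D (phi1 x) -> w (phi1 x) = 0) ->
  (forall A, measurable A -> A `<=` D -> mu (phi0 @^-1` A) = mu (phi1 @^-1` A)) ->
  \int[mu]_x w (phi0 x) = \int[mu]_x w (phi1 x).
Proof.
move=> muT m0 m1 mD mw wM w0 w1 D01.
have iw phi : measurable_fun setT phi -> mu.-integrable setT (EFin \o w \o phi).
  move=> mphi; have oneL : l2 mu (fun=> 1).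
    by apply: (@l2_bounded _ _ _ mu 1) => // x; rewrite normr1.
  have wl : l2 mu (w \o phi).
    apply: (@l2_bounded _ _ _ mu M) => //; [exact: measurableT_comp|].
    by move=> x; exact: wM.
  by apply: (integrable_eq (integrableM wl oneL)) => x; rewrite /= mulr1.
have mw' : measurable_fun setT (EFin \o w) by exact/measurable_EFinP.
have key phi : measurable_fun setT phi -> (forall x, ~ D (phi x) -> w (phi x) = 0) ->
    (\int[mu]_x (w (phi x))%:E = \int[pushforward mu phi]_(y in D) (EFin \o w) y)%E.
  move=> mphi wphi.
  have mDphi : measurable (phi @^-1` D) by rewrite -[X in measurable X]setTI; exact: mphi.
  have -> := integral_pushforward mphi mw' (integrableS measurableT mDphi (@subsetT _ _) (iw _ mphi)) mD.
  rewrite [RHS]integral_mkcond; apply: eq_integral => x _; rewrite patchE /=.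
  case: ifPn => // /negP xD; congr EFin; apply: wphi => Dx.
  by apply: xD; rewrite inE.
rewrite /Rintegral (key _ m0 w0) (key _ m1 w1); congr fine.
by apply: eq_measure_integral => A mA AD; exact: D01.
Qed.

Section lebesgue_on.
Context {R : realType} {d : nat}.
Let E := 'rV[R]_d.
Variable Omega : set E.
Hypotheses (open_Omega : open Omega) (bounded_Omega : bounded_set Omega).
Local Notation mu := (lebesgue_on Omega).
Local Notation T0 := (caratheodory_type (@lebesgue_outer R d)).
Local Notation T1 := (caratheodory_type (outer_restr (@lebesgue_outer R d) Omega)).

Lemma half_space_lebesgue_on i c :
  (outer_restr (@lebesgue_outer R d) Omega).-caratheodory (half_space i c).
Proof. by apply: caratheodory_outer_restr; exact: half_space_lebesgue. Qed.

Lemma open_measurable_on (U : set E) : open U -> measurable (U : set T1).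
Proof. by apply: open_caratheodory; exact: half_space_lebesgue_on. Qed.

Lemma lebesgue_on_fin : (mu setT < +oo)%E.
Proof.
rewrite /lebesgue_on /cara_measure /= /outer_restr setTI.
exact: lebesgue_outer_bounded.
Qed.

Lemma continuous_measurable_on (f : E -> R) : continuous f -> measurable_fun setT (f : T1 -> R).
Proof. by apply: continuous_measurable; exact: half_space_lebesgue_on. Qed.

Lemma bounded_l2_on (f : T1 -> R) (M : R) : measurable_fun setT f ->
  (forall x, `|f x| <= M) -> l2 mu f.
Proof. by move=> mf fM; apply: l2_bounded fM => //; exact: lebesgue_on_fin. Qed.

Lemma bounded_integrable_on (f : T1 -> R) (M : R) : measurable_fun setT f ->
  (forall x, `|f x| <= M) -> mu.-integrable setT (EFin \o f).
Proof.
move=> mf fM.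
have oneL : l2 mu (fun=> 1) by apply: (@bounded_l2_on _ 1) => // x; rewrite normr1.
apply: (integrable_eq (integrableM (bounded_l2_on mf fM) oneL)) => x.
by rewrite /= mulr1.
Qed.

Lemma continuous_translate (v : E) : continuous (fun x : E => x + v).
Proof. by move=> x; apply: continuousD; [exact: cvg_id|exact: cst_continuous]. Qed.

Lemma caratheodory_translate (v : E) (A : set E) : (@lebesgue_outer R d).-caratheodory A ->
  (@lebesgue_outer R d).-caratheodory (translate v A).
Proof.
move=> mA X; have tI Y : translate (- v) (X `&` translate v Y) = translate (- v) X `&` Y.
  by rewrite -{2}(translateN v Y).
have tC : ~` translate v A = translate v (~` A) by [].
rewrite tC -(lebesgue_outer_translate (- v) X) (mA (translate (- v) X)).
by rewrite -!tI !lebesgue_outer_translate.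
Qed.

(** The measure restricted to [Omega] is not invariant. Both integrals are pushed to the
    sigma-algebra [T0] of the unrestricted measure, and compared on the intersection of [Omega] with
    its translate, which carries [w]. *)
Lemma Rintegral_translate (v : E) (w : E -> R) (M : R) : continuous w ->
  (forall x, `|w x| <= M) -> (forall x, w x != 0 -> Omega x /\ Omega (x - v)) ->
  \int[mu]_x w x = \int[mu]_x w (x + v).
Proof.
move=> cw wM w0.
pose D : set T0 := Omega `&` translate v Omega.
have oD : open (D : set E).
  apply: openI => //; rewrite /translate; apply: (open_comp (f := fun x : E => x - v)) => //.
  by move=> x _; exact: continuous_translate.
have mD : measurable D by apply: open_caratheodory => //; exact: half_space_lebesgue.
pose phi0 : T1 -> T0 := id; pose phi1 : T1 -> T0 := fun x => (x : E) + v.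
have m0 : measurable_fun setT phi0.
  by move=> _ A mA; rewrite setTI; exact: caratheodory_outer_restr.
have m1 : measurable_fun setT phi1.
  move=> _ A mA; rewrite setTI; apply: caratheodory_outer_restr.
  rewrite (_ : phi1 @^-1` A = translate (- v) A); first exact: caratheodory_translate.
  by apply/seteqP; split => x; rewrite /translate/= opprK.
have mw : measurable_fun setT (w : T0 -> R).
  by apply: continuous_measurable => //; exact: half_space_lebesgue.
apply: (@eq_pushforward_Rintegral R _ _ T1 T0 mu phi0 phi1 D w M lebesgue_on_fin m0 m1 mD mw wM).
- by move=> x xD; apply/eqP/negPn/negP => /w0.
- by move=> x xD; apply/eqP/negPn/negP => /w0.
move=> A mA AD; rewrite /lebesgue_on /cara_measure /= /outer_restr.
have -> : phi0 @^-1` A `&` Omega = A by apply/setIidPl => x /AD[].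
have -> : phi1 @^-1` A `&` Omega = translate (- v) A.
  apply/seteqP; split => x; rewrite /translate/= opprK; first by move=> [].
  by move=> xA; split => //; have [_] := AD _ xA; rewrite /translate/= addrK.
by rewrite lebesgue_outer_translate.
Qed.

End lebesgue_on.

Import HBNNSimple.

(** * From indicators of measurable sets to all of L_2 *)

Section approximation.
Context d (T : measurableType d) (R : realType).
Variable mu : {measure set T -> \bar R}.
Variable P : (T -> R) -> Prop.
Hypotheses (P0 : P (fun=> 0)) (P_l2 : forall f, P f -> l2 mu f).
Hypothesis PD : forall f g, P f -> P g -> P (fun x => f x + g x).
Hypothesis PZ : forall a f, P f -> P (fun x => a * f x).

Definition approximable (f : T -> R) := l2 mu f /\
  forall e, 0 < e -> exists2 g, P g & nrm mu (fun x => f x - g x) <= e.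

Lemma approximableD f g : approximable f -> approximable g ->
  approximable (fun x => f x + g x).
Proof.
move=> [fl fP] [gl gP]; split => [|e e0]; first exact: l2D.
have [f' Pf' ff'] := fP _ (divr_gt0 e0 (ltr0Sn R 1)).
have [g' Pg' gg'] := gP _ (divr_gt0 e0 (ltr0Sn R 1)).
exists (fun x => f' x + g' x); first exact: PD.
have -> : (fun x => f x + g x - (f' x + g' x)) = (fun x => (f x - f' x) + (g x - g' x)).
  by apply/funext => x; rewrite opprD addrACA.
rewrite [leRHS]splitr; apply: le_trans (nrmD _ _) (lerD ff' gg'); apply: l2B => //;
  exact: P_l2.
Qed.

Lemma approximableZ a f : approximable f -> approximable (fun x => a * f x).
Proof.
move=> [fl fP]; split => [|e e0]; first exact: l2Z.
have a0 : 0 < `|a| + 1 by rewrite ltr_wpDl.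
have [f' Pf' ff'] := fP _ (divr_gt0 e0 a0).
exists (fun x => a * f' x); first exact: PZ.
have -> : (fun x => a * f x - a * f' x) = (fun x => a * (f x - f' x)).
  by apply/funext => x; rewrite mulrBr.
rewrite nrmZ; last by apply: l2B => //; exact: P_l2.
by rewrite -[leRHS](divfK (lt0r_neq0 a0)) mulrC ler_pM ?nrm_ge0// lerDl.
Qed.

Lemma approximable_refl f : P f -> approximable f.
Proof.
move=> Pf; split => [|e e0]; first exact: P_l2.
exists f => //; rewrite nrm_eq0_ae ?(ltW e0)//.
  by apply: l2B; exact: P_l2.
by apply: aeW => x _; rewrite subrr.
Qed.

Lemma approximable0 : approximable (fun=> 0).
Proof. exact: approximable_refl. Qed.

Lemma approximable_sum (I : Type) (s : seq I) (a : I -> R) (F : I -> T -> R) :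
  (forall i, approximable (F i)) -> approximable (fun x => \sum_(i <- s) a i * F i x).
Proof.
move=> aF; elim: s => [|i s IH].
  by under eq_fun do rewrite big_nil; exact: approximable0.
under eq_fun do rewrite big_cons.
by apply: approximableD => //; exact: approximableZ.
Qed.

Lemma approximable_lim (F : (T -> R)^nat) f : (forall n, approximable (F n)) -> l2 mu f ->
  nrm mu (fun x => F n x - f x) @[n --> \oo] --> (0 : R) -> approximable f.
Proof.
move=> aF fl Ff; split => // e e0; have e2 := divr_gt0 e0 (ltr0Sn R 1).
move/cvgrPdist_le : Ff => /(_ _ e2)[N _ /(_ N (leqnn N))].
rewrite sub0r normrN ger0_norm ?nrm_ge0// => FNf.
have [FNl /(_ _ e2)[g Pg FNg]] := aF N.
exists g => //; have gl := P_l2 Pg.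
apply: le_trans (nrm_triangle fl gl FNl) _.
by rewrite [leRHS]splitr lerD// nrm_distC.
Qed.

Lemma approximable_dominated (F : (T -> R)^nat) f h : (forall n, approximable (F n)) ->
  l2 mu f -> l2 mu h -> (forall x, F n x @[n --> \oo] --> f x) ->
  (forall n x, `|F n x| <= h x) -> approximable f.
Proof.
move=> aF fl hl Ff Fh; apply: (approximable_lim aF fl).
by apply: (nrm_dominated _ fl hl) => // n; have [/l2_measurable] := aF n.
Qed.

Variable W : set T.
Hypothesis approximable_indic : forall A, measurable A ->
  approximable (\1_(A `&` W) : T -> R).

(** Simple functions increase to [f]; the factor [\1_W], harmless since [f] vanishes off [W], brings
    their level sets to the form [A i] intersected with [W] covered by the hypothesis. *)
Lemma approximable_ge0 f : l2 mu f -> (forall x, 0 <= f x) ->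
  (forall x, ~ W x -> f x = 0) -> approximable f.
Proof.
move=> fl f0 fW; have mf := l2_measurable fl.
have mf' : measurable_fun setT (EFin \o f) by exact/measurable_EFinP.
have [s [s_nd sf]] := approximation measurableT mf' (fun x _ => f0 x).
have sfx x : s n x @[n --> \oo] --> f x.
  have := sf x Logic.I; move/fine_cvg; apply.
have s_le n x : s n x <= f x.
  rewrite -(cvg_lim _ (sfx x))//; apply: nondecreasing_cvgn_le; last by apply/cvg_ex; exists (f x); exact: sfx.
  by move=> m p mp; have /lefP := s_nd _ _ mp; apply.
apply: (@approximable_dominated (fun n x => s n x * \1_W x) f f) => //.
- move=> n.
  have [N [c [A [mA sE]]]] : exists N (c : nat -> R) (A : nat -> set T),
      (forall i, measurable (A i)) /\ forall x, s n x = \sum_(i < N) c i * \1_(A i) x.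
    pose S : seq R := finmap.enum_fset (fset_set (s n @` setT)).
    eexists _, (fun i => S`_i), (fun i => s n @^-1` [set S`_i]); split; last first.
      by move=> x; exact: (fimfunEord (s n) x).
    by move=> i; exact: measurable_sfunP.
  rewrite (_ : (fun x => _) = (fun x => \sum_(i < N) c i * \1_(A i `&` W) x)).
      apply: (@approximable_sum 'I_N _ (fun i => c i) (fun i => \1_(A i `&` W) : T -> R)).
    by move=> i; exact: approximable_indic.
  apply/funext => x; rewrite sE mulr_suml; apply: eq_bigr => i _.
  by rewrite -mulrA indicI.
- move=> x; have [Wx|nWx] := pselect (W x).
    by rewrite indicE mem_set//; under eq_fun do rewrite mulr1; exact: sfx.
  by rewrite indicE memNset//; under eq_fun do rewrite mulr0; rewrite fW//; exact: cvg_cst.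
- move=> n x; rewrite normrM !ger0_norm// indicE.
  by case: (x \in W); rewrite ?mulr1 ?mulr0// s_le.
Qed.

Lemma approximable_l2 f : l2 mu f -> (forall x, ~ W x -> f x = 0) -> approximable f.
Proof.
move=> fl fW.
have nl g : l2 mu g -> (forall x, ~ W x -> g x = 0) -> approximable (neg_part g).
  move=> gl gW; apply: approximable_ge0; first exact: l2_neg_part.
    by move=> x; rewrite /neg_part le_max lexx orbT.
  by move=> x /gW; rewrite /neg_part => ->; rewrite oppr0 maxxx.
have -> : f = (fun x => neg_part (fun x => - f x) x + -1 * neg_part f x).
  apply/funext => x; rewrite /neg_part opprK mulN1r.
  by case: (leP (f x) 0) => f0; case: (leP (- f x) 0) => f1; lra.
apply: approximableD; first by apply: nl => [|x /fW ->]; [exact: l2N|rewrite oppr0].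
by apply: approximableZ; exact: nl.
Qed.

End approximation.

Lemma in_bigsetU_ord (T : Type) (P : nat -> set T) (N : nat) (x : T) :
  (\big[setU/set0]_(k < N) P k) x <-> exists2 k, (k < N)%N & P k x.
Proof. by rewrite -bigcup_mkord; split => -[k kN Pk]; exists k. Qed.

Lemma continuous_supported_bounded (R : realType) (V : normedModType R) (f : V -> R) (K : set V) :
  compact K -> continuous f -> (forall x, ~ K x -> f x = 0) -> exists M, forall x, `|f x| <= M.
Proof.
move=> cK cf f0; have := compact_bounded (continuous_compact (continuous_subspaceT cf) cK).
move=> [M [_ /(_ (M + 1))]]; rewrite ltrDl => /(_ ltr01) KM.
exists (`|M + 1|) => x; have [Kx|/f0 ->] := pselect (K x); last by rewrite normr0.
by apply: le_trans (ler_norm _); apply: KM; exists x.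
Qed.

Section density.
Context {R : realType} {d : nat}.
Let E := 'rV[R]_d.

Definition bump_in (W : set E) (f : E -> R) : Prop :=
  bump_alg f /\ exists2 K, compact K /\ K `<=` W & forall x, ~ K x -> f x = 0.

Lemma bump_in0 W : bump_in W (fun=> 0).
Proof. by split; [exact: bump_cst|exists set0 => //; split => //; exact: compact0]. Qed.

Lemma bump_inD W f g : bump_in W f -> bump_in W g -> bump_in W (fun x => f x + g x).
Proof.
move=> [af [K [cK KW] f0]] [ag [L [cL LW] g0]]; split; first exact: bump_add.
exists (K `|` L); first by split; [exact: compactU|by rewrite subUset].
by move=> x /not_orP[/f0 -> /g0 ->]; rewrite addr0.
Qed.

Lemma bump_inZ W a f : bump_in W f -> bump_in W (fun x => a * f x).
Proof.
move=> [af [K KW f0]]; split; first by apply: bump_mul => //; exact: bump_cst.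
by exists K => // x /f0 ->; rewrite mulr0.
Qed.

Lemma bump_inS W V f : W `<=` V -> bump_in W f -> bump_in V f.
Proof. by move=> WV [af [K [cK KW] f0]]; split => //; exists K => //; split => // x /KW/WV. Qed.

Lemma closed_support_sub (f : E -> R) (K : set E) : closed K -> (forall x, ~ K x -> f x = 0) ->
  closure [set x | f x != 0] `<=` K.
Proof.
move=> cK f0; rewrite [X in _ `<=` X](closure_id K).1//; apply: closure_subset => x /= fx.
by apply: contrapT => /f0 fx0; rewrite fx0 eqxx in fx.
Qed.

Lemma bump_in_test (W : set E) f : bump_in W f -> test_function W f.
Proof.
move=> [af [K [cK KW] f0]].
have clK : closed K by apply: compact_closed cK; exact: norm_hausdorff.
have sK := closed_support_sub clK f0.
split; first exact: bump_alg_smooth.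
  by apply: subclosed_compact sK => //; exact: closed_closure.
exact: subset_trans KW.
Qed.

Lemma closed_rat_cube_compact p n : compact (closed_rat_cube p n : set E).
Proof.
have := @rV_compact R d (fun i => `[ratr (p 0 i) - n.+1%:R^-1, ratr (p 0 i) + n.+1%:R^-1]%classic).
rewrite (_ : [set v | _] = closed_rat_cube p n).
  by apply => i; exact: segment_compact.
apply/seteqP; split => x xp i; have := xp i; rewrite /= in_itv/=;
  rewrite ler_distl; by [].
Qed.

(** Only finitely many cubes occur, and the closed cubes containing them were chosen inside [V];
    their union is the compact set. *)
Lemma bump_approx_in (V : set E) n : bump_in V (bump_approx V n).
Proof.
split; first exact: bump_bump_approx.
have key m : exists2 K : set E, compact K /\ K `<=` V &
    forall x, ~ K x -> forall k, (k < m)%N -> inner_bump V k x = 0.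
  elim: m => [|m [K [cK KV] K0]]; first by exists set0 => //; split => //; exact: compact0.
  pose L : set E := if unpickle m is Some (p, q) then
    if `[< closed_rat_cube p q `<=` V >] then closed_rat_cube p q else set0 else set0.
  have [cL LV] : compact L /\ L `<=` V.
    rewrite /L; case: unpickle => [[p q]|]; last by split => //; exact: compact0.
    case: asboolP => [pV|_]; last by split => //; exact: compact0.
    by split => //; exact: closed_rat_cube_compact.
  exists (K `|` L); first by split; [exact: compactU|rewrite subUset].
  move=> x /not_orP[Kx Lx] k; rewrite ltnS leq_eqVlt => /predU1P[->|]; last exact: K0.
  move: Lx; rewrite /L /inner_bump; case: unpickle => // -[p q].
  case: ifP => // _ xp; apply: cube_bump_eq0 => xp'; apply: xp => i; exact: ltW.
have [K [cK KV] K0] := key n; exists K => // x Kx; rewrite /bump_approx big1 ?subrr// => k _.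
by rewrite K0// subr0 expr1n.
Qed.

Variable Omega : set E.
Hypotheses (open_Omega : open Omega) (bounded_Omega : bounded_set Omega).
Local Notation mu := (lebesgue_on Omega).
Local Notation T1 := (caratheodory_type (outer_restr (@lebesgue_outer R d) Omega)).

Lemma indic_l2_on (A : set T1) : measurable A -> l2 mu (\1_A : T1 -> R).
Proof.
move=> mA; apply: (@bounded_l2_on R d Omega _ _ 1) => //.
by move=> x; rewrite indicE; case: (_ \in _); rewrite ?normr1 ?normr0.
Qed.

Lemma bump_l2 W f : bump_in W f -> l2 mu (f : T1 -> R).
Proof.
move=> [af [K [cK _] f0]]; have cf := bump_alg_continuous af.
have [M fM] := continuous_supported_bounded cK cf f0.
by apply: (@bounded_l2_on R d Omega bounded_Omega _ M) => //; exact: continuous_measurable_on.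
Qed.

Variable W : set E.
Hypotheses (open_W : open W) (WOmega : W `<=` Omega).

Local Notation appr := (@approximable _ T1 R mu (bump_in W)).

Let indic_lim (F : (set T1)^nat) (A : set T1) : (forall n, appr (\1_(F n))) -> measurable A ->
  (forall x, \1_(F n) x @[n --> \oo] --> (\1_A x : R)) -> appr (\1_A).
Proof.
move=> aF mA FA.
apply: (@approximable_dominated _ T1 R mu (bump_in W) (@bump_l2 W) (fun n => \1_(F n)) _ (fun=> 1)) => //.
- exact: indic_l2_on.
- by apply: (@bounded_l2_on R d Omega bounded_Omega _ 1) => // x; rewrite normr1.
- by move=> n x; rewrite indicE; case: (_ \in _); rewrite ?normr1 ?normr0.
Qed.

Let appr_open (V : set E) : open V -> V `<=` W -> appr (\1_V : T1 -> R).
Proof.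
move=> oV VW.
apply: (@approximable_dominated _ T1 R mu (bump_in W) (@bump_l2 W) (bump_approx V) _ (fun=> 1)).
- move=> n; apply: (@approximable_refl _ T1 R mu (bump_in W) (@bump_l2 W)).
  exact: bump_inS VW (bump_approx_in V n).
- by apply: indic_l2_on; exact: open_measurable_on.
- by apply: (@bounded_l2_on R d Omega bounded_Omega _ 1) => // x; rewrite normr1.
- by move=> x; exact: bump_approx_cvg.
- by move=> n x; have /andP[b0 b1] := bump_approx01 V n x; rewrite ger0_norm.
Qed.

Definition open_box (a b : E) (m : nat) : set E :=
  [set x | forall i, a 0 i < x 0 i < b 0 i + m.+1%:R^-1].

Lemma open_open_box a b m : open (open_box a b m).
Proof.
rewrite openE => x xab; rewrite /interior -nbhs_ballE.
pose r := \big[Num.min/1]_(i < d) Num.min (x 0 i - a 0 i) (b 0 i + m.+1%:R^-1 - x 0 i).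
exists r => /=.
  rewrite /r; elim/big_ind: _ => [//|y z y0 z0|i _]; first by rewrite lt_min y0.
  by have /andP[h1 h2] := xab i; rewrite lt_min !subr_gt0 h1.
move=> y [_ xy] i; have := xy ord0 i; rewrite /ball/= => xyi.
have : r <= Num.min (x 0 i - a 0 i) (b 0 i + m.+1%:R^-1 - x 0 i) by exact: bigmin_le_cond.
rewrite le_min => /andP[r1 r2]; move: xyi; rewrite ltr_distl.
by move: (b 0 i + _) r2 => B r2 /andP[h1 h2]; apply/andP; split; lra.
Qed.

(* A box is a limit of open boxes, hence so is a finite union of boxes. *)
Let appr_boxes (a b : nat -> E) (N : nat) :
  appr (\1_((\big[setU/set0]_(k < N) box (a k) (b k)) `&` W) : T1 -> R).
Proof.
pose O m : set T1 := (\big[setU/set0]_(k < N) open_box (a k) (b k) m) `&` W.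
have oO m : open (O m : set E).
  apply: openI => //; elim/big_ind: _ => [|A B|k _]; [exact: open0|exact: openU|].
  exact: open_open_box.
have boxO k m : box (a k) (b k) `<=` open_box (a k) (b k) m.
  move=> x xab i; have /andP[-> h] := xab i; rewrite /=.
  by rewrite (le_lt_trans h)// ltrDl invr_gt0.
have bigO P x := @in_bigsetU_ord E P N x.
set B := (X in X `&` W).
(* A point at or below a lower face is outside every enlarged box, one beyond an upper face is left
   behind for large [m]; finitely many boxes admit a common [m]. *)
have OB x : W x -> ~ B x -> \forall m \near \oo, ~ O m x.
  move=> Wx Bx.
  have : \forall m \near \oo, forall k : 'I_N, ~ open_box (a k) (b k) m x.
    apply: filter_forall => k.
    have : ~ box (a k) (b k) x.
      by move=> xk; apply: Bx; apply: (bigO (fun k => box (a k) (b k)) x).2; exists k.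
    move=> /existsNP[i /negP]; rewrite negb_and -leNgt -ltNge => /orP[xa|bx].
      by apply: nearW => m /(_ i) /andP[]; rewrite ltNge xa.
    have [m0 m0P] := ltr_add_invr bx.
    exists m0 => // m /= m0m /(_ i)/andP[_]; apply/negP; rewrite -leNgt.
    apply: le_trans (ltW m0P); rewrite lerD2l lef_pV2 ?posrE// ler_nat.
    by rewrite ltnS.
  apply: filterS => m mk [Om _].
  have [k kN kx] := (bigO (fun k => open_box (a k) (b k) m) x).1 Om.
  exact: (mk (Ordinal kN)).
have mOm m : measurable (O m) by exact: open_measurable_on.
have BO : B `&` W = \bigcap_m O m.
  apply/seteqP; split => [x [Bx Wx] m _|x xO].
    have [k kN kx] := (bigO (fun k => box (a k) (b k)) x).1 Bx.
    by split => //; apply: (bigO (fun k => open_box (a k) (b k) m) x).2; exists k => //; exact: boxO.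
  have [_ Wx] := xO 0%N Logic.I; split => //; apply: contrapT => Bx.
  have [m0 _ /(_ m0 (leqnn m0))] := OB x Wx Bx.
  by apply; exact: xO.
apply: (@indic_lim O).
- by move=> m; apply: appr_open => //; exact: subIsetr.
- by rewrite [X in measurable X]BO; exact: bigcap_measurable.
move=> x; rewrite [X in _ --> X]indicE; case: (boolP (x \in _)) => [/set_mem xB|/negP xB].
  rewrite (_ : (fun n => _) = cst 1); first exact: cvg_cst.
  apply/funext => m; rewrite indicE mem_set//.
  by move: xB; rewrite [X in X x -> _]BO; exact.
apply: (cvg_near_cst 0).
have [Wx|nWx] := pselect (W x); last first.
  by apply: nearW => m; rewrite indicE memNset// => -[].
have Bx : ~ B x by move=> Bx; apply: xB; rewrite inE.
by apply: filterS (OB x Wx Bx) => m mO; rewrite indicE memNset.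
Qed.

Lemma measurable_box (a b : E) : measurable (box a b : set T1).
Proof.
rewrite (_ : box _ _ = \bigcap_(i in [set: 'I_d])
    (half_space i (b 0 i) `&` ~` half_space i (a 0 i))); last first.
  apply/seteqP; split => [x xab i _|x xab i].
    by have /andP[h1 h2] := xab i; split => //; rewrite /half_space/=; apply/negP; rewrite -ltNge.
  by have [//|h1 /negP] := xab i; rewrite -ltNge => ->.
apply: fin_bigcap_measurable => // i _.
apply: caratheodory_measurable_setI; first exact: half_space_lebesgue_on.
by apply: caratheodory_measurable_setC; exact: half_space_lebesgue_on.
Qed.

(** A second, separate limit: enlarging infinitely many boxes at once need not shrink back to their
    union, so the number of boxes grows only after each finite union has been approximated. *)
Let appr_countable_boxes (a b : nat -> E) :
  appr (\1_((\bigcup_k box (a k) (b k)) `&` W) : T1 -> R).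
Proof.
pose F N : set T1 := (\big[setU/set0]_(k < N) box (a k) (b k)) `&` W.
pose box_k k := box (a k) (b k).
have FE : (\bigcup_k box (a k) (b k)) `&` W = \bigcup_N F N.
  apply/seteqP; split => [x [[k _ kx] Wx]|x [N _ [Fx Wx]]].
    by exists k.+1 => //; split => //; apply: (@in_bigsetU_ord E box_k _ x).2; exists k.
  have [k _ kx] := (@in_bigsetU_ord E box_k _ x).1 Fx.
  by split => //; exists k.
have mbox k := measurable_box (a k) (b k).
have mF N : measurable (F N).
  apply: measurableI; last exact: open_measurable_on.
  by apply: bigsetU_measurable => k _.
apply: (@indic_lim F).
- by move=> N; exact: appr_boxes.
- by rewrite [X in measurable X]FE; exact: bigcup_measurable.
move=> x; rewrite [X in _ --> X]indicE [in X in _ --> X]FE.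
case: (boolP (x \in _)) => [/set_mem[N _ xN]|/negP xB].
  apply: (cvg_near_cst (true%:R : R)); exists N => // m /= Nm.
  rewrite indicE mem_set//; move: xN => [Fx Wx]; split => //.
  have [k kN kx] := (@in_bigsetU_ord E box_k _ x).1 Fx.
  by apply: (@in_bigsetU_ord E box_k _ x).2; exists k => //; exact: leq_trans Nm.
apply: (cvg_near_cst 0); apply: nearW => N; rewrite indicE memNset// => xN.
by apply: xB; rewrite inE; exists N.
Qed.

(** By definition of the outer measure, [A] within [W] is covered by boxes with excess volume at
    most [(e / 2) ^+ 2]; the indicator of an excess of that measure has L_2 norm at most [e / 2]. *)
Lemma bump_in_dense_indic (d_gt0 : (0 < d)%N) (A : set T1) : measurable A -> appr (\1_(A `&` W) : T1 -> R).
Proof.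
move=> mA; have mW : measurable (W : set T1) by exact: open_measurable_on.
have mAW : measurable (A `&` W) by exact: measurableI.
split; first exact: indic_l2_on.
move=> e e0; have e2 : 0 < e / 2 by rewrite divr_gt0.
have e22 : 0 < (e / 2) ^+ 2 by rewrite exprn_gt0.
have AWfin : lebesgue_outer (A `&` W) \is a fin_num.
  rewrite ge0_fin_numE ?outer_measure_ge0//.
  apply: le_lt_trans (lebesgue_outer_bounded bounded_Omega).
  by apply: le_outer_measure => x [_ /WOmega].
have [F AF Fsum] := cover_ext_approx e22 AWfin.
have Fbox k : exists ab : E * E, F k = box ab.1 ab.2.
  have [->|/set0P[x Fx]] := eqVneq (F k) set0.
    (* The degenerate box is empty because there is at least one coordinate; in dimension 0 it would
       be the whole space. *)
    exists (0, 0); apply/esym/seteqP; split => // x /(_ (Ordinal d_gt0)).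
    by rewrite /= mxE => /andP[/lt_le_trans h /h]; rewrite ltxx.
  (* A set that is neither empty nor a box has infinite volume, which a cover of finite total
     excludes. *)
  have Fk : (box_volume (F k) < +oo)%E.
    rewrite ltNge leye_eq; apply/eqP => Fk; move: Fsum.
    rewrite (@nneseries_pinfty _ _ xpredT k)//; last by move=> *; exact: box_volume_ge0.
    by rewrite ltNge leey.
  have [_ [[F0 _]|[a [b [_ Fab _]]]] _] := ereal_inf_lt Fk.
    by rewrite F0 in Fx.
  by exists (a, b).
have {Fbox}/choice[ab Fab] := Fbox.
have FE : \bigcup_k F k = \bigcup_k box (ab k).1 (ab k).2.
  by apply: eq_bigcup => // k _; exact: Fab.
pose B : set T1 := \bigcup_k F k.
have [BWl /(_ _ e2)[g Pg gB]] : appr (\1_(B `&` W) : T1 -> R).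
  by rewrite /B FE; exact: (@appr_countable_boxes (fun k => (ab k).1) (fun k => (ab k).2)).
have AWl := indic_l2_on mAW.
exists g => //; apply: le_trans (nrm_triangle AWl (bump_l2 Pg) BWl) _.
rewrite [leRHS]splitr lerD//.
pose D : set T1 := (B `&` W) `&` ~` A.
have mB : measurable B.
  rewrite /B FE; apply: bigcup_measurable => k _.
  by rewrite -[X in measurable X](_ : F k = _)//; rewrite Fab; exact: measurable_box.
have mD : measurable D by apply: measurableI; [exact: measurableI|exact: measurableC].
have AB : A `&` W `<=` B by exact: AF.
have muD : (mu D <= ((e / 2) ^+ 2)%:E)%E.
  have restrE (X : set E) : X `<=` W -> outer_restr (@lebesgue_outer R d) Omega X = lebesgue_outer X.
    by move=> XW; rewrite /outer_restr; congr lebesgue_outer; apply/setIidPl => x /XW/WOmega.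
  (* Measurability of [A] splits the union of boxes within [W] into [A] within [W] and the excess
     [D]; the finite first term is then cancelled. *)
  have : (lebesgue_outer (A `&` W) + mu D <= lebesgue_outer (A `&` W) + ((e / 2) ^+ 2)%:E)%E.
    apply: (@le_trans _ _ (lebesgue_outer (B `&` W))); last first.
      apply/ltW/(le_lt_trans _ Fsum); apply: (le_trans (le_outer_measure _ _ B _)).
        exact: subIsetl.
      by apply: cover_ext_le => //; exact: box_volume0.
    rewrite -(restrE (B `&` W)); last by move=> x [].
    have BWA : outer_restr (@lebesgue_outer R d) Omega (B `&` W `&` A) = lebesgue_outer (A `&` W).
      rewrite restrE; last by move=> x [[]].
      congr lebesgue_outer; apply/seteqP; split => x; first by move=> [[_ ?]].
      by move=> [Ax Wx]; split => //; split => //; exact: AB.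
    by rewrite (mA (B `&` W)) -BWA.
  by rewrite leeD2lE.
have muDfin : mu D \is a fin_num by rewrite ge0_fin_numE ?measure_ge0// (le_lt_trans muD)// ltry.
rewrite -ler_sqr ?nnegrE ?nrm_ge0 ?(ltW e2)// sqr_nrm.
rewrite /dot (_ : \int[mu]_x _ = fine (mu D)).
  by rewrite -lee_fin fineK.
rewrite -(setIT D) -(integral_indic mu measurableT mD) /Rintegral; congr fine.
apply: eq_integral => x _; congr EFin; rewrite !indicE.
have [Ax|nAx] := pselect (A x); have [Wx|nWx] := pselect (W x).
- rewrite (mem_set (_ : (A `&` W) x))// (mem_set (_ : (B `&` W) x))//; last by split => //; exact: AB.
  by rewrite memNset ?subrr ?mulr0// => -[].
- rewrite (memNset (_ : ~ (A `&` W) x)); last by case.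
  rewrite (memNset (_ : ~ (B `&` W) x)); last by case.
  by rewrite memNset ?subrr ?mulr0// => -[].
- rewrite (memNset (_ : ~ (A `&` W) x)); last by case.
  have [Bx|nBx] := pselect (B x).
    rewrite (mem_set (_ : (B `&` W) x))// (mem_set (_ : D x))//.
    by rewrite sub0r mulrNN mulr1.
  rewrite (memNset (_ : ~ (B `&` W) x)); last by case.
  by rewrite memNset ?subrr ?mulr0// => -[[]].
- rewrite (memNset (_ : ~ (A `&` W) x)); last by case.
  rewrite (memNset (_ : ~ (B `&` W) x)); last by case.
  by rewrite memNset ?subrr ?mulr0// => -[[]].
Qed.

Theorem bump_in_dense (d_gt0 : (0 < d)%N) (f : T1 -> R) : l2 mu f ->
  (forall x, ~ W x -> f x = 0) ->
  forall e, 0 < e -> exists2 g, bump_in W g & nrm mu (fun x => f x - g x) <= e.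
Proof.
move=> fl fW.
have [] := @approximable_l2 _ T1 R mu (bump_in W) (bump_in0 W) (@bump_l2 W)
  (@bump_inD W) (@bump_inZ W) W (@bump_in_dense_indic d_gt0) f fl fW.
by [].
Qed.

End density.

(** * Difference quotients and the chain rule *)

(** Near a point off [C] the product vanishes identically. This makes global integrands out of a [u]
    that is controlled on [U] alone. *)
Lemma continuous_mul_supported (R : realType) (V : normedModType R) (u f : V -> R) (C U : set V) :
  closed C -> C `<=` U -> continuous f -> (forall x, ~ C x -> f x = 0) ->
  (forall x, U x -> {for x, continuous u}) -> continuous (fun x => u x * f x).
Proof.
move=> cC CU cf f0 cu x; have [Cx|nCx] := pselect (C x).
  by apply: cvgM; [apply: cu; exact: CU|exact: cf].
rewrite /continuous_at f0// mulr0; apply: (cvg_near_cst (0 : R)).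
have : nbhs x (~` C) by apply: open_nbhs_nbhs; split => //; exact: closed_openC.
by apply: filterS => y /f0 ->; rewrite mulr0.
Qed.

Lemma compact_room (R : realType) (V : normedModType R) (K U : set V) : compact K -> open U ->
  K `<=` U -> exists2 r, 0 < r & forall y x, K y -> `|y - x| < r -> U x.
Proof.
move=> /compact_near_coveringP cK oU KU.
have : \forall r \near 0^'+, K `<=` [set y | forall x, `|y - x| < r -> U x].
  apply: cK => y Ky; have : nbhs y U by apply: open_nbhs_nbhs; split => //; exact: KU.
  rewrite -nbhs_ballE => -[r /= r0 rU].
  exists (ball y (r / 2), [set t | t < r / 2]).
    split; first by apply: nbhsx_ballx; rewrite divr_gt0.
    by apply: nbhs_right_lt; rewrite divr_gt0.
  move=> [z t] [/= zy tr] x zx; apply: rU; rewrite -ball_normE /ball_/=.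
  apply: le_lt_trans (ler_distD z _ _) _; rewrite [ltRHS]splitr ltrD//.
    by move: zy; rewrite -ball_normE.
  exact: lt_trans tr.
move=> H; have [r [r0 rK]] : exists r : R, 0 < r /\ K `<=` [set y | forall x, `|y - x| < r -> U x].
  by have [r [/= ? ?]] := @filter_ex _ (0 : R)^'+ _ _ (filterI (nbhs_right_gt 0) H); exists r.
by exists r => // y x Ky; exact: rK.
Qed.

Section test_functions.
Context {R : realType} {d : nat}.
Let E := 'rV[R]_d.
Variable i : 'I_d.
Let e : E := delta_mx 0 i.

Lemma derive_translate (f : E -> R) (a v x : E) : 'D_v (fun x => f (x + a)) x = 'D_v f (x + a).
Proof.
rewrite /derive (_ : (fun h => _) = fun h => h^-1 *: ((f \o shift (x + a)) (h *: v) - f (x + a)))//.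
by apply/funext => h /=; rewrite addrA.
Qed.

Lemma derivable_translate (f : E -> R) (a v x : E) : derivable f (x + a) v ->
  derivable (fun x => f (x + a)) x v.
Proof.
rewrite /derivable [X in _ -> cvg (X @ _)](_ : _ =
  fun h => h^-1 *: ((f \o shift (x + a)) (h *: v) - f (x + a)))//.
by apply/funext => h /=; rewrite addrA.
Qed.

Lemma smooth_translate (f : E -> R) (a : E) : smooth f -> smooth (fun x => f (x + a)).
Proof.
move=> sf s; have -> : foldr partial (fun x => f (x + a)) s = fun x => foldr partial f s (x + a).
  elim: s => //= j s ->; apply/funext => x; exact: derive_translate.
have [cf df] := sf s; split; last by move=> j x; apply: derivable_translate.
by move=> x; apply: (continuous_comp (@continuous_translate R d a x)); exact: cf.
Qed.

Lemma smooth_partial (f : E -> R) : smooth f -> smooth (partial i f).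
Proof. by move=> sf s; have := sf (rcons s i); rewrite foldr_rcons. Qed.

Lemma smooth_continuous (f : E -> R) : smooth f -> continuous f.
Proof. by move=> /(_ [::])[]. Qed.

Lemma partial_eq0 (f : E -> R) x : ~ closure [set x | f x != 0] x -> partial i f x = 0.
Proof.
move=> fx; rewrite /partial -[RHS](derive_cst (0 : R) x e); apply: near_eq_derive.
have : nbhs x (~` closure [set x | f x != 0]).
  by apply: open_nbhs_nbhs; split => //; apply: closed_openC; exact: closed_closure.
apply: filterS => y fy; apply/eqP/negPn/negP => fy0; apply: fy; exact: subset_closure.
Qed.

Lemma supp_eq0 (f : E -> R) x : ~ closure [set x | f x != 0] x -> f x = 0.
Proof. by move=> fx; apply/eqP/negPn/negP => fx0; apply: fx; exact: subset_closure. Qed.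

Lemma test_function_eq0 (U : set E) f x : test_function U f -> ~ U x -> f x = 0.
Proof. by move=> [_ _ fU] Ux; apply: supp_eq0 => /fU. Qed.

Lemma test_partial (U : set E) f : test_function U f -> test_function U (partial i f).
Proof.
move=> [sf cf fU]; have sub := closed_support_sub (@closed_closure _ _) (@partial_eq0 f).
split; [exact: smooth_partial| |exact: subset_trans fU].
by apply: subclosed_compact sub => //; exact: closed_closure.
Qed.

Lemma test_bounded (U : set E) f : test_function U f -> exists M, forall x, `|f x| <= M.
Proof.
move=> [/smooth_continuous cf cK _]; apply: continuous_supported_bounded cK cf _.
exact: supp_eq0.
Qed.

Definition room (U : set E) (s : R) : set E := [set x | U (x + s *: e)].

Lemma test_translate (U : set E) f s : test_function U f ->
  closure [set x | f x != 0] `<=` room U s -> test_function U (fun x => f (x - s *: e)).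
Proof.
move=> [sf cf fU] fs.
pose K := closure [set x | f x != 0].
have cK : compact ((fun x => x + s *: e) @` K).
  apply: continuous_compact => //; apply: continuous_subspaceT.
  exact: continuous_translate.
have clK : closed ((fun x => x + s *: e) @` K) by apply: compact_closed cK; exact: norm_hausdorff.
have sub : closure [set x | f (x - s *: e) != 0] `<=` (fun x => x + s *: e) @` K.
  apply: (closed_support_sub clK) => x xK; apply: supp_eq0 => /= fx.
  by apply: xK; exists (x - s *: e) => //; rewrite subrK.
split; first exact: smooth_translate.
  by apply: subclosed_compact sub => //; exact: closed_closure.
by move=> _ /sub[y /fs ? <-].
Qed.

Lemma is_derive_shift (f : E -> R) (x : E) (s : R) : smooth f ->
  is_derive s 1 (fun t : R => f (x - t *: e)) (- partial i f (x - s *: e)).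
Proof.
move=> /(_ [::])[_ /= df].
have h : is_derive (- s) 1 (fun h : R => f (h *: e + x)) (partial i f (- s *: e + x)).
  by apply/is_derive_line; apply: DeriveDef => //; exact: df.
have := @is_derive1_comp R (fun h : R => f (h *: e + x)) (fun t => - t) s _ (-1) h _.
rewrite mulrN1 scaleNr addrC (_ : _ \o _ = fun t : R => f (x - t *: e)); first exact.
by apply/funext => t /=; rewrite scaleNr addrC.
Qed.

End test_functions.

Lemma is_derive_cvg_seq (R : realType) (Q : R -> R) (q : R) (h : R^nat) : is_derive (0 : R) 1 Q q ->
  (forall n, h n != 0) -> h n @[n --> \oo] --> (0 : R) ->
  (Q (h n) - Q 0) / h n @[n --> \oo] --> q.
Proof.
move=> dQ hn0 hc; have [dQ0 dE] := dQ.
move: dQ0; rewrite /derivable => /cvg_ex[l lQ].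
have lq : l = q by rewrite -dE; apply/esym/cvg_lim.
move: lQ; rewrite lq => /cvgr_dnbhsP/(_ h (conj hn0 hc)).
apply: cvg_trans; apply: near_eq_cvg; apply: nearW => n /=.
by rewrite addr0 mulrC /GRing.scale /= mulr1.
Qed.

Section approximation_of_norms.
Context d (T : measurableType d) (R : realType).
Variable mu : {measure set T -> \bar R}.

Lemma nrm_le_of_approx (f : T -> R) (c : R) : l2 mu f -> 0 <= c ->
  (forall e, 0 < e -> exists2 g, l2 mu g & nrm mu (fun x => f x - g x) <= e /\
    `|dot mu f g| <= c * nrm mu g) -> nrm mu f <= c.
Proof.
move=> fl c0 H; apply: nrm_le_of_dot => //; apply/ler_addgt0Pr => e e0.
pose b := nrm mu f + c + 1.
have b0 : 0 < b by rewrite ltr_wpDl// addr_ge0// nrm_ge0.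
have [g gl [fg fgc]] := H (e / b) (divr_gt0 e0 b0).
have -> : dot mu f f = dot mu f (fun x => f x - g x) + dot mu f g.
  by rewrite dotBr// subrK.
have h1 := le_trans (ler_norm _) (dot_le_nrm fl (l2B fl gl)).
have h2 := le_trans (ler_norm _) fgc.
have h3 : nrm mu g <= nrm mu f + e / b.
  have := nrm_dist gl fl; rewrite nrm_distC => /(le_trans (ler_norm _)) h; lra.
have h4 : nrm mu f * nrm mu (fun x => f x - g x) <= nrm mu f * (e / b).
  by rewrite ler_wpM2l// nrm_ge0.
have h5 : c * nrm mu g <= c * nrm mu f + c * (e / b) by rewrite -mulrDr ler_wpM2l.
have h6 : (nrm mu f + c + 1) * (e / b) = e by rewrite mulrCA mulfV ?gt_eqF ?mulr1.
have h7 : 0 <= e / b by rewrite divr_ge0 ?ltW.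
by move: h1 h2 h4 h5 h6 h7; move: (e / b) => eb; nra.
Qed.

Lemma weak_cvg_of_approx (V : (T -> R)^nat) (g f : T -> R) (c : R) : (forall n, l2 mu (V n)) ->
  l2 mu g -> l2 mu f -> (forall n, nrm mu (V n) <= c) -> nrm mu g <= c ->
  (forall e, 0 < e -> exists2 f', l2 mu f' & nrm mu (fun x => f x - f' x) <= e /\
    dot mu (V n) f' @[n --> \oo] --> dot mu g f') ->
  dot mu (V n) f @[n --> \oo] --> dot mu g f.
Proof.
move=> Vl gl fl Vc gc H; apply/cvgrPdist_le => e e0.
have c0 : 0 <= c := le_trans (nrm_ge0 _ _) gc.
pose b := 2 * c + 1; have b0 : 0 < b by rewrite ltr_wpDl// mulr_ge0.
have [f' fl' [ff /cvgrPdist_le Vf]] := H (e / 2 / b) (divr_gt0 (divr_gt0 e0 (ltr0n _ 2)) b0).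
have bnd v : l2 mu v -> nrm mu v <= c -> `|dot mu v f - dot mu v f'| <= c * (e / 2 / b).
  move=> vl vc; rewrite -dotBr//; apply: le_trans (dot_le_nrm vl (l2B fl fl')) _.
  by rewrite ler_pM ?nrm_ge0.
have e2 : 0 < e / 2 by rewrite divr_gt0.
apply: filterS (Vf _ e2) => n Vn.
have h1 := bnd _ gl gc; have h2 := bnd _ (Vl n) (Vc n).
have h3 : 2 * (c * (e / 2 / b)) <= e / 2.
  rewrite mulrA mulrCA ler_piMr ?(ltW e2)// ler_pdivrMr// mul1r /b; lra.
rewrite (_ : dot mu g f - dot mu (V n) f = (dot mu g f - dot mu g f') +
  (dot mu g f' - dot mu (V n) f') - (dot mu (V n) f - dot mu (V n) f')); last by ring.
apply: le_trans (ler_normB _ _) _; apply: le_trans (lerD (ler_normD _ _) (lexx _)) _.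
lra.
Qed.

Lemma l2_abs (f : T -> R) : l2 mu f -> l2 mu (fun x => `|f x|).
Proof.
move=> fl; have mf := l2_measurable fl.
apply: l2_le fl; last by move=> x; rewrite normr_id.
exact: measurableT_comp.
Qed.

Lemma Rintegral_le_nrm (F f g : T -> R) : l2 mu f -> l2 mu g ->
  mu.-integrable setT (EFin \o F) -> (forall x, `|F x| <= `|f x| * `|g x|) ->
  `|\int[mu]_x F x| <= nrm mu f * nrm mu g.
Proof.
move=> fl gl iF FM; have fa := l2_abs fl; have ga := l2_abs gl.
apply: le_trans (le_normr_Rintegral measurableT iF) _.
apply: (@le_trans _ _ (dot mu (fun x => `|f x|) (fun x => `|g x|))).
  by apply: le_Rintegral => //; [exact: (integrable_norm iF)|exact: integrableM].
by apply: le_trans (ler_norm _) _; apply: le_trans (dot_le_nrm fa ga) _; rewrite !nrm_abs.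
Qed.

End approximation_of_norms.

Section difference_quotients.
Context {R : realType} {d : nat}.
Let E := 'rV[R]_d.
Variable i : 'I_d.
Let e : E := delta_mx 0 i.
Variable Omega : set E.
Hypotheses (open_Omega : open Omega) (bounded_Omega : bounded_set Omega).
Local Notation mu := (lebesgue_on Omega).
Local Notation T1 := (caratheodory_type (outer_restr (@lebesgue_outer R d) Omega)).
Local Notation supp f := (closure [set x | f x != 0]).

Lemma test_measurable (f : E -> R) : test_function Omega f -> measurable_fun setT (f : T1 -> R).
Proof. by move=> [/smooth_continuous cf _ _]; exact: continuous_measurable_on. Qed.

Lemma test_l2 (f : E -> R) : test_function Omega f -> l2 mu (f : T1 -> R).
Proof.
move=> tf; have [M fM] := test_bounded tf.
by apply: bounded_l2_on fM => //; exact: test_measurable.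
Qed.

Lemma shift_measurable (f : E -> R) (s : R) : continuous f ->
  measurable_fun setT (fun x : T1 => f ((x : E) - s *: e)).
Proof.
move=> cf; apply: continuous_measurable_on => x.
by apply: (continuous_comp (@continuous_translate R d (- (s *: e)) x)); exact: cf.
Qed.

(** Differentiation under the integral, with the constant [M * M1] as dominating function. The shift
    sits on the smooth factor, so [u] need only be bounded and measurable. *)
Lemma is_derive_int_shift (u : T1 -> R) (M s : R) (f : E -> R) :
  measurable_fun setT u -> (forall x, `|u x| <= M) -> test_function Omega f ->
  is_derive s 1 (fun t : R => \int[mu]_x (u x * f ((x : E) - t *: e)))
    (- \int[mu]_x (u x * partial i f ((x : E) - s *: e))).
Proof.
move=> mu_ uM tf; have [M0 fM0] := test_bounded tf.
have tdf := test_partial i tf; have [M1 fM1] := test_bounded tdf.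
have [sf _ _] := tf; have cdf := smooth_continuous (smooth_partial i sf).
have M_ge0 : 0 <= M by apply: le_trans (normr_ge0 _) (uM (0 : E)).
have M1_ge0 : 0 <= M1 by apply: le_trans (normr_ge0 _) (fM1 0).
pose F t (x : T1) := u x * f ((x : E) - t *: e).
have dF (t : R) (x : T1) : is_derive t 1 (F^~ x) (u x * - partial i f ((x : E) - t *: e)).
  have h := is_derive_shift i (x : E) t sf.
  exact: (@is_deriveZ R R R _ (u x) t 1 _ h).
have d1F (t : R) (x : T1) : partial1of2 F t x = u x * - partial i f ((x : E) - t *: e).
  by rewrite partial1of2E; have h := dF t x; rewrite derive_val.
have sI : `]s - 1, s + 1[%classic s by rewrite /= in_itv/=; apply/andP; split; lra.
have iF (t : R) : `]s - 1, s + 1[%classic t -> mu.-integrable setT (EFin \o F t).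
  move=> _; have mF := measurable_funM mu_ (shift_measurable t (smooth_continuous sf)).
  apply: (@bounded_integrable_on R d Omega bounded_Omega _ (M * M0) mF) => x.
  by rewrite /F normrM ler_pM.
have derF (t : R) (x : T1) : `]s - 1, s + 1[%classic t -> setT x -> derivable (F^~ x) t 1.
  by move=> _ _; have h := dF t x; exact: ex_derive.
have G0 (x : T1) : 0 <= M * M1 by exact: mulr_ge0.
have iG : mu.-integrable setT (EFin \o (fun _ : T1 => M * M1)).
  apply: (@bounded_integrable_on R d Omega bounded_Omega _ (M * M1)) => // x.
  by rewrite ger0_norm// mulr_ge0.
have Gub (t : R) (x : T1) : `]s - 1, s + 1[%classic t -> setT x -> `|partial1of2 F t x| <= M * M1.
  by move=> _ _; rewrite d1F normrM normrN ler_pM.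
apply: DeriveDef; first exact: (derivable_under_integral measurableT sI iF derF G0 iG Gub).
rewrite -derive1E (differentiation_under_integral measurableT sI iF derF G0 iG Gub).
rewrite -[RHS]mulN1r -RintegralZl//; last first.
  have mF := measurable_funM mu_ (shift_measurable s cdf).
  apply: (@bounded_integrable_on R d Omega bounded_Omega _ (M * M1) mF) => x.
  by rewrite normrM ler_pM.
by apply: eq_Rintegral => x _; rewrite d1F mulrN mulN1r.
Qed.

Lemma nrm_shift (f : E -> R) (s : R) : test_function Omega f -> supp f `<=` room i Omega s ->
  nrm mu (fun x : T1 => f ((x : E) - s *: e)) = nrm mu (f : T1 -> R).
Proof.
move=> tf fs; congr Num.sqrt; rewrite /dot.
have [M fM] := test_bounded tf; have [/smooth_continuous cf _ _] := tf.
have cfs : continuous (fun x : E => f (x - s *: e)).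
  by move=> x; apply: (continuous_comp (@continuous_translate R d (- (s *: e)) x)); exact: cf.
rewrite (@Rintegral_translate R d Omega open_Omega bounded_Omega (s *: e)
   (fun x : E => f (x - s *: e) * f (x - s *: e)) (M * M)).
- by apply: eq_Rintegral => x _; rewrite addrK.
- by move=> x; exact: (cvgM (cfs x) (cfs x)).
- by move=> x; rewrite normrM ler_pM.
move=> x; rewrite mulf_eq0 orbb => fx; have xf : supp f (x - s *: e) by exact: subset_closure.
split; first by have := fs _ xf; rewrite /room/= subrK.
by have [_ _] := tf; exact.
Qed.

Section bounded_function.
Variables (u : T1 -> R) (M : R).
Hypotheses (mu_ : measurable_fun setT u) (uM : forall x, `|u x| <= M).
Hypothesis cu : forall x, Omega x -> {for x, continuous (u : E -> R)}.

Let M_ge0 : 0 <= M. Proof. by apply: le_trans (normr_ge0 _) (uM (0 : E)). Qed.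

(** Discrete integration by parts: translation moves the shift from [f] to [u]. The shift by
    [0 *: e] keeps the left side in the form of an increment of one function of the shift. *)
Lemma int_difference_quotient (f : E -> R) (h : R) : 0 < h -> test_function Omega f ->
  supp f `<=` room i Omega h ->
  \int[mu]_x (u x * f ((x : E) - h *: e)) - \int[mu]_x (u x * f ((x : E) - 0 *: e)) =
  h * \int[mu]_x ((u ((x : E) + h *: e) - u x) / h * f x).
Proof.
move=> h0 tf fh; have [M0 fM0] := test_bounded tf.
have [/smooth_continuous cf _ fO] := tf.
have tfh := test_translate tf fh.
have [/smooth_continuous cfh _ fhO] := tfh.
pose w (x : E) := u x * f (x - h *: e).
have cw : continuous w.
  by apply: (continuous_mul_supported _ fhO) => //; [exact: closed_closure|exact: supp_eq0].
have wM x : `|w x| <= M * M0 by rewrite normrM ler_pM.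
have cv : continuous (fun x : E => u (x + h *: e) * f x).
  rewrite (_ : (fun x => _) = w \o (fun x : E => x + h *: e)).
    by move=> x; apply: (continuous_comp (@continuous_translate R d (h *: e) x)); exact: cw.
  by apply/funext => x; rewrite /w/= addrK.
rewrite (@Rintegral_translate R d Omega open_Omega bounded_Omega (h *: e) w (M * M0)) //; last first.
  move=> x; rewrite mulf_eq0 negb_or => /andP[_ fx].
  have xf : supp f (x - h *: e) by exact: subset_closure.
  by split; [have := fh _ xf; rewrite /room/= subrK|exact: fO].
have iu : mu.-integrable setT (EFin \o (fun x => u x * f x)).
  have mF := measurable_funM mu_ (test_measurable tf).
  apply: (@bounded_integrable_on R d Omega bounded_Omega _ (M * M0) mF) => x.
  by rewrite normrM ler_pM.
have iv : mu.-integrable setT (EFin \o (fun x : T1 => u ((x : E) + h *: e) * f x)).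
  apply: (@bounded_integrable_on R d Omega bounded_Omega _ (M * M0)).
    exact: continuous_measurable_on.
  by move=> x; rewrite normrM ler_pM.
under eq_Rintegral do rewrite /w addrK.
under [X in _ - X]eq_Rintegral do rewrite scale0r subr0.
rewrite -RintegralB// -RintegralZl//; last first.
  apply: (integrable_eq (integrableZl measurableT h^-1 (integrableB measurableT iv iu))).
  by move=> x /=; rewrite -EFinB -EFinM; congr EFin; rewrite mulrBl [h^-1 * _]mulrC mulrBl; ring.
by apply: eq_Rintegral => x _; rewrite mulrA mulrCA mulfV ?gt_eqF// mulr1 mulrBl.
Qed.

(** No weak derivative of [u] is assumed, so this also applies to the composite G(u), whose weak
    derivative is still to be found. *)
Lemma cvg_difference_quotient (f : E -> R) (h : R^nat) : (forall n, 0 < h n) ->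
  h n @[n --> \oo] --> (0 : R) -> test_function Omega f ->
  (forall n, supp f `<=` room i Omega (h n)) ->
  \int[mu]_x ((u ((x : E) + h n *: e) - u x) / h n * f x) @[n --> \oo] -->
    - \int[mu]_x (u x * partial i f x).
Proof.
move=> h0 hc tf fr.
have dQ := @is_derive_int_shift u M 0 f mu_ uM tf.
have := is_derive_cvg_seq dQ (fun n => lt0r_neq0 (h0 n)) hc.
rewrite (_ : \int[mu]_x (u x * partial i f ((x : E) - 0 *: e)) =
  \int[mu]_x (u x * partial i f x)); last by apply: eq_Rintegral => x _; rewrite scale0r subr0.
apply: cvg_trans; apply: near_eq_cvg; apply: nearW => n.
by rewrite int_difference_quotient// mulrAC mulfV ?gt_eqF// mul1r.
Qed.

(* [\int u(x) f(x - s e) dx] has derivative [\int g(x) f(x - s e) dx]. *)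
Lemma difference_quotient_dist (g : T1 -> R) (f : E -> R) (h w C : R) :
  weak_partial Omega i u g -> 0 < h -> test_function Omega f ->
  (forall s : R, 0 <= s <= h -> supp f `<=` room i Omega s) ->
  (forall s : R, 0 <= s <= h -> `|\int[mu]_x (g x * f ((x : E) - s *: e)) - w| <= C) ->
  `|\int[mu]_x ((u ((x : E) + h *: e) - u x) / h * f x) - w| <= C.
Proof.
move=> wug h0 tf fr gC.
pose Q t := \int[mu]_x (u x * f ((x : E) - t *: e)).
have dQ (s : R) : 0 <= s <= h -> is_derive s 1 Q (\int[mu]_x (g x * f ((x : E) - s *: e))).
  move=> sh; have tfs := test_translate tf (fr _ sh).
  have -> : \int[mu]_x (g x * f ((x : E) - s *: e)) =
      - \int[mu]_x (u x * partial i f ((x : E) - s *: e)).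
    have wE := wug _ tfs; have pE : partial i (fun x : E => f (x - s *: delta_mx 0 i)) =
      (fun x : E => partial i f (x - s *: delta_mx 0 i)).
      by apply/funext => x; exact: derive_translate.
    by rewrite pE in wE; apply: oppr_inj; rewrite opprK; exact: esym wE.
  exact: (@is_derive_int_shift u M s f mu_ uM tf).
have := primitive_dist (ltW h0) dQ gC.
have fh : supp f `<=` room i Omega h by apply: fr; rewrite lexx (ltW h0).
rewrite /Q subr0 int_difference_quotient//.
by rewrite -mulrBr normrM gtr0_norm// mulrC ler_pM2r.
Qed.

End bounded_function.

Lemma compact_neighbourhood (K : set E) : compact K -> K `<=` Omega ->
  exists (W : set E) (r : R), [/\ open W, K `<=` W, 0 < r &
    forall s : R, 0 <= s <= r -> W `<=` room i Omega s].
Proof.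
move=> cK KO; have [r0 r0_gt0 rO] := compact_room cK open_Omega KO.
pose W : set E := \bigcup_(y in K) ball y (r0 / 2); pose r := r0 / 2 / (`|e| + 1).
have e1 : 0 < `|e| + 1 by rewrite ltr_wpDl.
have r_gt0 : 0 < r by rewrite !divr_gt0.
exists W, r; split => //.
- by apply: bigcup_open => y _; apply: ball_open; rewrite divr_gt0.
- by move=> x Kx; exists x => //; apply: ballxx; rewrite divr_gt0.
move=> s /andP[s0 sr] x [y Ky]; rewrite -ball_normE /ball_/= => yx; apply: (rO y) => //.
rewrite opprD addrA; apply: le_lt_trans (ler_normB _ _) _.
rewrite [ltRHS]splitr ltr_leD// normrZ (ger0_norm s0).
apply: le_trans (_ : r * (`|e| + 1) <= _); last by rewrite /r divfK// gt_eqF.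
by rewrite ler_pM// lerDl.
Qed.

(** Cut off to [W], where the shifted point stays in [Omega]; elsewhere [u] takes arbitrary
    values. *)
Definition dquot (u : T1 -> R) (W : set E) (h : R) : T1 -> R :=
  (fun x : T1 => (u ((x : E) + h *: e) - u x) / h) \_ W.

Lemma dquot_in (u : T1 -> R) (W : set E) (h : R) (x : T1) : W x ->
  dquot u W h x = (u ((x : E) + h *: e) - u x) / h.
Proof. by move=> Wx; rewrite /dquot patchE mem_set. Qed.

Lemma dquot_out (u : T1 -> R) (W : set E) (h : R) (x : T1) : ~ W x -> dquot u W h x = 0.
Proof. by move=> Wx; rewrite /dquot patchE memNset. Qed.

Lemma dot_dquot (u : T1 -> R) (W : set E) (h : R) (f : T1 -> R) : (forall x, ~ W x -> f x = 0) ->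
  dot mu (dquot u W h) f = \int[mu]_x ((u ((x : E) + h *: e) - u x) / h * f x).
Proof.
move=> fW; apply: eq_Rintegral => x _; have [Wx|Wx] := pselect (W x); first by rewrite dquot_in.
by rewrite fW// !mulr0.
Qed.

Lemma dquot_l2 (u : T1 -> R) (M : R) (W : set E) (h : R) : measurable_fun setT u ->
  (forall x, `|u x| <= M) -> (forall x, Omega x -> {for x, continuous (u : E -> R)}) ->
  open W -> 0 < h -> W `<=` room i Omega h -> l2 mu (dquot u W h).
Proof.
move=> mu_ uM cu oW h0 WO; have mW := @open_measurable_on R d Omega W oW.
have M_ge0 : 0 <= M by apply: le_trans (normr_ge0 _) (uM (0 : E)).
apply: (@bounded_l2_on R d Omega bounded_Omega _ (2 * M / h)).
  apply: (measurable_restrictT _ mW).1.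
  have mv : measurable_fun (W : set T1) (fun x : T1 => u ((x : E) + h *: e)).
    apply: (@continuous_within_measurable R d _ (@half_space_lebesgue_on R d Omega) W
      (fun x : E => u (x + h *: e))) => //.
    apply: continuous_in_subspaceT => x /set_mem Wx.
    by apply: (continuous_comp (@continuous_translate R d (h *: e) x)); apply: cu; exact: WO.
  exact: (measurable_funM (measurable_funB mv (measurable_funTS mu_)) (measurable_cst h^-1)).
move=> x; have [Wx|Wx] := pselect (W x); last first.
  by rewrite dquot_out// normr0 divr_ge0 ?(ltW h0)// mulr_ge0.
rewrite dquot_in// normrM normfV (gtr0_norm h0) ler_pM2r ?invr_gt0// mulr_natl mulr2n.
by apply: le_trans (ler_normB _ _) _; rewrite lerD.
Qed.

Section chain_rule.
Variables (u g : T1 -> R) (M : R).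
Hypotheses (mu_ : measurable_fun setT u) (uM : forall x, `|u x| <= M).
Hypothesis cu : forall x, Omega x -> {for x, continuous (u : E -> R)}.
Hypotheses (gl : l2 mu g) (wug : weak_partial Omega i u g).
Hypothesis d_gt0 : (0 < d)%N.

Let M_ge0 : 0 <= M. Proof. by apply: le_trans (normr_ge0 _) (uM (0 : E)). Qed.

Section interior.
Variables (W : set E) (r : R).
Hypotheses (open_W : open W) (WOmega : W `<=` Omega).
Hypothesis W_room : forall s : R, 0 <= s <= r -> W `<=` room i Omega s.

Let V_l2 h : 0 < h <= r -> l2 mu (dquot u W h).
Proof.
by move=> /andP[h0 hr]; apply: (dquot_l2 mu_ uM) => //; apply: W_room; rewrite hr ltW.
Qed.

Let W_supp (f : E -> R) (s : R) : test_function W f -> 0 <= s <= r -> supp f `<=` room i Omega s.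
Proof. by move=> [_ _ fW] sr x /fW; exact: W_room. Qed.

Let test_W (f : E -> R) : test_function W f -> test_function Omega f.
Proof. by move=> [? ? fW]; split => //; exact: subset_trans fW WOmega. Qed.

(** By duality with smooth functions supported in [W]: the pairing with [f] averages, over [s] in
    [0, h], the pairings of [g] with translates of [f], all of the same norm as [f]. *)
Lemma nrm_difference_quotient h : 0 < h <= r -> nrm mu (dquot u W h) <= nrm mu g.
Proof.
move=> hr; have /andP[h0 h1] := hr; apply: nrm_le_of_approx; [exact: V_l2|exact: nrm_ge0|].
move=> t t0; have VW x : ~ W x -> dquot u W h x = 0.
  exact: dquot_out.
have [f bf Vf] := @bump_in_dense R d Omega bounded_Omega W open_W WOmega d_gt0
  (dquot u W h) (V_l2 hr) VW t t0.
have tf := bump_in_test bf; have tOf := test_W tf.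
exists f; [exact: test_l2|split => //].
rewrite dot_dquot; last by move=> x; exact: test_function_eq0.
rewrite -[X in `|X|]subr0; apply: (@difference_quotient_dist u M mu_ uM cu g f h) => //.
  by move=> s /andP[s0 sh]; apply: W_supp => //; rewrite s0 (le_trans sh).
move=> s /andP[s0 sh]; rewrite subr0.
have sf : supp f `<=` room i Omega s by apply: W_supp => //; rewrite s0 (le_trans sh).
have := dot_le_nrm gl (test_l2 (test_translate tOf sf)).
by rewrite (nrm_shift tOf sf).
Qed.

(** The quotients being bounded in L_2, smooth [f] suffice. For these, translates by at most h
    differ from [f] by O(h) in L_2, and so do the pairings from their limit. *)
Lemma cvg_dot_difference_quotient (f : T1 -> R) (h : R^nat) : (forall n, 0 < h n <= r) ->
  h n @[n --> \oo] --> (0 : R) -> l2 mu f -> (forall x, ~ W x -> f x = 0) ->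
  dot mu (dquot u W (h n)) f @[n --> \oo] --> dot mu g f.
Proof.
move=> hr hc fl fW; apply: (@weak_cvg_of_approx _ T1 R mu _ g f (nrm mu g)
  (fun n => V_l2 (hr n)) gl fl (fun n => nrm_difference_quotient (hr n)) (lexx _)) => t t0.
 have [f' bf ff'] := @bump_in_dense R d Omega bounded_Omega W open_W WOmega
  d_gt0 f fl fW t t0.
have tf := bump_in_test bf; have tOf := test_W tf.
exists f'; [exact: test_l2|split => //].
have one_l2 : l2 mu (fun=> 1).
  by apply: (@bounded_l2_on R d Omega bounded_Omega _ 1) => // x; rewrite normr1.
have [N fN] := test_bounded (test_partial i tOf).
have fL (s : R) (x : E) : 0 <= s -> `|f' (x - s *: e) - f' x| <= N * s.
  move=> s0; have [sf _ _] := tOf.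
  have := @primitive_dist R (fun t : R => f' (x - t *: e)) _ 0 s 0 N s0
    (fun t _ => is_derive_shift i x t sf).
  by rewrite scale0r mulr0 !subr0; apply => t1 _; rewrite subr0 normrN.
have N0 : 0 <= N by apply: le_trans (normr_ge0 _) (fN 0).
pose C := nrm mu g * (N * nrm mu (fun=> 1)).
have key n : `|dot mu (dquot u W (h n)) f' - dot mu g f'| <= C * h n.
  have /andP[h0 h1] := hr n.
  rewrite dot_dquot; last by move=> x; exact: test_function_eq0.
  apply: (@difference_quotient_dist u M mu_ uM cu g f' (h n)) => //.
    by move=> s /andP[s0 sh]; apply: W_supp => //; rewrite s0 (le_trans sh).
  move=> s /andP[s0 sh].
  have sf : supp f' `<=` room i Omega s by apply: W_supp => //; rewrite s0 (le_trans sh).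
  have lf := test_l2 (test_translate tOf sf).
  rewrite -[X in `|X - _|]/(dot mu g (fun x : T1 => f' ((x : E) - s *: e))).
  rewrite -(dotBr lf (test_l2 tOf) gl).
  apply: le_trans (dot_le_nrm gl (l2B lf (test_l2 tOf))) _.
  rewrite /C -mulrA ler_wpM2l ?nrm_ge0// mulrAC -[leRHS]ger0_norm; last first.
    by rewrite !mulr_ge0 ?nrm_ge0 ?(ltW h0).
  rewrite normrM [X in _ * X]ger0_norm ?nrm_ge0// -nrmZ//.
  apply: nrm_le => [||x]; [exact: l2B lf (test_l2 tOf)|exact: l2Z|].
  rewrite mulr1 [leRHS]ger0_norm; last by rewrite mulr_ge0 ?(ltW h0).
  by apply: le_trans (fL s x s0) _; rewrite ler_wpM2l.
have Ch0 : C * h n @[n --> \oo] --> (0 : R) by rewrite -[X in _ --> X](mulr0 C); exact: cvgMr.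
apply/cvgrPdist_le => t' t'0; move/cvgrPdist_le : Ch0 => /(_ _ t'0).
apply: filterS => n; rewrite sub0r normrN => Cn; rewrite distrC.
by apply: le_trans (key n) _; apply: le_trans (ler_norm _) Cn.
Qed.

End interior.

(** The quotients of G(u), paired with [f], have two limits: one by discrete integration by parts,
    the other by comparing them with [G'(u)] times the quotients of [u]. Uniqueness of limits is the
    chain rule. *)
Theorem weak_partial_comp (G G' : R -> R) (C : R) : continuous G -> continuous G' ->
  (forall t, `|G t| <= `|t|) -> (forall t, `|G' t| <= 1) ->
  (forall a b, `|G b - G a - G' a * (b - a)| <= C * (b - a) ^+ 2) ->
  weak_partial Omega i (fun x => G (u x)) (fun x => G' (u x) * g x).
Proof.
move=> cG cG' Gle G'1 G2 f tf; have [sf cK KO] := tf; have cf := smooth_continuous sf.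
have C0 : 0 <= C by have := le_trans (normr_ge0 _) (G2 0 1); rewrite subr0 expr1n mulr1.
have [N fN] := test_bounded tf.
have [W [r [oW KW r_gt0 W_room]]] := compact_neighbourhood cK KO.
have WO : W `<=` Omega.
  by move=> x /(@W_room 0); rewrite lexx (ltW r_gt0) /room/= scale0r addr0; exact.
have fW x : ~ W x -> f x = 0 by move=> Wx; apply: supp_eq0 => /KW.
have tfW : test_function W f by [].
pose h n := r / n.+1%:R.
have hr n : 0 < h n <= r.
  by rewrite divr_gt0//= ler_pdivrMr// ler_peMr ?(ltW r_gt0)// ler1n.
have h0 n : 0 < h n by have /andP[] := hr n.
have hc : h n @[n --> \oo] --> (0 : R).
  rewrite -[X in _ --> X](mulr0 r); apply: cvgMr; exact: cvg_harmonic.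
have hO n : W `<=` room i Omega (h n) by apply: W_room; have /andP[/ltW -> ->] := hr n.
pose Gu x := G (u x).
have mGu : measurable_fun setT Gu by apply: measurableT_comp => //; exact: continuous_measurable_fun.
have mG'u : measurable_fun setT (fun x => G' (u x)).
  by apply: measurableT_comp => //; exact: continuous_measurable_fun.
have GuM x : `|Gu x| <= M by exact: le_trans (Gle _) (uM x).
have cGu x : Omega x -> {for x, continuous (Gu : E -> R)}.
  by move=> Ox; apply: (continuous_comp (cu Ox)); exact: cG.
have fl : l2 mu (f : T1 -> R) by exact: test_l2.
(* With [G'(u)] moved to the test side, weakly convergent quotients are paired with a fixed element
   of L_2. *)
pose th (x : T1) := G' (u x) * f x.
have thl : l2 mu th by apply: (l2M _ mG'u fl); exact: (fun x => G'1 (u x)).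
have thW x : ~ W x -> th x = 0 by move=> Wx; rewrite /th fW// mulr0.
have L1 : dot mu (dquot Gu W (h n)) f @[n --> \oo] --> - \int[mu]_x (Gu x * partial i f x).
  under eq_fun do rewrite (dot_dquot _ _ fW).
  by apply: (cvg_difference_quotient mGu GuM cGu h0 hc tf) => n; exact: subset_trans KW (hO n).
have L2 := cvg_dot_difference_quotient oW WO W_room hr hc thl thW.
have Vl n : l2 mu (dquot u W (h n)) by exact: (dquot_l2 mu_ uM).
have VGl n : l2 mu (dquot Gu W (h n)) by exact: (dquot_l2 mGu GuM).
(* On [W], the increment of [u] times [f]. In the quadratic remainder one increment, over [h n], is
   bounded in norm by that of [g]; this one tends to 0 in L_2 by dominated convergence. *)
pose P n (x : T1) := h n * dquot u W (h n) x * f x.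
have mP n : measurable_fun setT (P n).
  exact: (measurable_funM (measurable_funM (measurable_cst (h n)) (l2_measurable (Vl n)))
    (test_measurable tf)).
have P2 n x : `|P n x| <= 2 * M * `|f x|.
  rewrite normrM ler_wpM2r//; have [Wx|Wx] := pselect (W x); last first.
    by rewrite dquot_out// mulr0 normr0 mulr_ge0.
  rewrite dquot_in// mulrC divfK ?gt_eqF// mulr_natl mulr2n.
  by apply: le_trans (ler_normB _ _) _; rewrite lerD.
have Pl n : l2 mu (P n).
  apply: (l2_le (mP n) _ (l2Z (2 * M) fl)) => x.
  by apply: le_trans (P2 n x) _; rewrite normrM ger0_norm// mulr_ge0.
have P3 n x : `|P n x| <= 2 * M * N by apply: le_trans (P2 n x) _; rewrite ler_wpM2l// mulr_ge0.
have N0 : 0 <= N by apply: le_trans (normr_ge0 _) (fN 0).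
have Nl : l2 mu (fun=> 2 * M * N).
  by apply: (@bounded_l2_on R d Omega bounded_Omega _ (2 * M * N)) => // x; rewrite ger0_norm ?mulr_ge0.
have Pc (x : T1) : P n x @[n --> \oo] --> (0 : R).
  have [Wx|Wx] := pselect (W x); last first.
    by apply: (cvg_near_cst (0 : R)); apply: nearW => n; rewrite /P fW// mulr0.
  rewrite -[X in _ --> X](mul0r (f x)); apply: cvgMl.
  have -> : (fun n => h n * dquot u W (h n) x) = fun n => u ((x : E) + h n *: e) - u x.
    by apply/funext => n; rewrite dquot_in// mulrC divfK// gt_eqF.
  rewrite -[X in _ --> X](subrr (u x)); apply: cvgB; last exact: cvg_cst.
  have hx : (x : E) + h n *: e @[n --> \oo] --> (x : E).
    rewrite -[X in _ --> X](addr0 (x : E)); apply: cvgD; first exact: cvg_cst.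
    by rewrite -[X in _ --> X](scale0r e); apply: cvgZl.
  by have := cu (WO x Wx); apply: (@cvg_comp _ _ _ (fun n => (x : E) + h n *: e) (u : E -> R)).
have P0 := @nrm_dominated _ T1 R mu P (fun=> 0) (fun=> 2 * M * N) mP (l20 mu) Nl Pc P3.
have key n : `|dot mu (dquot Gu W (h n)) f - dot mu (dquot u W (h n)) th| <=
    C * nrm mu g * nrm mu (P n).
  have VCl := l2Z C (Vl n).
  have i1 := integrableM (VGl n) fl; have i2 := integrableM (Vl n) thl.
  rewrite /dot -(RintegralB measurableT i1 i2).
  apply: le_trans (Rintegral_le_nrm VCl (Pl n) (integrableB measurableT i1 i2) _) _; last first.
    rewrite (nrmZ _ (Vl n)) (ger0_norm C0) ler_wpM2r ?nrm_ge0//.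
    by rewrite ler_wpM2l// (nrm_difference_quotient oW WO W_room (hr n)).
  move=> x; rewrite /P /th; have [Wx|Wx] := pselect (W x); last first.
    by rewrite !dquot_out// !(mul0r, mulr0) subrr normr0.
  rewrite !dquot_in//; set a := u x; set b := u _.
  rewrite [h n * _]mulrC divfK ?gt_eqF// -normrM.
  rewrite (_ : _ / _ * _ - _ = (G b - G a - G' a * (b - a)) * ((h n)^-1 * f x)); last first.
    by rewrite /Gu; ring.
  rewrite (_ : C * _ * _ = C * (b - a) ^+ 2 * ((h n)^-1 * f x)); last by ring.
  by rewrite normrM [leRHS]normrM (ger0_norm (mulr_ge0 C0 (sqr_ge0 (b - a)))) ler_wpM2r.
have Cg0 : C * nrm mu g * nrm mu (P n) @[n --> \oo] --> (0 : R).
  rewrite -[X in _ --> X](mulr0 (C * nrm mu g)); apply: cvgMr.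
  rewrite (_ : (fun n => nrm mu (P n)) = fun n => nrm mu (fun x => P n x - 0))//.
  by apply/funext => n; congr (nrm mu _); apply/funext => x; rewrite subr0.
have L3 : dot mu (dquot Gu W (h n)) f @[n --> \oo] --> dot mu g th.
  rewrite -[X in _ --> X]add0r.
  rewrite (_ : (fun n => _) = fun n => (dot mu (dquot Gu W (h n)) f -
    dot mu (dquot u W (h n)) th) + dot mu (dquot u W (h n)) th); last first.
    by apply/funext => n; rewrite subrK.
  apply: cvgD => //; apply/norm_cvg0P.
  by apply: (squeeze_cvgr _ (cvg_cst 0) Cg0); apply: nearW => n; rewrite normr_ge0/=.
have LE := cvg_unique (@norm_hausdorff _ _) L1 L3.
have -> : \int[mu]_x (G' (u x) * g x * f x) = dot mu g th.
  by apply: eq_Rintegral => x _; rewrite /th mulrCA mulrA.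
by rewrite -LE opprK.
Qed.

End chain_rule.

End difference_quotients.

(** * The Dirichlet-to-Neumann operator *)

Lemma lipschitz_continuous (R : realType) (f : R -> R) : (forall a b, `|f b - f a| <= `|b - a|) ->
  continuous f.
Proof.
move=> fL x; apply/cvgrPdist_le => e e0; near=> y.
rewrite distrC; apply: le_trans (fL x y) _; rewrite distrC; near: y.
by apply: (@cvgrPdist_le _ _ _ _ (nbhs_filter x) id x).1.
Unshelve. all: by end_near. Qed.

(** * A continuously differentiable approximation of minus the negative part *)

Section smooth_neg_part.
Context {R : realType}.
Variable e : R.
Hypothesis e0 : 0 < e.
Let m (t : R) := Num.max (- t) 0.

(* [soft_neg] is [- m^2 / (m + e)] and [soft_neg'] its derivative. *)
Definition soft_neg (t : R) : R := e - m t - e ^+ 2 / (m t + e).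
Definition soft_neg' (t : R) : R := 1 - (e / (m t + e)) ^+ 2.

Let m_ge0 t : 0 <= m t. Proof. by rewrite le_max lexx orbT. Qed.
Let me_gt0 t : 0 < m t + e. Proof. by rewrite ltr_wpDl. Qed.
Let me_neq0 t : m t + e != 0. Proof. by rewrite gt_eqF. Qed.
Let r01 t : 0 <= e / (m t + e) <= 1.
Proof. by rewrite divr_ge0 ?(ltW e0) ?(ltW (me_gt0 t))//= ler_pdivrMr// mul1r lerDr. Qed.

Lemma soft_neg'_ge0 t : 0 <= soft_neg' t.
Proof. by have /andP[h0 h1] := r01 t; rewrite /soft_neg' subr_ge0 expr_le1. Qed.

Lemma soft_neg'_le1 t : `|soft_neg' t| <= 1.
Proof. by rewrite ger0_norm ?soft_neg'_ge0// /soft_neg' gerBl sqr_ge0. Qed.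

Lemma soft_neg_dist t : `|soft_neg t + m t| <= e.
Proof.
rewrite /soft_neg addrAC subrK expr2 -mulrA -[X in X - _]mulr1 -mulrBr.
have /andP[h0 h1] := r01 t; rewrite ger0_norm ?mulr_ge0 ?(ltW e0) ?subr_ge0//.
by rewrite ler_piMr ?(ltW e0)// gerBl.
Qed.

Lemma soft_neg_le t : `|soft_neg t| <= `|t|.
Proof.
have -> : soft_neg t = - (m t * (1 - e / (m t + e))) by rewrite /soft_neg; field.
have /andP[h0 h1] := r01 t.
rewrite normrN ger0_norm ?mulr_ge0 ?subr_ge0//; apply: (@le_trans _ _ (m t)).
  by rewrite ler_piMr// gerBl.
by rewrite /m ge_max normr_ge0 andbT -normrN ler_norm.
Qed.

Lemma soft_neg_lipschitz a b : `|soft_neg b - soft_neg a| <= `|b - a|.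
Proof.
have -> : soft_neg b - soft_neg a = (m a - m b) * (1 - e / (m a + e) * (e / (m b + e))).
  by rewrite /soft_neg; field; rewrite !me_neq0.
have /andP[a0 a1] := r01 a; have /andP[b0 b1] := r01 b.
rewrite normrM distrC; apply: le_trans (ler_dist_neg_part b a).
rewrite ler_piMr// ger0_norm; last by rewrite subr_ge0 mulr_ile1.
by rewrite gerBl mulr_ge0.
Qed.

Lemma continuous_soft_neg : continuous soft_neg.
Proof. exact: lipschitz_continuous soft_neg_lipschitz. Qed.

Lemma continuous_soft_neg' : continuous soft_neg'.
Proof.
have cm : continuous m.
  by apply: lipschitz_continuous => a b; exact: ler_dist_neg_part.
move=> t; apply: cvgB; first exact: cvg_cst.
have h : e / (m s + e) @[s --> t] --> e / (m t + e).
  apply: cvgMr; apply: cvgV => //; apply: cvgD; [exact: cm|exact: cvg_cst].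
by rewrite expr2; under eq_fun do rewrite expr2; exact: cvgM.
Qed.

(** The error splits into the Taylor remainder in the variable [m], at most [(b - a) ^+ 2 / e], and
    a term from the kink of [m]. The latter survives only for [a < 0 <= b], where
    [soft_neg' a <= 2 * (m a / e)] makes it at most twice that; hence the 3. *)
Lemma soft_neg_taylor a b :
  `|soft_neg b - soft_neg a - soft_neg' a * (b - a)| <= (3 / e) * (b - a) ^+ 2.
Proof.
have -> : soft_neg b - soft_neg a - soft_neg' a * (b - a) =
   - ((e / (m a + e)) ^+ 2 * (m b - m a) ^+ 2 / (m b + e))
   - soft_neg' a * ((b - a) + (m b - m a)).
  by rewrite /soft_neg /soft_neg'; field; rewrite !me_neq0.
have /andP[a0 a1] := r01 a; have /andP[b0 b1] := r01 b.
have h1 : `|(e / (m a + e)) ^+ 2 * (m b - m a) ^+ 2 / (m b + e)| <= (b - a) ^+ 2 / e.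
  have p0 : 0 <= (e / (m a + e)) ^+ 2 * (m b - m a) ^+ 2.
    by apply: mulr_ge0; exact: sqr_ge0.
  have mb0 := ltW (me_gt0 b).
  rewrite ger0_norm ?(divr_ge0 p0)//; apply: ler_pM; rewrite ?invr_ge0//; last first.
    by rewrite lef_pV2 ?posrE// lerDr.
  apply: (@le_trans _ _ ((m b - m a) ^+ 2)); first by rewrite ler_piMl ?sqr_ge0// expr_le1.
  by rewrite -[leLHS]real_normK ?num_real// -[leRHS]real_normK ?num_real// ler_sqr ?nnegrE//
    ler_dist_neg_part.
have h2 : `|soft_neg' a * ((b - a) + (m b - m a))| <= 2 * ((b - a) ^+ 2 / e).
  have s0 := soft_neg'_ge0 a.
  have sE : soft_neg' a <= 2 * (m a / e).
    have -> : soft_neg' a = (1 + e / (m a + e)) * (m a / (m a + e)).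
      by rewrite /soft_neg'; field.
    rewrite ler_pM// ?addr_ge0// ?divr_ge0 ?(ltW (me_gt0 a))//; first by lra.
    by rewrite ler_wpM2l// lef_pV2 ?posrE// lerDr.
  have [ap|an] := leP 0 a.
    have ma : m a = 0 by rewrite /m; apply/max_idPr; rewrite oppr_le0.
    have -> : soft_neg' a = 0 by rewrite /soft_neg' ma add0r divff ?gt_eqF// expr1n subrr.
    by rewrite mul0r normr0 mulr_ge0// divr_ge0 ?sqr_ge0 ?(ltW e0).
  have ma : m a = - a by rewrite /m; apply/max_idPl; rewrite oppr_ge0 ltW.
  have [bp|bn] := leP 0 b; last first.
    have mb : m b = - b by rewrite /m; apply/max_idPl; rewrite oppr_ge0 ltW.
    have -> : b - a + (m b - m a) = 0 by rewrite ma mb; ring.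
    by rewrite mulr0 normr0 mulr_ge0// divr_ge0 ?sqr_ge0 ?(ltW e0).
  have mb : m b = 0 by rewrite /m; apply/max_idPr; rewrite oppr_le0.
  have -> : b - a + (m b - m a) = b by rewrite ma mb; ring.
  rewrite ger0_norm ?mulr_ge0//; apply: le_trans (ler_wpM2r bp sE) _.
  rewrite -mulrA ler_pM2l// mulrAC ler_pM2r ?invr_gt0// ma; nra.
apply: le_trans (ler_normB _ _) _; rewrite normrN.
rewrite (_ : 3 / e * _ = (b - a) ^+ 2 / e + 2 * ((b - a) ^+ 2 / e)); last by ring.
exact: lerD.
Qed.

End smooth_neg_part.

Lemma Lnorm_fin_num_l2 d (T : measurableType d) (R : realType) (mu : {measure set T -> \bar R})
    (f : T -> R) : measurable_fun setT f -> 'N[mu]_2%:E[EFin \o f]%E \is a fin_num ->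
  l2 mu f /\ nrm mu f = fine 'N[mu]_2%:E[EFin \o f]%E.
Proof.
move=> mf ffin; have fL : f \in Lfun mu 2%:E.
  rewrite inE; apply/andP; split; rewrite inE //=.
  by rewrite /finite_norm ltey_eq ffin.
split; first exact/l2_Lfun.
exact: esym (L2norm_nrm (Lfun_Sub (lee1n 2) fL)).
Qed.

Section outer_restr_null.
Context {R : realType} {T : pointedType}.
Variables (mu : {outer_measure set T -> \bar R}) (D : set T).

Lemma outer_restr_null (A : set T) : A `&` D = set0 -> (outer_restr mu D).-caratheodory A.
Proof.
move=> AD X; rewrite /outer_restr -setIA AD setI0 outer_measure0 add0e; congr (mu _).
rewrite -setIA; apply/seteqP; split => x [Xx]; last by move=> [_ Dx].
by move=> Dx; split=> //; split => // Ax; rewrite -[False]/((set0 : set T) x) -AD.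
Qed.

Lemma outer_restr_ae (P : T -> Prop) : (forall x, D x -> P x) ->
  {ae cara_measure (outer_restr mu D), forall x, P x}.
Proof.
move=> DP; exists (~` D); split.
- by apply: outer_restr_null; rewrite setICl.
- by rewrite /cara_measure /= /outer_restr setICl outer_measure0.
by move=> x /= nPx Dx; apply: nPx; exact: DP.
Qed.

End outer_restr_null.

Lemma Rintegral_sum d (T : measurableType d) (R : realType) (mu : {measure set T -> \bar R})
    (I : Type) (s : seq I) (F : I -> T -> R) :
  (forall i, mu.-integrable setT (EFin \o F i)) ->
  mu.-integrable setT (EFin \o (fun x => \sum_(i <- s) F i x)) /\
  \int[mu]_x (\sum_(i <- s) F i x) = \sum_(i <- s) \int[mu]_x F i x.
Proof.
move=> iF; elim: s => [|i s [iS IH]].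
  rewrite big_nil; split; first by apply: (integrable_eq (integrable0 _ _)) => x /=; rewrite big_nil.
  by under eq_Rintegral do rewrite big_nil; rewrite /Rintegral integral0.
split.
  apply: (integrable_eq (integrableD measurableT (iF i) iS)) => x /=.
  by rewrite big_cons EFinD.
under eq_Rintegral do rewrite big_cons.
by rewrite RintegralD// IH big_cons.
Qed.

Lemma continuous_open_eq (R : realType) (V : topologicalType) (u v : V -> R) (A : set V) :
  open A -> {within A, continuous u} -> (forall x, A x -> v x = u x) ->
  forall x, A x -> {for x, continuous v}.
Proof.
move=> oA; rewrite continuous_open_subspace// => cu vu x Ax.
rewrite /prop_for /continuous_at vu//; apply: cvg_trans (cu x (mem_set Ax)); apply: near_eq_cvg.
have nA : nbhs x A by exact: open_nbhs_nbhs.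
by apply: filterS nA => y Ay; rewrite vu.
Qed.

Lemma within_continuous_comp (R : realType) (V : topologicalType) (A : set V) (u : V -> R) (G : R -> R) :
  {within A, continuous u} -> continuous G -> {within A, continuous (fun x => G (u x))}.
Proof.
by move=> cu cG x; apply: (@continuous_comp (subspace A) _ _ (u : subspace A -> R) G);
  [exact: cu|exact: cG].
Qed.

Section dirichlet_to_neumann.
Context {R : realType} {d : nat}.
Let E := 'rV[R]_d.
Variable Omega : set E.
Hypotheses (open_Omega : open Omega) (bounded_Omega : bounded_set Omega) (d_gt0 : (0 < d)%N).
Local Notation mu := (lebesgue_on Omega).
Local Notation T1 := (caratheodory_type (outer_restr (@lebesgue_outer R d) Omega)).
Local Notation Ts := (caratheodory_type (outer_restr (@hausdorff_outer R d d.-1) (boundary Omega))).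

(** The fundamental lemma of the calculus of variations, from density of test functions. It is
    needed because the Laplacian inside [has_normal_derivative] is any [f] satisfying the weak
    identity, not literally 0. *)
Lemma test_orthogonal (f v : T1 -> R) : l2 mu f -> l2 mu v ->
  (forall phi, test_function Omega phi -> \int[mu]_x (f x * phi x) = 0) ->
  \int[mu]_x (f x * v x) = 0.
Proof.
(* The density theorem asks for functions vanishing off [Omega]; the measure does not see the
   change. *)
move=> fl vl f0; pose w (x : T1) := (\1_Omega x : R) * v x.
have mO : measurable_fun setT (\1_Omega : T1 -> R).
  by apply: measurable_indic; exact: open_measurable_on.
have wl : l2 mu w.
  apply: (@l2M _ T1 R mu 1 v _ _ mO vl) => x.
  by rewrite indicE; case: (_ \in _); rewrite ?normr1 ?normr0.
have -> : \int[mu]_x (f x * v x) = dot mu w f.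
  rewrite -[LHS]/(dot mu f v) dotC; apply: eq_ae_dot => //; apply: outer_restr_ae => x Ox _.
  by rewrite /w indicE mem_set// mul1r.
apply/eqP; rewrite -normr_le0; apply/ler_addgt0Pl => e e0; rewrite addr0.
have f1 : 0 < nrm mu f + 1 by rewrite ltr_wpDl// nrm_ge0.
have wO x : ~ Omega x -> w x = 0 by move=> Ox; rewrite /w indicE memNset// mul0r.
have [g bg wg] := @bump_in_dense R d Omega bounded_Omega Omega open_Omega (@subset_refl _ Omega) d_gt0
  w wl wO _ (divr_gt0 e0 f1).
have tg := bump_in_test bg; have gl := test_l2 bounded_Omega tg.
have -> : dot mu w f = dot mu (fun x => w x - g x) f.
  by rewrite dotBl// [X in _ - X]dotC [X in _ - X](f0 _ tg) subr0.
apply: le_trans (dot_le_nrm (l2B wl gl) fl) _.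
apply: le_trans (ler_wpM2r (nrm_ge0 _ _) wg) _.
by rewrite mulrAC ler_pdivrMr// ler_wpM2l ?(ltW e0)// lerDl.
Qed.

Lemma bounded_up_to_boundary (u : E -> R) : {within closure Omega, continuous u} ->
  exists M, forall x, closure Omega x -> `|u x| <= M.
Proof.
move=> cu; have cO : compact (closure Omega).
  apply: bounded_closed_compact; last exact: closed_closure.
  have [M [_ /(_ (M + 1))]] := bounded_Omega; rewrite ltrDl => /(_ ltr01) OM.
  exists (M + 1); split; first exact: num_real.
  have cB : closed [set y : E | `|y| <= M + 1].
    apply: (closed_comp (f := fun y : E => `|y|)) (@closed_le _ (M + 1)).
    by move=> y _; exact: norm_continuous.
  have sub : closure Omega `<=` [set y : E | `|y| <= M + 1].
    by rewrite [X in _ `<=` X]((closure_id _).1 cB); exact: closure_subset.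
  by move=> c Mc x /sub h; exact: le_trans h (ltW Mc).
have := compact_bounded (continuous_compact cu cO).
move=> [M [_ /(_ (M + 1))]]; rewrite ltrDl => /(_ ltr01) KM.
by exists (M + 1) => x Ox; apply: KM; exists x.
Qed.

(** Off the closure of [Omega] nothing is known of [u], but there every set misses the boundary and
    is therefore measurable for the restricted outer measure. *)
Lemma sigma_measurable (u : E -> R) : {within closure Omega, continuous u} ->
  measurable_fun setT (u : Ts -> R).
Proof.
move=> cu; pose C : set Ts := closure Omega.
have mC : measurable C.
  by apply: closed_caratheodory => [i c|]; [
    apply: caratheodory_outer_restr; exact: half_space_hausdorff|exact: closed_closure].
have mu1 : measurable_fun C (u : Ts -> R).
  apply: (@continuous_within_measurable R d _ _ (closure Omega)) => // i c.
  by apply: caratheodory_outer_restr; exact: half_space_hausdorff.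
move=> _ B mB; rewrite setTI (_ : u @^-1` B = (C `&` u @^-1` B) `|` (~` C `&` u @^-1` B)).
  apply: measurableU; first exact: mu1.
  apply: outer_restr_null; apply/seteqP; split => // x [[nCx _] [Cx _]]; exact: nCx.
by rewrite -setIUl setUv setTI.
Qed.

Lemma comp_H1 (u : H1 Omega) (e : R) : 0 < e -> continuous_up_to_boundary u ->
  exists v : H1 Omega, [/\ continuous_up_to_boundary v,
    forall x, v x = soft_neg e (u x) &
    forall i x, H1_grad v i x = soft_neg' e (u x) * H1_grad u i x].
Proof.
move=> e0 cu; have [M uM] := bounded_up_to_boundary cu.
have ul : l2 mu u := L2_l2 u; have mu_ := l2_measurable ul.
have mGu : measurable_fun setT (fun x : T1 => soft_neg e (u x)).
  by apply: measurableT_comp => //; apply: continuous_measurable_fun; exact: continuous_soft_neg.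
have mG'u : measurable_fun setT (fun x : T1 => soft_neg' e (u x)).
  by apply: measurableT_comp => //; apply: continuous_measurable_fun; exact: continuous_soft_neg'.
have vl : l2 mu (fun x => soft_neg e (u x)) by apply: (l2_le mGu _ ul) => x; exact: soft_neg_le.
have gl i : l2 mu (fun x => soft_neg' e (u x) * H1_grad u i x).
  by apply: (l2M _ mG'u (L2_l2 (H1_grad u i))) => x; exact: soft_neg'_le1.
(* The representative [u] is arbitrary outside the closure of [Omega], whereas the chain rule wants
   a global bound; test functions do not distinguish [U] from [u]. *)
pose U (x : T1) : R := \1_Omega x * u x.
have mO : measurable (Omega : set T1) by exact: open_measurable_on.
have mU : measurable_fun setT U by apply: measurable_funM => //; exact: measurable_indic.
have UE x : Omega x -> U x = u x by move=> Ox; rewrite /U indicE mem_set// mul1r.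
have UM x : `|U x| <= Num.max M 0.
  rewrite le_max; have [Ox|Ox] := pselect (Omega x).
    by rewrite UE// uM//; exact: subset_closure.
  by rewrite /U indicE memNset// mul0r normr0 lexx orbT.
have cU x : Omega x -> {for x, continuous (U : E -> R)}.
  apply: (@continuous_open_eq R E u U Omega) => //.
  by apply: continuous_subspaceW cu; exact: subset_closure.
have wU i : weak_partial Omega i U (H1_grad u i).
  move=> phi tphi; rewrite -(H1_gradP u i tphi); apply: eq_Rintegral => x _.
  have [Ox|Ox] := pselect (Omega x); first by rewrite UE.
  by rewrite (test_function_eq0 (test_partial i tphi) Ox) !mulr0.
have wv i : weak_partial Omega i (fun x => soft_neg e (u x))
    (fun x => soft_neg' e (u x) * H1_grad u i x).
  have w := weak_partial_comp open_Omega bounded_Omega mU UM cU (L2_l2 (H1_grad u i)) (wU i) d_gt0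
    (@continuous_soft_neg R e e0) (@continuous_soft_neg' R e e0) (@soft_neg_le R e e0)
    (@soft_neg'_le1 R e e0) (@soft_neg_taylor R e e0).
  move=> phi tphi; have := w phi tphi.
  rewrite (_ : \int[mu]_x (soft_neg e (U x) * partial i phi x) =
    \int[mu]_x (soft_neg e (u x) * partial i phi x)); last first.
    apply: eq_Rintegral => x _; have [Ox|Ox] := pselect (Omega x); first by rewrite UE.
    by rewrite (test_function_eq0 (test_partial i tphi) Ox) !mulr0.
  move=> ->; congr (- _); apply: eq_Rintegral => x _.
  have [Ox|Ox] := pselect (Omega x); first by rewrite UE.
  by rewrite (test_function_eq0 tphi Ox) !mulr0.
pose vL : L2 mu := Lfun_Sub (lee1n 2) ((l2_Lfun _ _).2 vl).
pose gL i : L2 mu := Lfun_Sub (lee1n 2) ((l2_Lfun _ _).2 (gl i)).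
exists (@Build_H1 R d Omega vL gL wv); split => //.
exact: (within_continuous_comp cu (@continuous_soft_neg R e e0)).
Qed.

Lemma nrm_grad_le_H1_dist (u v : H1 Omega) i :
  nrm mu (fun x => H1_grad u i x - H1_grad v i x) <= H1_dist u v.
Proof.
pose D j (x : T1) := H1_grad u j x - H1_grad v j x.
have Dl j : l2 mu (D j) by apply: l2B; exact: L2_l2.
have iD j : mu.-integrable setT (EFin \o (fun x => D j x ^+ 2)) by have [] := Dl j.
have uv : l2 mu (fun x => u x - v x) by apply: l2B; exact: L2_l2.
have [_ sE] := Rintegral_sum (index_enum 'I_d) iD.
rewrite /H1_dist sE /nrm; apply: ler_wsqrtr.
have sq f : dot mu f f = \int[mu]_x (f x ^+ 2) by apply: eq_Rintegral => x _; rewrite expr2.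
rewrite sq (bigD1 i)//= addrCA lerDl addr_ge0//; first by apply: Rintegral_ge0 => x _; exact: sqr_ge0.
by apply: sumr_ge0 => j _; apply: Rintegral_ge0 => x _; exact: sqr_ge0.
Qed.

(** The norms are extended reals; square integrability of [u n] on the boundary is read off from
    their being eventually finite. *)
Lemma cvg_trace (u : nat -> H1 Omega) (phi : L2 (sigma Omega)) :
  (forall n, continuous_up_to_boundary (u n)) ->
  'N[sigma Omega]_2%:E[EFin \o (fun x => (u n x - phi x)%R)]%E @[n --> \oo] --> (0 : \bar R) ->
  forall e, 0 < e -> \forall n \near \oo, l2 (sigma Omega) (fun x : Ts => u n x) /\
    nrm (sigma Omega) (fun x : Ts => u n x - phi x) <= e.
Proof.
move=> cu uphi e e0.
move/fine_cvgP : uphi => [ufin /cvgrPdist_le/(_ _ e0)]; move: ufin.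
apply: filterS2 => n ufin; rewrite sub0r normrN => ue.
have mu_ : measurable_fun setT (fun x : Ts => u n x) by apply: sigma_measurable; exact: cu.
have pl : l2 (sigma Omega) phi := L2_l2 phi.
have mup : measurable_fun setT (fun x : Ts => u n x - phi x).
  exact: measurable_funB mu_ (l2_measurable pl).
have [l nE] := Lnorm_fin_num_l2 mup ufin.
split; last by rewrite nE; apply: le_trans (ler_norm _) ue.
by apply: (l2_le mu_ _ (l2D l pl)) => x; rewrite subrK.
Qed.

Section dissipativity.
Variables (phi psi : L2 (sigma Omega)) (u : H1 Omega) (e : R).
Hypotheses (e0 : 0 < e) (lapl : is_laplacian u 0).

(* The boundary form of the harmonic [u] against [soft_neg e \o v] is the integral of
   [soft_neg' e v * grad u . grad v], which is almost nonnegative if [grad v] is close to [grad u]. *)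
Lemma dot_normal_derivative_ge (v : H1 Omega) : has_normal_derivative u psi ->
  continuous_up_to_boundary v ->
  - (\sum_i nrm mu (H1_grad u i)) * H1_dist v u <=
  \int[sigma Omega]_x (psi x * soft_neg e (v x)).
Proof.
move=> [f [fL fN]] cv; have [w [cw wE gw]] := comp_H1 e0 cv.
have := fN w cw.
have fw0 : \int[mu]_x (f x * w x) = 0.
  apply: test_orthogonal; [exact: L2_l2|exact: L2_l2|] => phi0 tphi.
  rewrite -(fL _ tphi) (lapl tphi); under eq_Rintegral do rewrite mul0r.
  by rewrite /Rintegral integral0.
rewrite fw0 add0r; under [X in _ = X]eq_Rintegral do rewrite wE; move=> <-.
have ul i : l2 mu (H1_grad u i) := L2_l2 (H1_grad u i).
have vl i : l2 mu (H1_grad v i) := L2_l2 (H1_grad v i).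
have wl i : l2 mu (H1_grad w i) := L2_l2 (H1_grad w i).
have iuw i := integrableM (ul i) (wl i).
have [_ ->] := Rintegral_sum (index_enum 'I_d) iuw.
rewrite mulNr mulr_suml -sumrN; apply: ler_sum => i _.
pose s (x : T1) := soft_neg' e (v x).
have ms : measurable_fun setT s.
  apply: (@measurableT_comp _ _ _ _ _ _ (soft_neg' e)).
    by apply: continuous_measurable_fun; exact: continuous_soft_neg'.
  exact: l2_measurable (L2_l2 v).
have s1 x : `|s x| <= 1 := soft_neg'_le1 e0 (v x).
have sul : l2 mu (fun x => s x * H1_grad u i x) := l2M s1 ms (ul i).
have Dl := l2B (vl i) (ul i).
have sDl : l2 mu (fun x => s x * (H1_grad v i x - H1_grad u i x)) := l2M s1 ms Dl.
(* By the chain rule the gradient of [w] is [s] times that of [v]; replacing [v] by [u] leaves a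
   nonnegative term and an error linear in the gradient of the difference. *)
have -> : \int[mu]_x (H1_grad u i x * H1_grad w i x) =
    dot mu (H1_grad u i) (fun x => s x * H1_grad u i x) +
    dot mu (H1_grad u i) (fun x => s x * (H1_grad v i x - H1_grad u i x)).
  rewrite -dotDr//; apply: eq_Rintegral => x _; rewrite gw /s; ring.
apply: (@le_trans _ _ (0 + - (nrm mu (H1_grad u i) * H1_dist v u))); first by rewrite add0r.
apply: lerD.
  by apply: Rintegral_ge0 => x _; rewrite mulrCA mulr_ge0 ?soft_neg'_ge0// -expr2 sqr_ge0.
have /ler_normlP[+ _] := dot_le_nrm (ul i) sDl; rewrite lerNl => h; rewrite lerNl.
apply: le_trans (_ : nrm mu (H1_grad u i) * nrm mu (fun x => s x * (H1_grad v i x - H1_grad u i x)) <= _).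
  by rewrite lerNl.
rewrite ler_wpM2l ?nrm_ge0//; apply: le_trans (nrm_grad_le_H1_dist v u i).
apply: nrm_le => // x; rewrite normrM ler_piMl//.
Qed.

(** The approximants of [u] are inserted in the preceding bound. [soft_neg e] is 1-Lipschitz, so
    their convergence to [phi] on the boundary survives the composition. *)
Lemma dot_soft_neg_ge0 : is_trace u phi -> has_normal_derivative u psi ->
  0 <= dot (sigma Omega) psi (fun x => soft_neg e (phi x)).
Proof.
move=> [un [cun unu unphi]] hN; apply/ler_addgt0Pr => t t0.
have pl : l2 (sigma Omega) phi := L2_l2 phi.
have psl : l2 (sigma Omega) psi := L2_l2 psi.
pose A := \sum_i nrm mu (H1_grad u i); pose B := nrm (sigma Omega) psi.
have A0 : 0 <= A by apply: sumr_ge0 => i _; exact: nrm_ge0.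
have B0 : 0 <= B by exact: nrm_ge0.
have AB : 0 < A + B + 1 by rewrite ltr_wpDl// addr_ge0.
pose s := t / (A + B + 1); have s0 : 0 < s by rewrite divr_gt0.
move/cvgrPdist_le : unu => /(_ _ s0) unu.
have [n [nu [nl np]]] := @filter_ex _ \oo _ _ (filterI unu (cvg_trace cun unphi s0)).
have soft_l2 (f : Ts -> R) : l2 (sigma Omega) f -> l2 (sigma Omega) (fun x => soft_neg e (f x)).
  move=> fl; apply: (l2_le _ _ fl) => [|x]; last exact: soft_neg_le.
  apply: (@measurableT_comp _ _ _ _ _ _ (soft_neg e)); last exact: l2_measurable fl.
  by apply: continuous_measurable_fun; exact: continuous_soft_neg.
have h1 := dot_normal_derivative_ge hN (cun n).
have h2 : `|dot (sigma Omega) psi (fun x : Ts => soft_neg e (un n x)) -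
    dot (sigma Omega) psi (fun x => soft_neg e (phi x))| <= B * s.
  rewrite -(dotBr (soft_l2 _ nl) (soft_l2 _ pl) psl).
  apply: le_trans (dot_le_nrm psl (l2B (soft_l2 _ nl) (soft_l2 _ pl))) _.
  rewrite ler_wpM2l//; apply: le_trans np.
  apply: nrm_le => [||x]; [exact: l2B (soft_l2 _ nl) (soft_l2 _ pl)|exact: l2B|].
  exact: soft_neg_lipschitz.
have h3 : H1_dist (un n) u <= s.
  by move: nu; rewrite sub0r normrN => /(le_trans (ler_norm _)).
have h4 : - (A * s) <= dot (sigma Omega) psi (fun x : Ts => soft_neg e (un n x)).
  by apply: le_trans h1; rewrite -/A mulNr lerN2 ler_wpM2l.
have h5 : (A + B) * s <= t.
  by rewrite /s mulrCA ler_piMr ?(ltW t0)// ler_pdivrMr// mul1r lerDl.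
move: h2; rewrite ler_norml => /andP[_ h2].
by move: h2 h4; set x := dot _ _ _; set y := dot _ _ _; move: h5; rewrite mulrDl; lra.
Qed.

End dissipativity.

Hypothesis sigma_fin : (hausdorff_outer d.-1 (boundary Omega) < +oo)%E.

Let sigma_setT : (sigma Omega setT < +oo)%E.
Proof. by rewrite /sigma /cara_measure /= /outer_restr setTI. Qed.

(** [soft_neg e] is within [e] of minus the negative part uniformly, which on a boundary of finite
    measure is an error O(e) in L_2. *)
Theorem DtN_dissipative (phi psi : L2 (sigma Omega)) : DtN phi psi ->
  dot (sigma Omega) psi (neg_part phi) <= 0.
Proof.
move=> [u [lapl tr hN]]; apply/ler_addgt0Pl => t t0; rewrite addr0.
have pl : l2 (sigma Omega) phi := L2_l2 phi.
have psl : l2 (sigma Omega) psi := L2_l2 psi.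
have one_l2 : l2 (sigma Omega) (fun=> 1).
  by apply: (@l2_bounded _ Ts R _ 1) => // x; rewrite normr1.
pose B := nrm (sigma Omega) psi * nrm (sigma Omega) (fun=> 1).
have B0 : 0 <= B by rewrite mulr_ge0 ?nrm_ge0.
have B1 : 0 < B + 1 by rewrite ltr_wpDl.
pose e := t / (B + 1); have e0 : 0 < e by rewrite divr_gt0.
have := dot_soft_neg_ge0 e0 lapl tr hN.
have soft_l2 : l2 (sigma Omega) (fun x => soft_neg e (phi x)).
  apply: (l2_le _ _ pl) => [|x]; last exact: soft_neg_le.
  apply: (@measurableT_comp _ _ _ _ _ _ (soft_neg e)); last exact: l2_measurable pl.
  by apply: continuous_measurable_fun; exact: continuous_soft_neg.
have negl := l2_neg_part pl.
have suml := l2D soft_l2 negl.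
have := dot_le_nrm psl suml; rewrite (dotDr soft_l2 negl psl) => /(le_trans (ler_norm _)) h1 h2.
have h3 : nrm (sigma Omega) (fun x => soft_neg e (phi x) + neg_part phi x) <=
    e * nrm (sigma Omega) (fun=> 1).
  rewrite -[X in X * _](ger0_norm (ltW e0)) -(nrmZ _ one_l2).
  apply: nrm_le => // [|x]; first exact: l2Z.
  by rewrite mulr1 [leRHS]ger0_norm ?(ltW e0)// soft_neg_dist.
have h4 : nrm (sigma Omega) psi * (e * nrm (sigma Omega) (fun=> 1)) <= t.
  by rewrite mulrCA -/B /e mulrAC ler_pdivrMr// ler_wpM2l ?(ltW t0)// lerDl.
have := ler_wpM2l (nrm_ge0 (sigma Omega) psi) h3; lra.
Qed.

(** The limit of difference quotients is applied to the constant function 1, whose quotients are all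
    0. *)
Lemma int_partial_eq0 i phi : test_function Omega phi -> \int[mu]_x partial i phi x = 0.
Proof.
move=> tphi; have [_ cK KO] := tphi.
have [W [r [oW KW r_gt0 W_room]]] := compact_neighbourhood i open_Omega cK KO.
pose h n := r / n.+1%:R.
have h0 n : 0 < h n by rewrite divr_gt0.
have hr n : h n <= r by rewrite /h ler_pdivrMr// ler_peMr ?(ltW r_gt0)// ler1n.
have hc : h n @[n --> \oo] --> (0 : R).
  by rewrite -[X in _ --> X](mulr0 r); apply: cvgMr; exact: cvg_harmonic.
have supp_room n : closure [set x | phi x != 0] `<=` room i Omega (h n).
  by apply: subset_trans KW _; apply: W_room; rewrite (ltW (h0 n)) hr.
have one1 (x : T1) : `|1 : R| <= 1 by rewrite normr1.
have c1 (x : E) : Omega x -> {for x, continuous (fun _ : E => 1 : R)} by move=> _; exact: cst_continuous.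
have L := @cvg_difference_quotient R d i Omega open_Omega bounded_Omega (fun=> 1) 1
  (measurable_cst _) one1 c1 phi h h0 hc tphi supp_room.
have q0 n : \int[mu]_x ((1 - 1) / h n * phi x) = 0.
  by under eq_Rintegral do rewrite subrr !mul0r; rewrite /Rintegral integral0.
have L0 : \int[mu]_x ((1 - 1) / h n * phi x) @[n --> \oo] --> (0 : R).
  by apply: (cvg_near_cst (0 : R)); apply: nearW => n; rewrite q0.
apply: oppr_inj; rewrite oppr0 -[RHS](cvg_unique (@norm_hausdorff _ _) L L0).
by congr (- _); apply: eq_Rintegral => x _; rewrite mul1r.
Qed.

Theorem DtN_one : DtN (indic_boundary sigma_fin) 0.
Proof.
have one_l2 : l2 mu (fun=> 1).
  by apply: (@bounded_l2_on R d Omega bounded_Omega _ 1) => // x; rewrite normr1.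
have int_eq0 (F : T1 -> R) : (forall x, F x = 0) -> \int[mu]_x F x = 0.
  by move=> F0; rewrite (eq_Rintegral _ (g := fun=> 0)) ?/Rintegral ?integral0// => x _; exact: F0.
have int0 (f : T1 -> R) : \int[mu]_x (0 * f x) = 0 by apply: int_eq0 => x; rewrite mul0r.
pose oneL : L2 mu := Lfun_Sub (lee1n 2) ((l2_Lfun _ _).2 one_l2).
pose zeroL (i : 'I_d) : L2 mu := 0.
have w i : weak_partial Omega i oneL (zeroL i).
  move=> phi tphi; rewrite [X in _ = - X](int0 phi) oppr0 -[RHS](int_partial_eq0 i tphi).
  by apply: eq_Rintegral => x _; rewrite /= mul1r.
pose u : H1 Omega := @Build_H1 R d Omega oneL zeroL w.
have lu : is_laplacian u 0.
  move=> phi tphi; rewrite [RHS](int0 phi).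
  have ipp i : mu.-integrable setT (EFin \o (partial i (partial i phi) : T1 -> R)).
    have tpp := test_partial i (test_partial i tphi).
    by apply: (integrable_eq (integrableM one_l2 (test_l2 bounded_Omega tpp))) => x /=; rewrite mul1r.
  transitivity (\int[mu]_x \sum_i partial i (partial i phi) x).
    by apply: eq_Rintegral => x _; rewrite /= mul1r.
  have [_ ->] := Rintegral_sum (index_enum 'I_d) ipp.
  by apply: big1 => i _; exact: (int_partial_eq0 i (test_partial i tphi)).
exists u; split => //.
- exists (fun=> u); split.
  + by move=> _; apply: continuous_subspaceT => x; exact: cst_continuous.
  + rewrite (_ : H1_dist u u = 0); first exact: cvg_cst.
    rewrite /H1_dist int_eq0; last by move=> x; rewrite subrr expr0n.
    rewrite int_eq0 ?addr0 ?sqrtr0// => x.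
    by rewrite big1// => i _; rewrite subrr expr0n.
  have one_l2s : l2 (sigma Omega) (fun=> 1).
    by apply: (@l2_bounded _ Ts R _ 1) => // x; rewrite normr1.
  (* The H^1 function is 1 on all of R^d while the indicator vanishes off the boundary; the two
     agree almost everywhere for [sigma Omega]. *)
  pose f (x : Ts) : R := 1 - indic_boundary sigma_fin x.
  have fl : l2 (sigma Omega) f by apply: l2B => //; exact: L2_l2.
  have fL := (l2_Lfun _ _).2 fl.
  have ffin : 'N[sigma Omega]_2%:E[EFin \o f]%E \is a fin_num.
    rewrite ge0_fin_numE ?Lnorm_ge0//.
    by move: fL; rewrite inE => /andP[_]; rewrite inE.
  have [_ fE] := Lnorm_fin_num_l2 (l2_measurable fl) ffin.
  have f0 : nrm (sigma Omega) f = 0.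
    apply: nrm_eq0_ae => //; apply: outer_restr_ae => x Bx _.
    by rewrite /f /= indicE mem_set// subrr.
  have N0 : 'N[sigma Omega]_2%:E[EFin \o f]%E = 0%E by rewrite -(fineK ffin) -fE f0.
  by rewrite [X in X @ _](_ : _ = fun=> 0%E) ?N0//; exact: cvg_cst.
exists 0; split => // v cv.
rewrite [X in X + _](int0 v) add0r.
transitivity (0 : R); last first.
  by apply/esym; under eq_Rintegral do rewrite mul0r; rewrite /Rintegral integral0.
by apply: int_eq0 => x; rewrite big1// => i _; rewrite mul0r.
Qed.

End dirichlet_to_neumann.

Theorem proposition3p7 (R : realType) (d : nat) (Omega : set 'rV[R]_d)
  (d_ge2 : (2 <= d)%N)
  (bounded_Omega : bounded_set Omega)
  (connected_Omega : connected Omega)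
  (open_Omega : open Omega)
  (sigma_fin : (hausdorff_outer d.-1 (boundary Omega) < +oo)%E)
  (S : R -> L2 (sigma Omega) -> L2 (sigma Omega))
  (C0_S : C0_semigroup S)
  (gen_S : is_generator S (opp_graph (@DtN R d Omega))) :
  markovian (indic_boundary sigma_fin) S.
Proof.
have d_gt0 : (0 < d)%N by exact: ltn_trans d_ge2.
(* The generator is minus the Dirichlet-to-Neumann operator: [g] stands for its negative at [f],
   which reverses the sign in [DtN_dissipative]. *)
have genE f g : gen S f g <-> DtN f (- g).
  by split => [/genP/gen_S//|h]; apply/genP; exact/gen_S.
have orbitE t f : 0 < t -> orbit S t f = S t f by rewrite /orbit => ->.
move=> t t0; split => [f f0|].
  rewrite -orbitE//; apply: orbit_positive => //; last exact: ltW.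
  move=> g h /genE gh; have := DtN_dissipative open_Omega bounded_Omega d_gt0 sigma_fin gh.
  by rewrite (dotNl (L2_l2 h) (l2_neg_part (L2_l2 g))) oppr_le0.
rewrite -orbitE//; apply: orbit_fixed => //; last exact: ltW.
by apply/genE; rewrite oppr0; exact: DtN_one.
Qed.
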